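(* Let $n \ge 2$ be an integer and $p,q \in \mathbb{N}_0$. Then $$\boldsymbol{\lambda}\big(\mathcal{H}_{p,q}(\mathbb{S}^{n-1})\big)\le\frac{(n+p+q-1)\,\Gamma(n-1+p \wedge q)}{\Gamma(n-1)\Gamma(1+p) \Gamma(1+q)}\sum_{m=0}^{p \wedge q} \binom{p \wedge q}{m} \frac{\Gamma(n-1+m+p \vee q)}{\Gamma(n-1+m)}\int_{0}^{1} (1-t)^{n+m-2}\, t^{\frac{| p-q |}{2}}\, dt.$$ So, if $p\geq q$, $$\boldsymbol{\lambda}\big(\mathcal{H}_{p,q}(\mathbb{S}^{n-1})\big)\leq\frac{\Gamma(n-1+q)}{\Gamma(n-1) \Gamma(1+q)}\sum_{m=0}^{q} \binom{q}{m}(n+p+q-1)\,\frac{\Gamma(n-1+m+p)}{\Gamma(1+p)}\,\frac{\Gamma(\frac{p-q}{2}+1)}{\Gamma(n+m+\frac{p-q}{2})}.$$ In particular, for fixed $q$, $$\limsup_{p \to + \infty} \, \boldsymbol{\lambda}\big(\mathcal{H}_{p,q}(\mathbb{S}^{n-1})\big)\leq \frac{2^{n-1}}{\Gamma(n-1)} \frac{\Gamma(n-1+q)}{\Gamma(1+q)}\sum_{m=0}^{q} \binom{q}{m} 2^{m} = 2^{n-1}3^q\binom{n-2+q}{q}.$$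
   Context: Notation: $p\wedge q=\min\{p,q\}$, $p\vee q=\max\{p,q\}$; $\mathbb{S}^{n-1}=\{z\in\mathbb{C}^n:\|z\|_2=1\}$ is the complex Euclidean sphere. $\mathcal{H}_{p,q}(\mathbb{C}^n)$ is the space of functions $f(z)=\sum_{|\alpha|=p,|\beta|=q}c_{(\alpha,\beta)}z^\alpha\overline{z}^\beta$ on $\mathbb{C}^n$ ($\alpha,\beta\in\mathbb{N}_0^n$, $c_{(\alpha,\beta)}\in\mathbb{C}$) with $\Delta f=0$, where $\Delta=\sum_{j=1}^n\frac{\partial^2}{\partial z_j\partial\overline{z_j}}$. $\mathcal{H}_{p,q}(\mathbb{S}^{n-1})$ is the space of restrictions of these functions to $\mathbb{S}^{n-1}$, with the supremum norm (a subspace of $C(\mathbb{S}^{n-1})$, complex-valued functions). For a Banach space $Y$ and a closed complemented subspace $X\subset Y$, $\boldsymbol{\lambda}(X,Y)$ is the infimum of the norms of all bounded linear projections from $Y$ onto $X$. The (absolute) projection constant of a Banach space $X$ is $\boldsymbol{\lambda}(X)=\sup\boldsymbol{\lambda}(I(X),Y)$, the supremum over all Banach spaces $Y$ and isometric embeddings $I:X\to Y$. If $X$ is a finite-dimensional subspace of $C(K)$, then $\boldsymbol{\lambda}(X)=\boldsymbol{\lambda}(X,C(K))$. *)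

(* Defs.v *)
From HB Require Import structures.
From mathcomp Require Import all_boot all_order all_algebra.
From mathcomp Require Import complex ring.
From mathcomp Require Import all_classical all_reals all_analysis.
Set Implicit Arguments.
Unset Strict Implicit.
Unset Printing Implicit Defensive.
Import Order.TTheory GRing.Theory Num.Theory.
Import numFieldNormedType.Exports.
Local Open Scope classical_set_scope.
Local Open Scope ring_scope.

Section projection_constants.
Variable R : realType.

(* The norm of a normed module over [R[i]] takes values in [R[i]]; it is
   real, and [complex.Re] reads it in [R]. *)
Definition opnorm (Y : normedModType R[i]) (P : Y -> Y) : \bar R :=
  ereal_sup [set (complex.Re `|P y|)%:E | y in [set y : Y | `|y| <= 1]].

Definition bounded_projection_onto (Y : normedModType R[i]) (X : set Y)
    (P : {linear Y -> Y}) : Prop :=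
  [/\ (opnorm P < +oo)%E, range P = X & forall x, X x -> P x = x].

(* The value is +oo when X is not complemented in Y. *)
Definition relative_projection_constant (Y : normedModType R[i]) (X : set Y)
    : \bar R :=
  ereal_inf [set opnorm P | P in [set P : {linear Y -> Y} |
                                   bounded_projection_onto X P]].

Definition projection_constant (X : normedModType R[i]) : \bar R :=
  ereal_sup [set l | exists (Y : completeNormedModType R[i])
                            (J : {linear X -> Y}),
    (forall x, `|J x| = `|x|) /\
    l = relative_projection_constant (range J)].

End projection_constants.

Section spherical_harmonics.
Variables (R : realType) (n : nat).
Local Notation C := R[i].
Local Notation Cn := 'rV[R[i]]_n.

(* Derivative of f at z along v, v being a direction of the real vector space
   underlying C^n. *)
Definition real_deriv (v : Cn) (f : Cn -> C) (z : Cn) : C :=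
  Complex (derive1 (fun t : R => complex.Re (f (z + t%:C%C *: v))) 0)
          (derive1 (fun t : R => complex.Im (f (z + t%:C%C *: v))) 0).

Definition deriv_x (j : 'I_n) : (Cn -> C) -> Cn -> C :=
  real_deriv (delta_mx 0 j).
Definition deriv_y (j : 'I_n) : (Cn -> C) -> Cn -> C :=
  real_deriv ('i%C *: delta_mx 0 j).

Definition deriv_z (j : 'I_n) (f : Cn -> C) (z : Cn) : C :=
  (deriv_x j f z - 'i%C * deriv_y j f z) / 2.
Definition deriv_zbar (j : 'I_n) (f : Cn -> C) (z : Cn) : C :=
  (deriv_x j f z + 'i%C * deriv_y j f z) / 2.

Definition laplacian (f : Cn -> C) (z : Cn) : C :=
  \sum_(j < n) deriv_z j (deriv_zbar j f) z.

(* A multi-index of length p has entries at most p, so the finite type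
   {ffun 'I_n -> 'I_p.+1} contains all of them. *)
Definition bihomogeneous (p q : nat) (f : Cn -> C) : Prop :=
  exists c : {ffun 'I_n -> 'I_p.+1} -> {ffun 'I_n -> 'I_q.+1} -> C,
  forall z, f z =
    \sum_(a : {ffun 'I_n -> 'I_p.+1} | (\sum_j a j)%N == p)
    \sum_(b : {ffun 'I_n -> 'I_q.+1} | (\sum_j b j)%N == q)
      c a b * (\prod_j z 0 j ^+ a j) * (\prod_j (z 0 j)^*%C ^+ b j).

Definition harmonic_bihomogeneous (p q : nat) : set (Cn -> C) :=
  [set f | bihomogeneous p q f /\ forall z, laplacian f z = 0].

Definition l2norm (z : Cn) : R :=
  Num.sqrt (\sum_j complex.Re `|z 0 j| ^+ 2).

Definition sphere : Type := {z : Cn | l2norm z == 1}.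

Definition harmonic_on_sphere (p q : nat) : {pred (sphere -> C)} :=
  [pred g | `[< exists2 f, harmonic_bihomogeneous p q f &
                           g = fun x : sphere => f (val x) >]].

Definition supnorm (g : sphere -> C) : R :=
  sup [set complex.Re `|g x| | x in [set: sphere]].

(* Polynomials in the coordinates and their conjugates; on this class
   [laplacian] is linear and restrictions to the sphere are bounded, which is
   what makes [Hsphere] below a vector space normed by [supnorm]. *)

Inductive zpoly : (Cn -> C) -> Prop :=
| zpoly_cst c : zpoly (fun=> c)
| zpoly_coord j : zpoly (fun z => z 0 j)
| zpoly_conj j : zpoly (fun z => (z 0 j)^*%C)
| zpoly_add f g : zpoly f -> zpoly g -> zpoly (fun z => f z + g z)
| zpoly_mul f g : zpoly f -> zpoly g -> zpoly (fun z => f z * g z).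

Lemma zpoly_sum (I : Type) (r : seq I) (P : pred I) (F : I -> Cn -> C) :
  (forall i, zpoly (F i)) -> zpoly (fun z => \sum_(i <- r | P i) F i z).
Proof.
move=> h; elim: r => [|i r IH].
  rewrite (_ : (fun _ => _) = fun=> 0); first exact: zpoly_cst.
  by apply/funext => z; rewrite big_nil.
case Pi: (P i).
  rewrite (_ : (fun _ => _) =
    fun z => F i z + \sum_(i <- r | P i) F i z); first exact: zpoly_add.
  by apply/funext => z; rewrite big_cons Pi.
rewrite (_ : (fun _ => _) = fun z => \sum_(i <- r | P i) F i z) //.
by apply/funext => z; rewrite big_cons Pi.
Qed.

Lemma zpoly_prod (I : Type) (r : seq I) (F : I -> Cn -> C) :
  (forall i, zpoly (F i)) -> zpoly (fun z => \prod_(i <- r) F i z).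
Proof.
move=> h; elim: r => [|i r IH].
  rewrite (_ : (fun _ => _) = fun=> 1); first exact: zpoly_cst.
  by apply/funext => z; rewrite big_nil.
rewrite (_ : (fun _ => _) = fun z => F i z * \prod_(i <- r) F i z).
  exact: zpoly_mul.
by apply/funext => z; rewrite big_cons.
Qed.

Lemma zpoly_exp f k : zpoly f -> zpoly (fun z => f z ^+ k).
Proof.
move=> h; elim: k => [|k IH].
  rewrite (_ : (fun _ => _) = fun=> 1); first exact: zpoly_cst.
  by apply/funext => z; rewrite expr0.
rewrite (_ : (fun _ => _) = fun z => f z * f z ^+ k); first exact: zpoly_mul.
by apply/funext => z; rewrite exprS.
Qed.

Lemma bihomogeneous_zpoly p q f : bihomogeneous p q f -> zpoly f.
Proof.
case=> c /funext ->; apply: zpoly_sum => a; apply: zpoly_sum => b.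
apply: zpoly_mul.
  apply: zpoly_mul; first exact: zpoly_cst.
  by apply: zpoly_prod => j; apply: zpoly_exp; exact: zpoly_coord.
by apply: zpoly_prod => j; apply: zpoly_exp; exact: zpoly_conj.
Qed.

Let has_real_deriv (v : Cn) (f f' : Cn -> C) := forall z,
  is_derive (0 : R) 1 (fun t : R => complex.Re (f (z + t%:C%C *: v)))
            (complex.Re (f' z)) /\
  is_derive (0 : R) 1 (fun t : R => complex.Im (f (z + t%:C%C *: v)))
            (complex.Im (f' z)).

Lemma has_real_derivE v f f' : has_real_deriv v f f' -> real_deriv v f = f'.
Proof.
move=> h; apply/funext => z; have [h1 h2] := h z.
by rewrite /real_deriv !derive1E !derive_val; case: (f' z).
Qed.

Let ReD (x y : C) : complex.Re (x + y) = complex.Re x + complex.Re y.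
Proof. by case: x y => [? ?] [? ?]. Qed.
Let ImD (x y : C) : complex.Im (x + y) = complex.Im x + complex.Im y.
Proof. by case: x y => [? ?] [? ?]. Qed.
Let ReM (x y : C) : complex.Re (x * y) =
  complex.Re x * complex.Re y - complex.Im x * complex.Im y.
Proof. by case: x y => [? ?] [? ?]. Qed.
Let ImM (x y : C) : complex.Im (x * y) =
  complex.Re x * complex.Im y + complex.Im x * complex.Re y.
Proof. by case: x y => [? ?] [? ?]. Qed.

Let is_derive_affine (a b : R) :
  is_derive (0 : R) 1 (fun t : R => a + t * b) b.
Proof.
apply: is_derive_eq.
by rewrite /GRing.scale /=; ring.
Qed.

Lemma has_real_deriv_add v f f' g g' :
  has_real_deriv v f f' -> has_real_deriv v g g' ->
  has_real_deriv v (fun z => f z + g z) (fun z => f' z + g' z).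
Proof.
move=> hf hg z; have [f1 f2] := hf z; have [g1 g2] := hg z; split.
  under [X in is_derive _ _ X]eq_fun do rewrite ReD.
  rewrite ReD; exact: is_deriveD.
under [X in is_derive _ _ X]eq_fun do rewrite ImD.
rewrite ImD; exact: is_deriveD.
Qed.

Lemma has_real_deriv_mul v f f' g g' :
  has_real_deriv v f f' -> has_real_deriv v g g' ->
  has_real_deriv v (fun z => f z * g z) (fun z => f' z * g z + f z * g' z).
Proof.
move=> hf hg z; have [f1 f2] := hf z; have [g1 g2] := hg z.
have e0 : z + (0 : R)%:C%C *: v = z by rewrite scale0r addr0.
split.
  under [X in is_derive _ _ X]eq_fun do rewrite ReM.
  apply: is_derive_eq; rewrite ?e0 ReD !ReM /GRing.scale /=; ring.
under [X in is_derive _ _ X]eq_fun do rewrite ImM.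
apply: is_derive_eq; rewrite ?e0 ImD !ImM /GRing.scale /=; ring.
Qed.

Lemma zpoly_real_deriv v f : zpoly f ->
  exists2 f', zpoly f' & has_real_deriv v f f'.
Proof.
elim=> {f} [c|j|j|f g _ [f' zf' hf] _ [g' zg' hg]
           |f g zf [f' zf' hf] zg [g' zg' hg]].
- exists (fun=> 0); first exact: zpoly_cst.
  by move=> z; split => /=; exact: is_derive_cst.
- exists (fun=> v 0 j); first exact: zpoly_cst.
  move=> z; split.
    rewrite (_ : (fun _ => _) =
      fun t : R => complex.Re (z 0 j) + t * complex.Re (v 0 j)).
      exact: is_derive_affine.
    by apply/funext => t; rewrite !mxE ReD ReM /= mul0r subr0.
  rewrite (_ : (fun _ => _) =
    fun t : R => complex.Im (z 0 j) + t * complex.Im (v 0 j)).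
    exact: is_derive_affine.
  by apply/funext => t; rewrite !mxE ImD ImM /= mul0r addr0.
- exists (fun=> (v 0 j)^*%C); first exact: zpoly_cst.
  move=> z; split.
    rewrite (_ : (fun _ => _) =
      fun t : R => complex.Re (z 0 j) + t * complex.Re ((v 0 j)^*%C)).
      exact: is_derive_affine.
    apply/funext => t; rewrite !mxE.
    by case: (z 0 j) (v 0 j) => [? ?] [? ?] /=; rewrite mul0r subr0.
  rewrite (_ : (fun _ => _) =
    fun t : R => complex.Im ((z 0 j)^*%C) + t * complex.Im ((v 0 j)^*%C)).
    exact: is_derive_affine.
  apply/funext => t; rewrite !mxE.
  by case: (z 0 j) (v 0 j) => [? ?] [? ?] /=; ring.
- exists (fun z => f' z + g' z); first exact: zpoly_add.
  exact: has_real_deriv_add.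
- exists (fun z => f' z * g z + f z * g' z).
    by apply: zpoly_add; exact: zpoly_mul.
  exact: has_real_deriv_mul.
Qed.

Lemma real_deriv_zpoly v f : zpoly f -> zpoly (real_deriv v f).
Proof. by move=> /(zpoly_real_deriv v)[f' zf' /has_real_derivE ->]. Qed.

Lemma real_deriv_lin v a f g : zpoly f -> zpoly g ->
  real_deriv v (fun z => a * f z + g z) =
  fun z => a * real_deriv v f z + real_deriv v g z.
Proof.
move=> /(zpoly_real_deriv v)[f' _ hf] /(zpoly_real_deriv v)[g' _ hg].
rewrite (has_real_derivE hf) (has_real_derivE hg).
rewrite (has_real_derivE (f' := fun z => (0 * f z + a * f' z) + g' z)).
  by apply/funext => z; rewrite mul0r add0r.
apply: has_real_deriv_add => //; apply: has_real_deriv_mul => //.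
by move=> z; split => /=; exact: is_derive_cst.
Qed.

Lemma deriv_zbar_zpoly j f : zpoly f -> zpoly (deriv_zbar j f).
Proof.
move=> zf; apply: (@zpoly_mul (fun z => _ + _) (fun=> _)); last first.
  exact: zpoly_cst.
apply: zpoly_add; first exact: real_deriv_zpoly.
apply: (@zpoly_mul (fun=> _)); first exact: zpoly_cst.
exact: real_deriv_zpoly.
Qed.

Let lin_comb (F : fieldType) (a i x y u v : F) :
  ((a * x + u) + i * (a * y + v)) / 2 =
  a * ((x + i * y) / 2) + (u + i * v) / 2.
Proof. ring. Qed.

Let lin_comb_sub (F : fieldType) (a i x y u v : F) :
  ((a * x + u) - i * (a * y + v)) / 2 =
  a * ((x - i * y) / 2) + (u - i * v) / 2.
Proof. ring. Qed.

Lemma laplacian_lin a f g z : zpoly f -> zpoly g ->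
  laplacian (fun z => a * f z + g z) z = a * laplacian f z + laplacian g z.
Proof.
move=> zf zg; rewrite /laplacian mulr_sumr -big_split /=.
apply: eq_bigr => j _.
have -> : deriv_zbar j (fun z => a * f z + g z) =
    fun z => a * deriv_zbar j f z + deriv_zbar j g z.
  apply/funext => y; rewrite /deriv_zbar /deriv_x /deriv_y.
  by rewrite !real_deriv_lin// lin_comb.
have zf' := deriv_zbar_zpoly j zf; have zg' := deriv_zbar_zpoly j zg.
by rewrite /deriv_z /deriv_x /deriv_y !real_deriv_lin// lin_comb_sub.
Qed.

Lemma harmonic_on_sphere_submod p q : submod_closed (harmonic_on_sphere p q).
Proof.
have lin a f g : harmonic_bihomogeneous p q f -> harmonic_bihomogeneous p q g ->
    harmonic_bihomogeneous p q (fun z => a * f z + g z).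
  move=> [bf lf] [bg lg]; split; last first.
    move=> z; rewrite laplacian_lin; [|exact: bihomogeneous_zpoly bf
                                      |exact: bihomogeneous_zpoly bg].
    by rewrite lf lg mulr0 addr0.
  case: bf bg => [c hc] [d hd]; exists (fun x y => a * c x y + d x y) => z.
  rewrite hc hd mulr_sumr -big_split; apply: eq_bigr => x _ /=.
  by rewrite mulr_sumr -big_split; apply: eq_bigr => y _ /=; ring.
have h0 : harmonic_bihomogeneous p q (fun=> 0).
  split.
    exists (fun _ _ => 0) => z; rewrite big1// => x _; rewrite big1// => y _.
    by rewrite !mul0r.
  move=> z; have z0 : zpoly (fun=> 0) by exact: zpoly_cst.
  have := laplacian_lin (-1) z z0 z0.
  rewrite (_ : (fun=> -1 * 0 + 0) = (fun=> 0)); last first.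
    by apply/funext => ?; rewrite mulr0 addr0.
  by move=> ->; rewrite mulN1r addNr.
split; first by apply/asboolP; exists (fun=> 0); first exact: h0.
move=> a u v /asboolP[f hf ->] /asboolP[g hg ->]; apply/asboolP.
exists (fun z => a * f z + g z); first exact: lin.
by apply/funext => x; rewrite addrfctE scalrfctE.
Qed.

HB.instance Definition _ p q := GRing.isSubmodClosed.Build _ _
  (harmonic_on_sphere p q) (harmonic_on_sphere_submod p q).

Record Hsphere (p q : nat) : Type :=
  MkHsphere { Hfun :> sphere -> C; _ : Hfun \in harmonic_on_sphere p q }.

HB.instance Definition _ p q := [isSub for @Hfun p q].
HB.instance Definition _ p q := [Choice of Hsphere p q by <:].
HB.instance Definition _ p q := [SubChoice_isSubLmodule of Hsphere p q by <:].

Let nm (x : C) : R := complex.Re `|x|.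
Let nmE (x : C) : `|x| = (nm x)%:C%C.
Proof. by rewrite /nm normc_def. Qed.
Let nm_ge0 (x : C) : 0 <= nm x.
Proof. by rewrite /nm normc_def sqrtr_ge0. Qed.
Let nmD (x y : C) : nm (x + y) <= nm x + nm y.
Proof. by rewrite -lecR rmorphD /= -!nmE ler_normD. Qed.
Let nmM (x y : C) : nm (x * y) = nm x * nm y.
Proof. by apply: (@complexI R); rewrite rmorphM /= -!nmE normrM. Qed.
Let nm0_eq0 (x : C) : nm x = 0 -> x = 0.
Proof. by move=> h; apply/eqP; rewrite -normr_eq0 nmE h. Qed.

Let sphere_coord (x : sphere) j : nm (val x 0 j) <= 1.
Proof.
have /eqP hx := valP x.
have s_ge0 : 0 <= \sum_j nm (val x 0 j) ^+ 2.
  by apply: sumr_ge0 => i _; exact: sqr_ge0.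
have s1 : \sum_j nm (val x 0 j) ^+ 2 = 1.
  by rewrite -(sqr_sqrtr s_ge0) (hx : Num.sqrt _ = 1) expr1n.
rewrite -(@ler_pXn2r _ 2)// ?nnegrE ?nm_ge0//.
rewrite expr1n -[leRHS]s1 (bigD1 j)//= lerDl.
by apply: sumr_ge0 => i _; exact: sqr_ge0.
Qed.

Lemma zpoly_bounded f : zpoly f ->
  exists M, forall x : sphere, complex.Re `|f (val x)| <= M.
Proof.
elim=> {f} [c|j|j|f g _ [M hM] _ [N hN]|f g _ [M hM] _ [N hN]].
- by exists (nm c).
- by exists 1 => x; exact: sphere_coord.
- exists 1 => x; rewrite normcJ; exact: sphere_coord.
- exists (M + N) => x; apply: le_trans (nmD _ _) _.
  by apply: lerD; [exact: hM|exact: hN].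
- exists (M * N) => x; rewrite [leLHS]nmM.
  apply: ler_pM; [exact: nm_ge0|exact: nm_ge0|exact: hM|exact: hN].
Qed.

Section norm.
Variables p q : nat.
Implicit Types g : Hsphere p q.

Let nm_le_supnorm g x : nm (g x) <= supnorm g.
Proof.
apply: ub_le_sup; last by exists x.
case: g => g /= /asboolP[f [/bihomogeneous_zpoly/zpoly_bounded[M hM] _] ->].
by exists M => _ [y _ <-]; exact: hM.
Qed.

Let supnorm_le g (M : R) : 0 <= M -> (forall x, nm (g x) <= M) ->
  supnorm g <= M.
Proof.
move=> M0 hM; rewrite /supnorm; set A := (X in sup X).
have [->|/set0P A0] := eqVneq A set0; first by rewrite sup0.
by apply: ge_sup => // _ [x _ <-]; exact: hM.
Qed.

Let supnorm_ge0 g : 0 <= supnorm g.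
Proof.
rewrite /supnorm; set A := (X in sup X).
have [->|/set0P[_ [x _ _]]] := eqVneq A set0; first by rewrite sup0.
exact: le_trans (nm_ge0 _) (nm_le_supnorm g x).
Qed.

Let HsphereD g h x : (g + h) x = g x + h x. Proof. by []. Qed.
Let HsphereZ (a : C) g x : (a *: g) x = a * g x. Proof. by []. Qed.

Let norm_ler_normD g h :
  (supnorm (g + h))%:C%C <= (supnorm g)%:C%C + (supnorm h)%:C%C.
Proof.
rewrite -rmorphD lecR; apply: supnorm_le => [|x].
  by rewrite addr_ge0 ?supnorm_ge0.
by rewrite HsphereD; apply: le_trans (nmD _ _) _; apply: lerD.
Qed.

Let norm_normr0_eq0 g : (supnorm g)%:C%C = 0 -> g = 0.
Proof.
move=> /(@complexI R) g0; apply: val_inj; apply/funext => x.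
apply: nm0_eq0; apply/eqP; rewrite eq_le nm_ge0 andbT -g0.
exact: nm_le_supnorm.
Qed.

Let supnormZ_le (a : C) g : supnorm (a *: g) <= nm a * supnorm g.
Proof.
apply: supnorm_le => [|x]; first by rewrite mulr_ge0 ?nm_ge0 ?supnorm_ge0.
by rewrite HsphereZ nmM ler_wpM2l ?nm_ge0.
Qed.

Let norm_normrZ (a : C) g :
  (supnorm (a *: g))%:C%C = `|a| * (supnorm g)%:C%C.
Proof.
rewrite nmE -rmorphM; congr (_%:C)%C; apply/eqP; rewrite eq_le supnormZ_le /=.
have [->|a0] := eqVneq a 0.
  by rewrite /nm normr0 mul0r; exact: (supnorm_ge0 (0 *: g)).
have na0 : 0 < nm a.
  by rewrite lt_neqAle nm_ge0 andbT eq_sym; apply: contra_neq a0 => /nm0_eq0.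
rewrite -ler_pdivlMl//.
have -> : (nm a)^-1 = nm a^-1.
  apply: (mulfI (lt0r_neq0 na0)); rewrite mulfV ?lt0r_neq0// -nmM mulfV//.
  by rewrite /nm normr1.
have := supnormZ_le a^-1 (a *: g).
by rewrite scalerA (mulVf a0) scale1r; apply.
Qed.

HB.instance Definition _ := @Lmodule_isNormed.Build C (Hsphere p q)
  (fun g => (supnorm g)%:C%C) norm_ler_normD norm_normrZ norm_normr0_eq0.

End norm.

End spherical_harmonics.

(* Only meant for x > 0, where the integral converges. *)
Definition Gamma (R : realType) (x : R) : R :=
  \int[lebesgue_measure]_(t in `]0, +oo[) (t `^ (x - 1) * expR (- t)).

(* Main.v *)
Require Import Defs.
From HB Require Import structures.
From mathcomp Require Import all_boot all_order all_algebra.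
From mathcomp Require Import complex.
From mathcomp Require Import spectral sesquilinear ring lra zify.
From mathcomp Require Import all_classical all_reals all_analysis.
From mathcomp Require Import measurable_realfun.
Set Implicit Arguments.
Unset Strict Implicit.
Unset Printing Implicit Defensive.
Import Order.TTheory GRing.Theory Num.Theory.
Import numFieldNormedType.Exports.
Local Open Scope classical_set_scope.
Local Open Scope ring_scope.

(* Extend the evaluation functionals g |-> g(x) of H_{p,q} from the copy
   of H_{p,q} in Y to Y by Hahn-Banach; together they map Y into bounded
   functions on the sphere with norm 1.  Compose with the reproducing operator
   of H_{p,q}, whose integral is replaced by a finite positive quadrature on
   the sphere that is exact up to a given degree, so that it acts on arbitrary
   functions.  The norm of the projection obtained is at most the mean of
   |K(z, .)|, where K is the reproducing kernel.

   The quadrature comes from Gauss-Laguerre nodes for the squared moduli and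
   roots of unity for the phases of the coordinates of a complex Gaussian
   vector; integration by parts for the Gaussian gives
   k (n-1+k) M(h) = M(Laplacian h) for the mean M on the sphere and h of
   bidegree (k, k).  That identity alone yields the reproducing property: only
   the leading term of K in powers of <z,w> matters.

   Up to a factor, K is <z,w>^(p-q) times the Jacobi polynomial in
   1 - |<z,w>|^2 with alternating coefficients; taking absolute values term by
   term gives the bound, after |<z,w>|^|p-q| has been approximated from above by
   polynomials in |<z,w>|^2 (needed when p - q is odd). *)

(** * Quadrature for the complex Gaussian *)

(** Writing p = k + d1 and q = k + d2 with [d1 * d2 = 0] makes k the smaller of p and q and d1 + d2
    = |p - q|, and treats both orders at once. On the sphere the kernel is a monomial times an
    expansion in powers of 1 - |<z,w>|^2, which is nonnegative by Cauchy-Schwarz; so the triangle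
    inequality costs only the signs of the coefficients, and the sum over m in the bound is this
    expansion. Under the invariant mean, |<z,w>|^2 has density (n-1) (1-t)^(n-2) on [0, 1], the
    source of the integrals. The quadrature sees this density only through finitely many moments,
    and its degree must exceed that of the polynomial majorant of s^|p-q|. Nodes and projection
    therefore change with the majorant; only the bounds converge, and the estimate is reached up to
    an arbitrary error e. The Gaussian has independent coordinates, so its rule is a product of
    one-dimensional ones; rescaling the nodes to norm 1 carries exactness over to the sphere. As p
    grows, term m is, up to factors free of p, a product of n - 1 + m quotients of affine functions
    of p with slopes 1 and 1/2, whence the powers of 2. *)

Section exponential_quadrature.
Local Open Scope sesquilinear_scope.

(* The Jacobi matrix of the Laguerre polynomials is [B *m B^T]; it maps
   [a`! 'C(a, k)]_k, the coordinates of [x ^ a] in the Laguerre basis, to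
   [a.+1`! 'C(a.+1, k)]_k. *)
Lemma exponential_quadrature (C : numClosedFieldType) (N : nat) :
  exists x c : 'I_N.+1 -> C,
  [/\ forall i, 0 <= x i, forall i, 0 <= c i &
      forall a, (a <= N)%N -> \sum_i c i * x i ^+ a = a`!%:R].
Proof.
pose s k : C := sqrtC k%:R.
have s2 k : s k * s k = k%:R by rewrite -expr2 sqrtCK.
have sJ k : (s k)^* = s k by apply/CrealP; rewrite ger0_real // sqrtC_ge0 ler0n.
(* The lower bidiagonal Cholesky factor: [B *m B^T] has diagonal 2i + 1 and off-diagonal i + 1. The
   factored form makes the eigenvalues, hence the nodes, nonnegative. *)
pose B : 'M[C]_N.+1 := \matrix_(i, j)
  ((i == j)%:R * s i.+1 + (i == j.+1 :> nat)%:R * s i).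
pose J : 'M[C]_N.+1 := B *m B ^t Num.conj.
have BJ : B ^ Num.conj = B.
  by apply/matrixP => i j; rewrite !mxE rmorphD !rmorphM !rmorph_nat /= !sJ.
have JE : J = B *m B^T by rewrite /J -map_trmx BJ.
have Jh : J \is hermsymmx.
  apply/is_hermitianmxP; rewrite expr0 scale1r JE trmx_mul trmxK.
  by rewrite map_mxM -map_trmx BJ.
pose v a : 'cV[C]_N.+1 := \col_k (a`! * 'C(a, k))%:R.
(* Truncation to N + 1 rows does no harm for a < N: the missing row would meet 'C(a, N + 1) = 0. *)
have Jv a : (a < N)%N -> J *m v a = v a.+1.
  move=> aN; have y k : (B^T *m v a) k 0 = s k.+1 * (a`! * 'C(a.+1, k.+1))%:R.
    rewrite !mxE; under eq_bigr do rewrite !mxE mulrDl -!mulrA.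
    rewrite big_split /= (bigD1 k) //= big1 => [|i ik]; last by rewrite (negbTE ik) mul0r.
    rewrite eqxx mul1r addr0 binS mulnDr natrD mulrDr addrC; congr (_ + _).
    have [kN|kN] := ltnP k.+1 N.+1.
      rewrite (bigD1 (Ordinal kN)) //= eqxx big1 ?mul1r ?addr0 // => i ik.
      by rewrite -val_eqE /= in ik; rewrite (negbTE ik) mul0r.
    rewrite bin_small ?muln0 ?mulr0; last by rewrite (leq_trans _ kN)// ltnW.
    rewrite big1// => i _; case: eqP => [ik|]; last by rewrite mul0r.
    by move: kN; rewrite -ik leqNgt ltn_ord.
  apply/colP => k; rewrite JE -mulmxA !mxE.
  under eq_bigr do rewrite y !mxE mulrDl -!mulrA.
  rewrite big_split /= (bigD1 k) //= big1 => [|i ik]; last first.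
    by rewrite eq_sym (negbTE ik) mul0r.
  rewrite eqxx mul1r addr0 !mulrA s2.
  have -> : \sum_(i < N.+1) (k == i.+1 :> nat)%:R * (s k * (s i.+1 * (a`! * 'C(a.+1, i.+1))%:R))
      = (k * (a`! * 'C(a.+1, k)))%:R.
    case: (posnP k) => [k0|k0].
      by rewrite k0 big1 // => i _; rewrite mul0r.
    have kN : (k.-1 < N.+1)%N by rewrite (leq_ltn_trans (leq_pred _)).
    rewrite (bigD1 (Ordinal kN)) //= prednK // eqxx mul1r mulrA s2 -natrM.
    rewrite big1 ?addr0// => i; rewrite -val_eqE /= => ik.
    case: eqP => [ki|]; last by rewrite mul0r.
    by rewrite ki eqxx in ik.
  rewrite -natrM -natrD; congr (_%:R).
  rewrite factS mulnCA mul_bin_left.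
  have [ka|ka] := leqP k a.+1; first by
    rewrite [(k * _)%N]mulnCA -mulnDr -mulnDl subnK// mulnA [(_ * a`!)%N]mulnC.
  by rewrite bin_small// !muln0.
pose P := spectralmx J; pose d := spectral_diag J.
have Pu : P \is unitarymx := spectral_unitarymx J.
have PP : P *m P ^t Num.conj = 1%:M by apply/unitarymxP.
have PP' : P ^t Num.conj *m P = 1%:M by apply: mulmx1C.
have Jd : P *m J = diag_mx d *m P.
  have /hermitian_normalmx/orthomx_spectralP {1}-> := Jh.
  by rewrite -/P -/d !mulmxA mulmxV ?mul1mx// unitarymx_unit.
(* The nodes are the eigenvalues of J, the weights the squared moduli of the components of the
   eigenvectors at index 0. The a-th moment is then the entry (0, 0) of J^a, which is entry 0 of
   [v a], namely a!. *)
exists (d 0), (fun i => P i 0 * (P i 0)^*); split.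
- move=> i; have : (P *m J *m P ^t Num.conj) i i = d 0 i.
    by rewrite Jd -mulmxA PP mulmx1 mxE eqxx mulr1n.
  rewrite /J mulmxA -mulmxA -map_mxM -trmx_mul => <-.
  by rewrite mxE; apply: sumr_ge0 => k _; rewrite !mxE mul_conjC_ge0.
- by move=> i; rewrite mul_conjC_ge0.
- move=> a aN; have Pv : forall i, (P *m v a) i 0 = d 0 i ^+ a * P i 0.
    elim: a aN => [_ i|a IH aN i].
      rewrite expr0 mul1r mxE (bigD1 0) //= big1 => [|k k0].
        by rewrite addr0 mxE mulr1.
      by rewrite mxE bin0n -val_eqE /= in k0 *; rewrite (negbTE k0) muln0 mulr0.
    have -> : P *m v a.+1 = diag_mx d *m (P *m v a).
      by rewrite -(Jv a)// mulmxA Jd mulmxA.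
    by rewrite mul_diag_mx mxE IH 1?ltnW// exprS mulrA.
  have : v a 0 0 = a`!%:R by rewrite mxE bin0 muln1.
  rewrite -[v a]mul1mx -PP' -mulmxA mxE => <-; apply: eq_bigr => i _.
  by rewrite Pv !mxE; ring.
Qed.

End exponential_quadrature.

(** Repeated square roots of -1: an order that divides 2^(k+1), for an element whose power 2^k is
    -1, can only be 2^(k+1). Since N < 2^N, such orders suffice for every degree. *)
Lemma dyadic_prim_root (C : numClosedFieldType) (k : nat) :
  exists z : C, (2 ^ k).-primitive_root z.
Proof.
case: k => [|k].
  have [m h] := @prim_order_exists C 1 1 isT (expr1n _ 1).
  by rewrite dvdn1 => /eqP m1; exists 1; rewrite -[(2 ^ 0)%N]m1.
have [z zk] : exists z : C, z ^+ (2 ^ k) = -1.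
  elim: k => [|k [z zk]]; first by exists (-1); rewrite expr1.
  by exists (sqrtC z); rewrite expnS exprM sqrtCK.
exists z; have zM : z ^+ (2 ^ k.+1) = 1.
  by rewrite expnSr exprM zk sqrrN expr1n.
have [m zm /dvdn_pfactor -/(_ isT)[j jk mE]] := prim_order_exists (expn_gt0 2 k.+1) zM.
move: jk; rewrite leq_eqVlt => /predU1P[<-|jk]; first by rewrite -mE.
have : z ^+ (2 ^ k) = 1.
  by apply: (expr_dvd (prim_expr_order zm)); rewrite mE dvdn_exp2l.
rewrite zk => /eqP; rewrite -subr_eq0 -opprD oppr_eq0.
by rewrite (_ : 1 + 1 = 2%:R)// pnatr_eq0.
Qed.

(** Orthogonality of the characters of a cyclic group: the geometric sum of x = z^(a-b). The bounds
    a, b < M turn congruence modulo M into equality. *)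
Lemma sum_prim_root (C : numClosedFieldType) (M : nat) (z : C) a b :
  M.-primitive_root z -> (a < M)%N -> (b < M)%N ->
  \sum_(j < M) (z ^+ j) ^+ a * ((z ^+ j)^*) ^+ b = (a == b)%:R * M%:R.
Proof.
move=> zM aM bM; have M0 := prim_order_gt0 zM.
have nz : `|z| = 1.
  by apply/eqP; rewrite -(@pexpr_eq1 _ _ M)// -normrX (prim_expr_order zM) normr1.
have zz : z * z^* = 1 by rewrite -normCK nz expr1n.
pose x := z ^+ a * (z^*) ^+ b.
have -> : \sum_(j < M) (z ^+ j) ^+ a * ((z ^+ j)^*) ^+ b = \sum_(j < M) x ^+ j.
  by apply: eq_bigr => j _; rewrite rmorphXn /= exprAC [(z^* ^+ j) ^+ b]exprAC -exprMn.
have [ab|ab] := eqVneq a b.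
  rewrite mul1r /x ab -exprMn zz expr1n; under eq_bigr do rewrite expr1n.
  by rewrite sumr_const card_ord.
rewrite mul0r; apply/eqP; have xM : x ^+ M = 1.
  rewrite /x exprMn -!exprM mulnC [(b * M)%N]mulnC !exprM -rmorphXn /=.
  by rewrite (prim_expr_order zM) rmorph1 !expr1n mul1r.
have := subrX1 x M; rewrite xM subrr => /esym/eqP; rewrite mulf_eq0 => /orP[|//].
rewrite subr_eq0 => /eqP x1; case/eqP: ab; apply/eqP.
have := eq_prim_root_expr zM a b; rewrite !modn_small// => <-.
by rewrite -[z ^+ b]mul1r -x1 /x -mulrA -exprMn [z^* * z]mulrC zz expr1n mulr1.
Qed.

(** A standard complex Gaussian is the square root of an exponential variable times an independent
    uniform phase; each factor is replaced by its own rule. *)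
Lemma gaussian_quadrature (C : numClosedFieldType) (N : nat) :
  exists (T : finType) (c x : T -> C), (forall t, 0 <= c t) /\
  forall a b, (a <= N)%N -> (b <= N)%N ->
    \sum_t c t * (x t ^+ a * (x t)^* ^+ b) = (a == b)%:R * a`!%:R.
Proof.
have [y [c [y0 c0 hy]]] := exponential_quadrature C N.
have [z zM] := dyadic_prim_root C N.
pose M := (2 ^ N)%N; have NM : (N < M)%N := ltn_expl N (ltnSn 1).
have M0 : M%:R != 0 :> C by rewrite pnatr_eq0 -lt0n (leq_trans _ NM).
exists ('I_N.+1 * 'I_M)%type, (fun t : 'I_N.+1 * 'I_M => c t.1 / M%:R),
  (fun t : 'I_N.+1 * 'I_M => sqrtC (y t.1) * z ^+ t.2).
split=> [t|a b aN bN]; first by rewrite divr_ge0// ler0n.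
rewrite -(pair_bigA _ (fun (i : 'I_N.+1) (j : 'I_M) => c i / M%:R *
  ((sqrtC (y i) * z ^+ j) ^+ a * (sqrtC (y i) * z ^+ j)^* ^+ b)))/=.
transitivity (\sum_i c i / M%:R * (sqrtC (y i) ^+ a * sqrtC (y i) ^+ b) *
    \sum_(j < M) (z ^+ j) ^+ a * ((z ^+ j)^*) ^+ b).
  apply: eq_bigr => i _; rewrite mulr_sumr; apply: eq_bigr => j _.
  have sJ : (sqrtC (y i))^* = sqrtC (y i).
    by apply/CrealP; rewrite ger0_real // sqrtC_ge0.
  by rewrite rmorphM /= sJ !exprMn; ring.
rewrite sum_prim_root ?(leq_ltn_trans _ NM)//.
have [<-|_] := eqVneq a b; last first.
  by rewrite !mul0r; apply: big1 => i _; rewrite mulr0.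
rewrite !mul1r -(hy a)//; apply: eq_bigr => i _.
by rewrite -exprMn -expr2 sqrtCK mulrAC divfK.
Qed.

(** * Wirtinger calculus *)

Section wirtinger.
Variables (R : realType) (n : nat).
Local Notation C := R[i].
Local Notation Cn := 'rV[R[i]]_n.
Local Notation zpoly := (@zpoly R n).
Implicit Types (f g : Cn -> C) (v z : Cn) (d : (Cn -> C) -> Cn -> C).

(** First-order operators with constant coefficients: constant values on the coordinates and their
    conjugates are what makes any two of them commute. The sum and product rules are asked on
    [zpoly] only, because [real_deriv] returns default values on functions that are not
    differentiable. *)
Definition derivation d := [/\ forall c, d (fun=> c) = (fun=> 0),
  forall j, exists c, d (fun z => z 0 j) = (fun=> c),
  forall j, exists c, d (fun z => (z 0 j)^*%C) = (fun=> c),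
  forall f g, zpoly f -> zpoly g ->
    d (fun z => f z + g z) = (fun z => d f z + d g z) &
  forall f g, zpoly f -> zpoly g ->
    d (fun z => f z * g z) = (fun z => d f z * g z + f z * d g z)].

Lemma zpoly_derivation d f : derivation d -> zpoly f -> zpoly (d f).
Proof.
move=> [dc dz db dD dM]; elim=> {f} [c|j|j|f g zf df zg dg|f g zf df zg dg].
- by rewrite dc; exact: zpoly_cst.
- by have [c ->] := dz j; exact: zpoly_cst.
- by have [c ->] := db j; exact: zpoly_cst.
- by rewrite dD//; exact: zpoly_add.
- by rewrite dM//; apply: zpoly_add; exact: zpoly_mul.
Qed.

Lemma derivationC d e f : derivation d -> derivation e -> zpoly f ->
  d (e f) = e (d f).
Proof.
move=> hd he; have [dc dz db dD dM] := hd; have [ec ez eb eD eM] := he.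
elim=> {f} [c|j|j|f g zf df zg dg|f g zf df zg dg].
- by rewrite dc ec dc.
- by have [c ->] := dz j; have [c' ->] := ez j; rewrite dc ec.
- by have [c ->] := db j; have [c' ->] := eb j; rewrite dc ec.
- have zdf := zpoly_derivation hd zf; have zdg := zpoly_derivation hd zg.
  have zef := zpoly_derivation he zf; have zeg := zpoly_derivation he zg.
  by rewrite eD// dD// dD// eD// df dg.
- have zdf := zpoly_derivation hd zf; have zdg := zpoly_derivation hd zg.
  have zef := zpoly_derivation he zf; have zeg := zpoly_derivation he zg.
  rewrite eM// dM// dD//; [|exact: zpoly_mul..].
  rewrite eD//; [|exact: zpoly_mul..].
  by rewrite !dM// !eM// df dg; apply/funext => z; ring.
Qed.

Lemma derivation_lin d e (a b : C) : derivation d -> derivation e ->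
  derivation (fun f z => a * d f z + b * e f z).
Proof.
move=> [dc dz db dD dM] [ec ez eb eD eM]; split=> [c|j|j|f g zf zg|f g zf zg].
- by rewrite dc ec; apply/funext => z; ring.
- by have [c ->] := dz j; have [c' ->] := ez j; exists (a * c + b * c').
- by have [c ->] := db j; have [c' ->] := eb j; exists (a * c + b * c').
- by rewrite dD// eD//; apply/funext => z; ring.
- by rewrite dM// eM//; apply/funext => z; ring.
Qed.

Lemma derivation0 : derivation (fun _ _ => 0).
Proof.
split=> [c|j|j|f g _ _|f g _ _] //; try by exists 0.
- by apply/funext => z; rewrite addr0.
- by apply/funext => z; rewrite mul0r mulr0 addr0.
Qed.

Lemma derivation_sum (I : Type) (r : seq I) (a : I -> C) D :
  (forall i, derivation (D i)) ->
  derivation (fun f z => \sum_(i <- r) a i * D i f z).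
Proof.
move=> hD; elim: r => [|i r IH].
  rewrite (_ : (fun _ => _) = fun _ _ => 0); first exact: derivation0.
  by apply/funext => f; apply/funext => z; rewrite big_nil.
rewrite (_ : (fun _ => _) =
  fun f z => a i * D i f z + 1 * \sum_(i <- r) a i * D i f z).
  exact: derivation_lin.
by apply/funext => f; apply/funext => z; rewrite big_cons mul1r.
Qed.

Lemma derivation_big d (I : Type) (r : seq I) (F : I -> Cn -> C) :
  derivation d -> (forall i, zpoly (F i)) ->
  d (fun z => \sum_(i <- r) F i z) = fun z => \sum_(i <- r) d (F i) z.
Proof.
move=> [d0 _ _ dD _] zF; elim: r => [|i r IH].
  rewrite (_ : (fun z => _) = fun=> 0); last by apply/funext => z; rewrite big_nil.
  by rewrite d0; apply/funext => z; rewrite big_nil.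
rewrite (_ : (fun z => _) = fun z => F i z + \sum_(i <- r) F i z); last first.
  by apply/funext => z; rewrite big_cons.
rewrite dD//; last exact: zpoly_sum.
by rewrite IH; apply/funext => z; rewrite big_cons.
Qed.

Lemma derivation_exp d f k : derivation d -> zpoly f ->
  d (fun z => f z ^+ k) = fun z => k%:R * f z ^+ k.-1 * d f z.
Proof.
move=> [d0 _ _ _ dM] zf; elim: k => [|k IH].
  rewrite (_ : (fun z => _) = fun=> 1) ?d0//.
  by apply/funext => z; rewrite !mul0r.
rewrite (_ : (fun z => _) = fun z => f z * f z ^+ k); last first.
  by apply/funext => z; rewrite exprS.
rewrite dM//; last exact: zpoly_exp.
rewrite IH; apply/funext => z /=; move: (d f z) (f z) => x y.
by case: k {IH} => [|k]; rewrite /= ?exprS; ring.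
Qed.

Lemma is_derive_affine (a b : R) :
  is_derive (0 : R) 1 (fun t : R => a + t * b) b.
Proof. by apply: is_derive_eq; rewrite /GRing.scale /=; ring. Qed.

Lemma real_deriv_coord v j : real_deriv v (fun z => z 0 j) = fun=> v 0 j.
Proof.
apply: has_real_derivE => z; split.
  rewrite (_ : (fun _ => _) =
    fun t : R => complex.Re (z 0 j) + t * complex.Re (v 0 j)).
    exact: is_derive_affine.
  apply/funext => t; rewrite !mxE.
  by case: (z 0 j) (v 0 j) => [? ?] [? ?] /=; ring.
rewrite (_ : (fun _ => _) =
  fun t : R => complex.Im (z 0 j) + t * complex.Im (v 0 j)).
  exact: is_derive_affine.
apply/funext => t; rewrite !mxE.
by case: (z 0 j) (v 0 j) => [? ?] [? ?] /=; ring.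
Qed.

Lemma real_deriv_conj v j :
  real_deriv v (fun z => (z 0 j)^*%C) = fun=> (v 0 j)^*%C.
Proof.
apply: has_real_derivE => z; split.
  rewrite (_ : (fun _ => _) =
    fun t : R => complex.Re (z 0 j) + t * complex.Re ((v 0 j)^*%C)).
    exact: is_derive_affine.
  apply/funext => t; rewrite !mxE.
  by case: (z 0 j) (v 0 j) => [? ?] [? ?] /=; ring.
rewrite (_ : (fun _ => _) =
  fun t : R => complex.Im ((z 0 j)^*%C) + t * complex.Im ((v 0 j)^*%C)).
  exact: is_derive_affine.
apply/funext => t; rewrite !mxE.
by case: (z 0 j) (v 0 j) => [? ?] [? ?] /=; ring.
Qed.

Lemma derivation_real_deriv v : derivation (real_deriv v).
Proof.
split=> [c|j|j|f g zf zg|f g zf zg].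
- apply: has_real_derivE => z; split; exact: is_derive_cst.
- by exists (v 0 j); exact: real_deriv_coord.
- by exists (v 0 j)^*%C; exact: real_deriv_conj.
- have := real_deriv_lin v 1 zf zg.
  rewrite (_ : (fun z => 1 * f z + g z) = fun z => f z + g z).
    by move=> ->; apply/funext => z; rewrite mul1r.
  by apply/funext => z; rewrite mul1r.
- have [f' _ hf] := zpoly_real_deriv v zf.
  have [g' _ hg] := zpoly_real_deriv v zg.
  by rewrite (has_real_derivE (has_real_deriv_mul hf hg))
    (has_real_derivE hf) (has_real_derivE hg).
Qed.

Lemma deriv_zE j : @deriv_z R n j = fun f z =>
  2^-1 * deriv_x j f z + (- 'i%C / 2) * deriv_y j f z.
Proof. by apply/funext => f; apply/funext => z; rewrite /deriv_z; ring. Qed.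

Lemma deriv_zbarE j : @deriv_zbar R n j = fun f z =>
  2^-1 * deriv_x j f z + ('i%C / 2) * deriv_y j f z.
Proof. by apply/funext => f; apply/funext => z; rewrite /deriv_zbar; ring. Qed.

Lemma derivation_z j : derivation (deriv_z j).
Proof. by rewrite deriv_zE; apply: derivation_lin; exact: derivation_real_deriv. Qed.

Lemma derivation_zbar j : derivation (deriv_zbar j).
Proof. by rewrite deriv_zbarE; apply: derivation_lin; exact: derivation_real_deriv. Qed.

Let ii : 'i%C * 'i%C = -1 :> C. Proof. by rewrite -expr2 sqr_i. Qed.
Let ic (x : C) : ('i%C * x)^*%C = - 'i%C * x^*%C.
Proof.
case: x => a b; apply/eqP; rewrite eq_complex /=.
by apply/andP; split; apply/eqP; ring.
Qed.

Let halve (x : C) : (x + x) / 2 = x.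
Proof. by rewrite -mulr2n -[x *+ 2]mulr_natr mulfK// pnatr_eq0. Qed.

Lemma deriv_z_coord i j : deriv_z i (fun z => z 0 j) = fun=> (j == i)%:R.
Proof.
apply/funext => z; rewrite /deriv_z /deriv_x /deriv_y !real_deriv_coord !mxE eqxx.
by rewrite mulrA ii mulN1r opprK halve.
Qed.

Lemma deriv_zbar_coord i j : deriv_zbar i (fun z => z 0 j) = fun=> 0.
Proof.
apply/funext => z; rewrite /deriv_zbar /deriv_x /deriv_y !real_deriv_coord !mxE eqxx.
by rewrite mulrA ii mulN1r subrr mul0r.
Qed.

Lemma deriv_z_conj i j : deriv_z i (fun z => (z 0 j)^*%C) = fun=> 0.
Proof.
apply/funext => z; rewrite /deriv_z /deriv_x /deriv_y !real_deriv_conj !mxE eqxx.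
by rewrite ic mulrA mulrN ii opprK mul1r subrr mul0r.
Qed.

Lemma deriv_zbar_conj i j :
  deriv_zbar i (fun z => (z 0 j)^*%C) = fun=> (j == i)%:R.
Proof.
apply/funext => z; rewrite /deriv_zbar /deriv_x /deriv_y !real_deriv_conj !mxE eqxx.
rewrite ic mulrA mulrN ii opprK mul1r.
by rewrite rmorph_nat halve.
Qed.

(** Half of the mixed term in the Laplacian of a product. It is not symmetric: the holomorphic
    derivative falls on f, the antiholomorphic one on g, so it vanishes when f is antiholomorphic or
    g is holomorphic. *)
Definition gradient_form f g z := \sum_j deriv_z j f z * deriv_zbar j g z.

Lemma laplacian_mul f g z : zpoly f -> zpoly g ->
  laplacian (fun z => f z * g z) z = laplacian f z * g z + f z * laplacian g z
    + (gradient_form f g z + gradient_form g f z).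
Proof.
move=> zf zg; rewrite /laplacian /gradient_form mulr_suml mulr_sumr -!big_split /=.
apply: eq_bigr => j _.
have [_ _ _ _ bM] := derivation_zbar j; have [_ _ _ zD zM] := derivation_z j.
have zbf := zpoly_derivation (derivation_zbar j) zf.
have zbg := zpoly_derivation (derivation_zbar j) zg.
rewrite (bM f g zf zg) (zD _ _ (zpoly_mul zbf zg) (zpoly_mul zf zbg)).
rewrite (zM _ _ zbf zg) (zM _ _ zf zbg).
move: (deriv_z j (deriv_zbar j f) z) (deriv_z j (deriv_zbar j g) z).
move: (deriv_z j f z) (deriv_z j g z) (deriv_zbar j f z) (deriv_zbar j g z).
by move: (f z) (g z) => *; ring.
Qed.

Lemma laplacian_cst c z : laplacian (fun=> c) z = 0 :> C.
Proof.
apply: big1 => j _; have [dc _ _ _ _] := derivation_zbar j.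
by have [dc' _ _ _ _] := derivation_z j; rewrite dc dc'.
Qed.

Lemma laplacian_derivation d f : derivation d -> zpoly f ->
  laplacian (d f) = d (laplacian f).
Proof.
move=> hd zf; have hz := derivation_z; have hb := derivation_zbar.
have zb j := zpoly_derivation (hb j) zf.
rewrite /laplacian (derivation_big (index_enum 'I_n) (F := fun j => deriv_z j (deriv_zbar j f)) hd); last first.
  by move=> j; apply: zpoly_derivation.
apply/funext => z; apply: eq_bigr => j _.
by rewrite -(derivationC hd (hb j) zf) -(derivationC hd (hz j) (zb j)).
Qed.

Lemma gradient_form_mulr f g h z : zpoly g -> zpoly h ->
  gradient_form f (fun z => g z * h z) z =
  gradient_form f g z * h z + g z * gradient_form f h z.
Proof.
move=> zg zh; rewrite /gradient_form mulr_suml mulr_sumr -big_split /=.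
apply: eq_bigr => j _; have [_ _ _ _ dM] := derivation_zbar j.
rewrite dM//; move: (deriv_z j f z) (deriv_zbar j g z) (deriv_zbar j h z).
by move: (g z) (h z) => *; ring.
Qed.

Lemma gradient_form_mull f g h z : zpoly f -> zpoly g ->
  gradient_form (fun z => f z * g z) h z =
  gradient_form f h z * g z + f z * gradient_form g h z.
Proof.
move=> zf zg; rewrite /gradient_form mulr_suml mulr_sumr -big_split /=.
apply: eq_bigr => j _; have [_ _ _ _ dM] := derivation_z j.
rewrite dM//; move: (deriv_z j f z) (deriv_z j g z) (deriv_zbar j h z).
by move: (f z) (g z) => *; ring.
Qed.

Lemma gradient_form_expr f g k z : zpoly g ->
  gradient_form f (fun z => g z ^+ k) z =
  k%:R * g z ^+ k.-1 * gradient_form f g z.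
Proof.
move=> zg; rewrite /gradient_form mulr_sumr; apply: eq_bigr => j _.
by rewrite (derivation_exp k (derivation_zbar j) zg) mulrCA.
Qed.

Lemma gradient_form_expl f g k z : zpoly f ->
  gradient_form (fun z => f z ^+ k) g z =
  k%:R * f z ^+ k.-1 * gradient_form f g z.
Proof.
move=> zf; rewrite /gradient_form mulr_sumr; apply: eq_bigr => j _.
by rewrite (derivation_exp k (derivation_z j) zf) mulrA.
Qed.

(** The truncated exponents are harmless: the coefficients k and k (k-1) vanish where truncation
    takes place. *)
Lemma laplacian_exp f k z : zpoly f -> laplacian (fun z => f z ^+ k) z =
  k%:R * f z ^+ k.-1 * laplacian f z +
  (k * k.-1)%:R * f z ^+ k.-2 * gradient_form f f z.
Proof.
move=> zf; elim: k => [|k IH].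
  rewrite (_ : (fun z => _) = fun=> 1) ?laplacian_cst ?mul0r ?addr0//.
rewrite (_ : (fun z => _) = fun z => f z * f z ^+ k); last first.
  by apply/funext => y; rewrite exprS.
rewrite laplacian_mul//; last exact: zpoly_exp.
rewrite IH gradient_form_expr// gradient_form_expl//.
move: (laplacian f z) (gradient_form f f z) (f z) => x y t.
by case: k {IH} => [|[|k]]; rewrite /= ?exprS; ring.
Qed.

End wirtinger.

(** * Polynomials of given bidegree *)

Lemma sum_count_mem (T : finType) (s : seq T) :
  (\sum_j count_mem j s = size s)%N.
Proof.
elim: s => [|i s IH]; first by rewrite big1.
rewrite big_split /= IH (bigD1 i)//= eqxx big1 ?addn0// => j ji.
by rewrite eq_sym (negbTE ji).
Qed.

Lemma prod_count_mem (K : comNzRingType) (T : finType) (F : T -> K) (s : seq T) :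
  \prod_(i <- s) F i = \prod_j F j ^+ count_mem j s.
Proof.
elim: s => [|i s IH]; first by rewrite big_nil big1// => j _; rewrite expr0.
rewrite big_cons IH [RHS](eq_bigr (fun j => F j ^+ (i == j) * F j ^+ count_mem j s)).
  rewrite big_split /=; congr (_ * _).
  rewrite (bigD1 i)//= eqxx big1 ?mulr1// => j ji.
  by rewrite eq_sym (negbTE ji).
by move=> j _; rewrite -exprD.
Qed.

Section bihomogeneous_polynomials.
Variables (R : realType) (n : nat).
Local Notation C := R[i].
Local Notation Cn := 'rV[R[i]]_n.
Local Notation zpoly := (@zpoly R n).
Implicit Types (f g : Cn -> C) (v z : Cn) (d : (Cn -> C) -> Cn -> C).
Implicit Types (s t : seq 'I_n).

(** Lists of indices instead of exponent vectors: products become concatenation, and derivatives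
    become [count_mem] and [rem]. *)
Definition monomial s t z : C :=
  \prod_(i <- s) z 0 i * \prod_(i <- t) (z 0 i)^*%C.

(** An inductive form of [bihomogeneous], adding one monomial at a time, so that linear statements
    reduce to monomials by induction. *)
Inductive bidegree p q : (Cn -> C) -> Prop :=
| bidegree0 : bidegree p q (fun=> 0)
| bidegree_consm c s t f : size s = p -> size t = q -> bidegree p q f ->
    bidegree p q (fun z => c * monomial s t z + f z).

Lemma monomial_cat s t s' t' z :
  monomial (s ++ s') (t ++ t') z = monomial s t z * monomial s' t' z.
Proof. by rewrite /monomial !big_cat /= mulrACA. Qed.

Lemma bidegree_ext p q f g : f =1 g -> bidegree p q f -> bidegree p q g.
Proof. by move=> /funext ->. Qed.

Lemma bidegree_add p q f g : bidegree p q f -> bidegree p q g ->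
  bidegree p q (fun z => f z + g z).
Proof.
move=> hf hg; elim: hf => [|c s t {}f sp tq _ IH].
  by apply: bidegree_ext hg => z; rewrite add0r.
by apply: bidegree_ext (bidegree_consm c sp tq IH) => z; rewrite addrA.
Qed.

Lemma bidegree_scale p q a f : bidegree p q f -> bidegree p q (fun z => a * f z).
Proof.
elim=> [|c s t {}f sp tq _ IH].
  by apply: bidegree_ext (bidegree0 p q) => z; rewrite mulr0.
apply: bidegree_ext (bidegree_consm (a * c) sp tq IH) => z.
by rewrite mulrDr mulrA.
Qed.

Lemma bidegree_monomial s t : bidegree (size s) (size t) (monomial s t).
Proof.
apply: bidegree_ext (bidegree_consm 1 erefl erefl (bidegree0 _ _)) => z.
by rewrite mul1r addr0.
Qed.

Lemma bidegree_mul p q p' q' f g : bidegree p q f -> bidegree p' q' g ->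
  bidegree (p + p') (q + q') (fun z => f z * g z).
Proof.
move=> hf hg; elim: hf => [|c s t {}f sp tq _ IH].
  by apply: bidegree_ext (bidegree0 _ _) => z; rewrite mul0r.
have hm : bidegree (p + p') (q + q') (fun z => monomial s t z * g z).
  elim: hg {IH} => [|c' s' t' {}g sp' tq' _ IH].
    by apply: bidegree_ext (bidegree0 _ _) => z; rewrite mulr0.
  have sz : size (s ++ s') = (p + p')%N by rewrite size_cat sp sp'.
  have tz : size (t ++ t') = (q + q')%N by rewrite size_cat tq tq'.
  apply: bidegree_ext (bidegree_consm c' sz tz IH) => z.
  by rewrite monomial_cat; ring.
apply: bidegree_ext (bidegree_add (bidegree_scale c hm) IH) => z.
by ring.
Qed.

Lemma bidegree_cst c : bidegree 0 0 (fun=> c).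
Proof.
apply: bidegree_ext (bidegree_scale c (bidegree_monomial [::] [::])) => z.
by rewrite /monomial !big_nil !mulr1.
Qed.

Lemma bidegree_coord j : bidegree 1 0 (fun z => z 0 j).
Proof.
apply: bidegree_ext (bidegree_monomial [:: j] [::]) => z.
by rewrite /monomial big_seq1 big_nil mulr1.
Qed.

Lemma bidegree_conj j : bidegree 0 1 (fun z => (z 0 j)^*%C).
Proof.
apply: bidegree_ext (bidegree_monomial [::] [:: j]) => z.
by rewrite /monomial big_seq1 big_nil mul1r.
Qed.

Lemma bidegree_exp p q k f : bidegree p q f ->
  bidegree (k * p) (k * q) (fun z => f z ^+ k).
Proof.
move=> hf; elim: k => [|k IH].
  by apply: bidegree_ext (bidegree_cst 1) => z; rewrite expr0.
by rewrite !mulSn; apply: bidegree_ext (bidegree_mul hf IH) => z; rewrite exprS.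
Qed.

Lemma bidegree_sum p q (I : Type) (r : seq I) (P : pred I) (F : I -> Cn -> C) :
  (forall i, P i -> bidegree p q (F i)) ->
  bidegree p q (fun z => \sum_(i <- r | P i) F i z).
Proof.
move=> hF; elim: r => [|i r IH].
  by apply: bidegree_ext (bidegree0 _ _) => z; rewrite big_nil.
case Pi: (P i); last by apply: bidegree_ext IH => z; rewrite big_cons Pi.
by apply: bidegree_ext (bidegree_add (hF i Pi) IH) => z; rewrite big_cons Pi.
Qed.

Lemma bidegree_prod (p q : 'I_n -> nat) (r : seq 'I_n) (F : 'I_n -> Cn -> C) :
  (forall i, bidegree (p i) (q i) (F i)) ->
  bidegree (\sum_(i <- r) p i) (\sum_(i <- r) q i)
    (fun z => \prod_(i <- r) F i z).
Proof.
move=> hF; elim: r => [|i r IH].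
  rewrite !big_nil.
  by apply: bidegree_ext (bidegree_cst 1) => z; rewrite big_nil.
rewrite !big_cons.
by apply: bidegree_ext (bidegree_mul (hF i) IH) => z; rewrite big_cons.
Qed.

Lemma bihomogeneous_bidegree p q f : bihomogeneous p q f -> bidegree p q f.
Proof.
have ha (a : 'I_n -> nat) :
    bidegree (\sum_j a j) 0 (fun z => \prod_j z 0 j ^+ a j).
  have h j : bidegree (a j) 0 (fun z => z 0 j ^+ a j).
    by have := bidegree_exp (a j) (bidegree_coord j); rewrite muln1 muln0.
  by have := bidegree_prod (index_enum 'I_n) h; rewrite big1_eq.
have hb (b : 'I_n -> nat) :
    bidegree 0 (\sum_j b j) (fun z => \prod_j (z 0 j)^*%C ^+ b j).
  have h j : bidegree 0 (b j) (fun z => (z 0 j)^*%C ^+ b j).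
    by have := bidegree_exp (b j) (bidegree_conj j); rewrite muln1 muln0.
  by have := bidegree_prod (index_enum 'I_n) h; rewrite big1_eq.
case=> c /funext ->; apply: bidegree_sum => a /eqP ap.
apply: bidegree_sum => b /eqP bq.
have := bidegree_mul (bidegree_scale (c a b) (ha (fun j => a j))) (hb (fun j => b j)).
by rewrite addn0 add0n ap bq.
Qed.

Lemma bidegree_bihomogeneous p q f : bidegree p q f -> bihomogeneous p q f.
Proof.
have cnt k (s : seq 'I_n) : size s = k ->
    exists a : {ffun 'I_n -> 'I_k.+1}, forall j, a j = count_mem j s :> nat.
  move=> sk; have lt j : (count_mem j s < k.+1)%N by rewrite ltnS -sk count_size.
  by exists [ffun j => Ordinal (lt j)] => j; rewrite ffunE.
elim=> [|c s t {}f sp tq _ [e he]].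
  exists (fun _ _ => 0) => z; rewrite big1// => a _; rewrite big1// => b _.
  by rewrite !mul0r.
have [a0 ha] := cnt p s sp; have [b0 hb] := cnt q t tq.
exists (fun a b => c * (a == a0)%:R * (b == b0)%:R + e a b) => z.
have sa : (\sum_j a0 j)%N == p.
  by rewrite (eq_bigr _ (fun j _ => ha j)) sum_count_mem sp.
have sb : (\sum_j b0 j)%N == q.
  by rewrite (eq_bigr _ (fun j _ => hb j)) sum_count_mem tq.
transitivity (\sum_(a : {ffun 'I_n -> 'I_p.+1} | (\sum_j a j)%N == p)
  \sum_(b : {ffun 'I_n -> 'I_q.+1} | (\sum_j b j)%N == q)
   (c * (a == a0)%:R * (b == b0)%:R) * (\prod_j z 0 j ^+ a j) * (\prod_j (z 0 j)^*%C ^+ b j) + f z).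
  congr (_ + _); rewrite (bigD1 a0)//= [X in _ + X]big1 ?addr0 => [|a /andP[_ aa]]; last first.
    by apply: big1 => b _; rewrite (negbTE aa) mulr0 !mul0r.
  rewrite (bigD1 b0)//= [X in _ + X]big1 ?addr0 => [|b /andP[_ bb]]; last first.
    by rewrite (negbTE bb) mulr0 !mul0r.
  rewrite !eqxx !mulr1 /monomial (prod_count_mem _ s) (prod_count_mem _ t) -mulrA; congr (_ * (_ * _)).
    by apply: eq_bigr => j _; rewrite ha.
  by apply: eq_bigr => j _; rewrite hb.
rewrite he -big_split; apply: eq_bigr => a _ /=.
by rewrite -big_split; apply: eq_bigr => b _ /=; rewrite !mulrDl.
Qed.

Lemma bidegree_zpoly p q f : bidegree p q f -> zpoly f.
Proof. by move=> /bidegree_bihomogeneous/bihomogeneous_zpoly. Qed.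

Lemma bidegree_homogeneous p q f a z : bidegree p q f ->
  f (a *: z) = a ^+ p * a^*%C ^+ q * f z.
Proof.
elim=> [|c s t {}f sp tq _ IH]; first by rewrite mulr0.
rewrite IH mulrDr; congr (_ + _); rewrite [RHS]mulrCA; congr (_ * _).
rewrite /monomial -sp -tq.
have -> : \prod_(i <- s) (a *: z) 0 i = a ^+ size s * \prod_(i <- s) z 0 i.
  elim: (s) => [|i r IHr]; first by rewrite !big_nil mulr1.
  by rewrite !big_cons IHr mxE exprS; ring.
have -> : \prod_(i <- t) ((a *: z) 0 i)^*%C =
    a^*%C ^+ size t * \prod_(i <- t) (z 0 i)^*%C.
  elim: (t) => [|i r IHr]; first by rewrite !big_nil mulr1.
  by rewrite !big_cons IHr mxE rmorphM exprS; ring.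
by rewrite mulrACA.
Qed.

Lemma zpoly_monomial s t : zpoly (monomial s t).
Proof. exact: bidegree_zpoly (bidegree_monomial s t). Qed.

Let derivation_prod0 d (F : 'I_n -> Cn -> C) s : derivation d ->
  (forall i, zpoly (F i)) -> (forall i, d (F i) = fun=> 0) ->
  d (fun z => \prod_(i <- s) F i z) = fun=> 0.
Proof.
move=> [d0 _ _ _ dM] zF hF; elim: s => [|i s IH].
  rewrite (_ : (fun z => _) = fun=> 1) ?d0//.
  by apply/funext => z; rewrite big_nil.
rewrite (_ : (fun z => _) = fun z => F i z * \prod_(i <- s) F i z); last first.
  by apply/funext => z; rewrite big_cons.
rewrite dM//; last exact: zpoly_prod.
by rewrite IH hF; apply/funext => z; rewrite mul0r mulr0 addr0.
Qed.

(** The count on both sides covers the case [j \notin s], in which [rem] removes nothing. *)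
Let prod_rem (F : 'I_n -> Cn -> C) s j z :
  (count_mem j s)%:R * (F j z * \prod_(i <- rem j s) F i z) =
  (count_mem j s)%:R * \prod_(i <- s) F i z.
Proof.
have [js|js] := boolP (j \in s); last by rewrite (count_memPn js) !mul0r.
by rewrite [in RHS](perm_big _ (perm_to_rem js)) big_cons.
Qed.

Let derivation_prod d (F : 'I_n -> Cn -> C) s j : derivation d ->
  (forall i, zpoly (F i)) -> (forall i, d (F i) = fun=> (i == j)%:R) ->
  d (fun z => \prod_(i <- s) F i z) =
  fun z => (count_mem j s)%:R * \prod_(i <- rem j s) F i z.
Proof.
move=> [d0 _ _ _ dM] zF hF; elim: s => [|i s IH].
  rewrite (_ : (fun z => _) = fun=> 1) ?d0/=.
    by apply/funext => z; rewrite mul0r.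
  by apply/funext => z; rewrite big_nil.
rewrite (_ : (fun z => _) = fun z => F i z * \prod_(i <- s) F i z); last first.
  by apply/funext => z; rewrite big_cons.
rewrite dM//; last exact: zpoly_prod.
rewrite IH hF; apply/funext => z /=; have [ij|ij] := eqVneq i j.
  by rewrite mul1r natrD mulrDl mul1r mulrCA -ij prod_rem.
by rewrite mul0r !add0r big_cons mulrCA.
Qed.

Lemma deriv_z_monomial j s t : deriv_z j (monomial s t) =
  fun z => (count_mem j s)%:R * monomial (rem j s) t z.
Proof.
have hd := @derivation_z R n j; have [_ _ _ _ dM] := hd.
rewrite /monomial dM; [|by apply: zpoly_prod => i; exact: zpoly_coord
                       |by apply: zpoly_prod => i; exact: zpoly_conj].
rewrite (derivation_prod s hd (@zpoly_coord R n) (@deriv_z_coord R n j)).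
rewrite (derivation_prod0 t hd (@zpoly_conj R n) (@deriv_z_conj R n j)).
by apply/funext => z; rewrite mulr0 addr0 mulrA.
Qed.

Lemma deriv_zbar_monomial j s t : deriv_zbar j (monomial s t) =
  fun z => (count_mem j t)%:R * monomial s (rem j t) z.
Proof.
have hd := @derivation_zbar R n j; have [_ _ _ _ dM] := hd.
rewrite /monomial dM; [|by apply: zpoly_prod => i; exact: zpoly_coord
                       |by apply: zpoly_prod => i; exact: zpoly_conj].
rewrite (derivation_prod0 s hd (@zpoly_coord R n) (@deriv_zbar_coord R n j)).
rewrite (derivation_prod t hd (@zpoly_conj R n) (@deriv_zbar_conj R n j)).
by apply/funext => z; rewrite mul0r add0r mulrCA.
Qed.

Lemma derivation_consm d c s t f : derivation d -> zpoly f ->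
  d (fun z => c * monomial s t z + f z) =
  fun z => c * d (monomial s t) z + d f z.
Proof.
move=> [d0 _ _ dD dM] zf; have zm := zpoly_monomial s t.
rewrite dD//; last by apply: (@zpoly_mul R n (fun=> c)) => //; exact: zpoly_cst.
rewrite (dM (fun=> c))//; last exact: zpoly_cst.
by rewrite d0; apply/funext => z; rewrite mul0r add0r.
Qed.

Lemma bidegree_deriv_z p q j f : bidegree p q f -> bidegree p.-1 q (deriv_z j f).
Proof.
have hd := @derivation_z R n j; elim=> [|c s t {}f sp tq /bidegree_zpoly zf IH].
  by have [-> _ _ _ _] := hd; exact: bidegree0.
rewrite derivation_consm//; apply: bidegree_add IH; apply: bidegree_scale.
rewrite deriv_z_monomial; have [js|js] := boolP (j \in s).
  rewrite -sp -(size_rem js) -tq; apply: bidegree_scale.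
  exact: bidegree_monomial.
rewrite (count_memPn js); apply: bidegree_ext (bidegree0 _ _) => z.
by rewrite mul0r.
Qed.

Lemma deriv_z_bidegree0 q j f : bidegree 0 q f -> deriv_z j f = fun=> 0.
Proof.
have hd := @derivation_z R n j.
suff h p : bidegree p q f -> p = 0%N -> deriv_z j f = fun=> 0 by move=> /h; exact.
elim=> [|c s t {}f sp _ /bidegree_zpoly zf IH] p0.
  by have [-> _ _ _ _] := hd.
rewrite derivation_consm// IH// deriv_z_monomial; apply/funext => z.
have /nilP -> : nilp s by rewrite /nilp sp p0.
by rewrite mul0r mulr0 addr0.
Qed.

Lemma bidegree_deriv_zbar p q j f :
  bidegree p q f -> bidegree p q.-1 (deriv_zbar j f).
Proof.
have hd := @derivation_zbar R n j; elim=> [|c s t {}f sp tq /bidegree_zpoly zf IH].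
  by have [-> _ _ _ _] := hd; exact: bidegree0.
rewrite derivation_consm//; apply: bidegree_add IH; apply: bidegree_scale.
rewrite deriv_zbar_monomial; have [js|js] := boolP (j \in t).
  rewrite -sp -tq -(size_rem js); apply: bidegree_scale.
  exact: bidegree_monomial.
rewrite (count_memPn js); apply: bidegree_ext (bidegree0 _ _) => z.
by rewrite mul0r.
Qed.

Lemma deriv_zbar_bidegree0 p j f : bidegree p 0 f -> deriv_zbar j f = fun=> 0.
Proof.
have hd := @derivation_zbar R n j.
suff h q : bidegree p q f -> q = 0%N -> deriv_zbar j f = fun=> 0 by move=> /h; exact.
elim=> [|c s t {}f _ tq /bidegree_zpoly zf IH] q0.
  by have [-> _ _ _ _] := hd.
rewrite derivation_consm// IH// deriv_zbar_monomial; apply/funext => z.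
have /nilP -> : nilp t by rewrite /nilp tq q0.
by rewrite mul0r mulr0 addr0.
Qed.

Lemma bidegree_laplacian p q f :
  bidegree p q f -> bidegree p.-1 q.-1 (laplacian f).
Proof.
move=> hf; apply: bidegree_sum => j _.
by apply: bidegree_deriv_z; exact: bidegree_deriv_zbar.
Qed.

Lemma euler_z p q f z : bidegree p q f ->
  \sum_j z 0 j * deriv_z j f z = p%:R * f z.
Proof.
elim=> [|c s t {}f sp tq /bidegree_zpoly zf IH].
  rewrite mulr0; apply: big1 => j _; have [d0 _ _ _ _] := @derivation_z R n j.
  by rewrite d0 mulr0.
transitivity (\sum_j (c * ((count_mem j s)%:R * monomial s t z) +
    z 0 j * deriv_z j f z)).
  apply: eq_bigr => j _; rewrite (derivation_consm _ _ _ (@derivation_z R n j))//.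
  rewrite mulrDr; congr (_ + _); rewrite deriv_z_monomial mulrCA; congr (_ * _).
  have := prod_rem (fun i z => z 0 i) s j z; rewrite /monomial => e.
  by rewrite [RHS]mulrA -e; ring.
rewrite big_split /= IH -mulr_sumr -mulr_suml -natr_sum sum_count_mem sp.
by rewrite mulrDr mulrCA.
Qed.

Lemma euler_zbar p q f z : bidegree p q f ->
  \sum_j (z 0 j)^*%C * deriv_zbar j f z = q%:R * f z.
Proof.
elim=> [|c s t {}f sp tq /bidegree_zpoly zf IH].
  rewrite mulr0; apply: big1 => j _; have [d0 _ _ _ _] := @derivation_zbar R n j.
  by rewrite d0 mulr0.
transitivity (\sum_j (c * ((count_mem j t)%:R * monomial s t z) +
    (z 0 j)^*%C * deriv_zbar j f z)).
  apply: eq_bigr => j _; rewrite (derivation_consm _ _ _ (@derivation_zbar R n j))//.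
  rewrite mulrDr; congr (_ + _); rewrite deriv_zbar_monomial mulrCA; congr (_ * _).
  have := prod_rem (fun i z => (z 0 i)^*%C) t j z; rewrite /monomial => e.
  by rewrite [RHS]mulrCA -e; ring.
rewrite big_split /= IH -mulr_sumr -mulr_suml -natr_sum sum_count_mem tq.
by rewrite mulrDr mulrCA.
Qed.

End bihomogeneous_polynomials.

(** * Exact quadrature on the sphere *)

Section sphere_design.
Variables (R : realType) (n : nat).
Local Notation C := R[i].
Local Notation Cn := 'rV[R[i]]_n.
Local Notation bidegree := (@bidegree R n).
Implicit Types (f g h : Cn -> C) (z : Cn) (s t : seq 'I_n).

Definition sqnorm z : C := \sum_j z 0 j * (z 0 j)^*%C.

Lemma bidegree_sqnorm : bidegree 1 1 sqnorm.
Proof.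
apply: bidegree_sum => j _.
exact: (bidegree_mul (@bidegree_coord R n j) (@bidegree_conj R n j)).
Qed.

(** n independent copies of the one-dimensional rule: the sum over all choices of nodes factors over
    the coordinates. *)
Lemma gaussian_design N : exists (I : finType) (W : I -> C) (Z : I -> Cn),
  (forall e, 0 <= W e) /\ forall s t, (size s <= N)%N -> (size t <= N)%N ->
  \sum_e W e * monomial s t (Z e) =
  \prod_j ((count_mem j s == count_mem j t)%:R * (count_mem j s)`!%:R).
Proof.
have [T [c [x [c0 hx]]]] := @gaussian_quadrature R[i] N.
exists {ffun 'I_n -> T}, (fun e : {ffun 'I_n -> T} => \prod_j c (e j)),
  (fun e : {ffun 'I_n -> T} => \row_j x (e j)).
split=> [e|s t sN tN]; first by apply: prodr_ge0 => j _; exact: c0.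
transitivity (\sum_(e : {ffun 'I_n -> T}) \prod_j (c (e j) *
    (x (e j) ^+ count_mem j s * (x (e j))^* ^+ count_mem j t))).
  apply: eq_bigr => e _; rewrite big_split /=; congr (_ * _).
  rewrite /monomial (prod_count_mem _ s) (prod_count_mem _ t) -big_split /=.
  by apply: eq_bigr => j _; rewrite mxE.
rewrite -(bigA_distr_bigA (fun (j : 'I_n) (t' : T) => c t' *
  (x t' ^+ count_mem j s * (x t')^* ^+ count_mem j t))).
by apply: eq_bigr => j _; rewrite hx// (leq_trans (count_size _ _)).
Qed.

Section gaussian_mean.
Variables (N : nat) (I : finType) (W : I -> C) (Z : I -> Cn).
Hypothesis momentE : forall s t, (size s <= N)%N -> (size t <= N)%N ->
  \sum_e W e * monomial s t (Z e) =
  \prod_j ((count_mem j s == count_mem j t)%:R * (count_mem j s)`!%:R).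

Let E f := \sum_e W e * f (Z e).

Let E_lin a f g : E (fun z => a * f z + g z) = a * E f + E g.
Proof.
rewrite /E mulr_sumr -big_split /=; apply: eq_bigr => e _.
by rewrite mulrDr mulrCA.
Qed.

Let E_scale a f : E (fun z => a * f z) = a * E f.
Proof. by rewrite /E mulr_sumr; apply: eq_bigr => e _; rewrite mulrCA. Qed.

Let E_add f g : E (fun z => f z + g z) = E f + E g.
Proof. by rewrite /E -big_split /=; apply: eq_bigr => e _; rewrite mulrDr. Qed.

Let E0 : E (fun=> 0) = 0.
Proof. by apply: big1 => e _; rewrite mulr0. Qed.

Let E_sum (J : finType) (F : J -> Cn -> C) :
  E (fun z => \sum_j F j z) = \sum_j E (F j).
Proof.
by rewrite /E exchange_big /=; apply: eq_bigr => e _; rewrite mulr_sumr.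
Qed.

Let E_ext f g : f =1 g -> E f = E g.
Proof. by move=> /funext ->. Qed.

(** Against the weight exp(-|z|^2), multiplication by z_i is adjoint to the derivative in the
    conjugate of z_i. On moments this is (c+1)! = (c+1) c!; the strict bound on s leaves room for
    the additional factor z_i. *)
Let by_parts_monomial i s t : (size s < N)%N -> (size t <= N)%N ->
  E (monomial (i :: s) t) = (count_mem i t)%:R * E (monomial s (rem i t)).
Proof.
move=> sN tN; rewrite /E momentE//.
have [it|it] := boolP (i \in t); last first.
  by rewrite (count_memPn it) mul0r (bigD1 i)//= eqxx (count_memPn it) !mul0r.
rewrite momentE ?(ltnW sN)//; last first.
  by rewrite (leq_trans _ tN)// size_rem// leq_pred.
have ct j : count_mem j t = ((i == j) + count_mem j (rem i t))%N.
  by have /permP -> := perm_to_rem it.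
rewrite (bigD1 i)//= [in RHS](bigD1 i)//= mulrA; congr (_ * _).
  rewrite ct eqxx !add1n eqSS; case: eqP => [->|_]; last by rewrite !mul0r mulr0.
  by rewrite !mul1r factS natrM.
by apply: eq_bigr => j ji; rewrite /= ct [i == j]eq_sym (negbTE ji) !add0n.
Qed.

Let by_parts p q i f : bidegree p q f -> (p < N)%N -> (q <= N)%N ->
  E (fun z => z 0 i * f z) = E (deriv_zbar i f).
Proof.
move=> hf pN qN; elim: hf => [|c s t {}f sp tq zf IH].
  have [-> _ _ _ _] := @derivation_zbar R n i.
  by apply: E_ext => z; rewrite mulr0.
rewrite (derivation_consm _ _ _ (@derivation_zbar R n i)); last first.
  exact: bidegree_zpoly zf.
rewrite E_lin -IH deriv_zbar_monomial.
rewrite (E_ext (g := fun z => c * monomial (i :: s) t z + z 0 i * f z)); last first.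
  by move=> z; rewrite mulrDr /monomial big_cons; ring.
rewrite E_lin by_parts_monomial ?sp ?tq//; congr (c * _ + _).
by rewrite E_scale.
Qed.

(** Euler's identity writes p h as the sum of z_j times the holomorphic derivatives of h, and
    integration by parts turns each z_j into the conjugate derivative. *)
Lemma gaussian_laplacian p q h : bidegree p q h -> (p <= N)%N -> (q <= N)%N ->
  p%:R * E h = E (laplacian h).
Proof.
case: p => [|p] hh pN qN.
  rewrite mul0r -E0; apply: E_ext => z; apply/esym; apply: big1 => j _.
  have zf := bidegree_zpoly hh.
  rewrite (derivationC (@derivation_z R n j) (@derivation_zbar R n j) zf).
  by rewrite (deriv_z_bidegree0 j hh); have [-> _ _ _ _] := @derivation_zbar R n j.
transitivity (E (fun z => \sum_j z 0 j * deriv_z j h z)).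
  by rewrite -E_scale; apply: E_ext => z; rewrite (euler_z _ hh).
rewrite E_sum /laplacian E_sum; apply: eq_bigr => j _.
have hd := bidegree_deriv_z j hh.
rewrite (by_parts _ hd)//; apply: E_ext => z.
by rewrite (derivationC (@derivation_zbar R n j) (@derivation_z R n j)
  (bidegree_zpoly hh)).
Qed.

(** Integrating z_j by parts against conj(z_j) h gives h once for each j, hence n, and an Euler sum,
    hence q. *)
Lemma gaussian_sqnorm p q h : bidegree p q h -> (p < N)%N -> (q < N)%N ->
  E (fun z => sqnorm z * h z) = (n + q)%:R * E h.
Proof.
move=> hh pN qN; have zh := bidegree_zpoly hh.
transitivity (E (fun z => \sum_j z 0 j * ((z 0 j)^*%C * h z))).
  by apply: E_ext => z; rewrite mulr_suml; apply: eq_bigr => j _; rewrite mulrA.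
rewrite E_sum.
transitivity (\sum_(j < n) (E h + E (fun z => (z 0 j)^*%C * deriv_zbar j h z))).
  apply: eq_bigr => j _; have hj := bidegree_mul (@bidegree_conj R n j) hh.
  rewrite (by_parts _ hj)//.
  have [_ _ _ _ dM] := @derivation_zbar R n j.
  rewrite dM//; last exact: zpoly_conj.
  by rewrite (@deriv_zbar_conj R n j j) eqxx -E_add; apply: E_ext => z; rewrite mul1r.
rewrite big_split /= sumr_const card_ord -E_sum natrD mulrDl mulr_natl.
congr (_ + _); rewrite -E_scale; apply: E_ext => z.
by rewrite (euler_zbar _ hh).
Qed.

(** Each factor |z|^2 raises the antiholomorphic degree by one, so [gaussian_sqnorm] iterates to a
    rising factorial starting at n + k. *)
Lemma gaussian_sqnorm_exp k m h : bidegree k k h -> (k + m <= N)%N ->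
  E (fun z => sqnorm z ^+ m * h z) = (\prod_(i < m) (n + k + i))%:R * E h.
Proof.
move=> hh; elim: m => [_|m IH kN].
  by rewrite big_ord0 mul1r; apply: E_ext => z; rewrite expr0 mul1r.
have hm := bidegree_mul (bidegree_exp m bidegree_sqnorm) hh; rewrite !muln1 in hm.
rewrite (E_ext (g := fun z => sqnorm z * (sqnorm z ^+ m * h z))); last first.
  by move=> z; rewrite exprS mulrA.
have mk : (m + k < N)%N by rewrite addnC -addnS.
rewrite (gaussian_sqnorm hm)// IH; last by rewrite ltnW// addnC.
by rewrite big_ord_recr /= mulrA -natrM mulnC -addnA [(k + m)%N]addnC.
Qed.

End gaussian_mean.

Lemma sqnormE z : sqnorm z = (l2norm z ^+ 2)%:C%C.
Proof.
rewrite sqr_sqrtr ?sumr_ge0// => [|j _]; last exact: sqr_ge0.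
rewrite rmorph_sum; apply: eq_bigr => j _.
by rewrite -sqr_normc -[in LHS](RRe_real (normr_real (z 0 j))) -rmorphXn.
Qed.

Lemma sqnorm_sphere (x : sphere R n) : sqnorm (val x) = 1.
Proof. by rewrite sqnormE (eqP (valP x)) expr1n. Qed.

Lemma l2norm_ge0 z : 0 <= l2norm z.
Proof. exact: sqrtr_ge0. Qed.

Lemma l2norm_scale (a : R) z : 0 <= a -> l2norm (a%:C%C *: z) = a * l2norm z.
Proof.
move=> a0; apply: (@pexpIrn _ 2%N) => //; rewrite ?nnegrE ?mulr_ge0 ?l2norm_ge0//.
apply: (@complexI R); rewrite -sqnormE (bidegree_homogeneous _ _ bidegree_sqnorm).
by rewrite sqnormE conjc_real !expr1 -!rmorphM /= -expr2 -exprMn.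
Qed.

Lemma sphere_normalize z : (0 < n)%N -> exists x : sphere R n,
  z = (l2norm z)%:C%C *: val x.
Proof.
move=> n0; have [z0|z0] := eqVneq (l2norm z) 0.
  have x1 : l2norm (delta_mx 0 (Ordinal n0) : Cn) == 1.
    rewrite /l2norm (eq_bigr (fun j => (j == Ordinal n0)%:R)) => [|j _].
      rewrite (bigD1 (Ordinal n0))//= big1 ?addr0 ?sqrtr1// => j /negbTE jn.
      by rewrite jn.
    rewrite mxE eqxx andTb; case: (j == _); last by rewrite normr0 expr0n.
    by rewrite normr1 (_ : complex.Re 1 = 1)// expr1n.
  exists (exist (fun z : Cn => is_true (l2norm z == 1)) _ x1 : sphere R n).
  rewrite z0 scale0r; apply/rowP => j; rewrite mxE.
  have /eqP : sqnorm z = 0 by rewrite sqnormE z0 expr0n.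
  rewrite psumr_eq0 => [|i _]; last exact: mulcJ_ge0.
  move=> /allP/(_ j); rewrite mem_index_enum => /(_ isT) /=.
  by rewrite mulf_eq0 conjc_eq0 orbb => /eqP.
have x1 : l2norm (((l2norm z)^-1)%:C%C *: z) == 1.
  by rewrite l2norm_scale ?invr_ge0 ?l2norm_ge0// mulVf.
exists (exist (fun z : Cn => is_true (l2norm z == 1)) _ x1 : sphere R n) => /=.
by rewrite scalerA -rmorphM /= mulfV// scale1r.
Qed.

(** With E the Gaussian mean, the weighted mean on the sphere of h of bidegree (k, k) is E(h)
    divided by n (n+1) ... (n+k-1). Comparing bidegrees (k+1, k+1) and (k, k) through (k+1) E(h) =
    E(Laplacian h) produces the factor (k+1) (n+k). *)
Lemma spherical_design D : (0 < n)%N -> (0 < D)%N ->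
  exists (I : finType) (w : I -> R) (x : I -> sphere R n),
  [/\ forall i, 0 <= w i, \sum_i w i = 1 &
   forall k h, bidegree k.+1 k.+1 h -> (k < D)%N ->
    (k.+1 * (n + k))%:R * (\sum_i (w i)%:C%C * h (val (x i))) =
    \sum_i (w i)%:C%C * laplacian h (val (x i))].
Proof.
move=> n0 D0; have [I [W [Z [W0 hZ]]]] := gaussian_design D.
pose E f := \sum_e W e * f (Z e).
have Wreal e : ((complex.Re (W e))%:C)%C = W e.
  by apply: RRe_real; exact: ger0_real.
(* The inverse of the Gaussian mean of |z|^(2D), so that the weights sum to 1. *)
pose c0 := ((\prod_(i < D) (n + i))%N%:R)^-1 : R.
have c00 : (\prod_(i < D) (n + i))%N%:R != 0 :> R.
  rewrite pnatr_eq0 -lt0n prodn_gt0// => i; by rewrite addn_gt0 n0.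
have /choice[x hx] := fun e => sphere_normalize (Z e) n0.
pose w e := c0 * (complex.Re (W e) * l2norm (Z e) ^+ 2 ^+ D).
(* the weight l2norm (Z e) ^+ 2 ^+ D makes every h of bidegree (k, k) with
   k <= D homogeneous of bidegree (D, D) *)
have wE k h : bidegree k k h -> (k <= D)%N ->
    \sum_e (w e)%:C%C * h (val (x e)) =
    c0%:C%C * ((\prod_(i < D - k) (n + k + i))%N%:R * E h).
  move=> hh kD; rewrite -(gaussian_sqnorm_exp hZ hh) ?subnKC// mulr_sumr.
  apply: eq_bigr => e _; rewrite /w !rmorphM /= -mulrA; congr (_ * _).
  rewrite Wreal -mulrA; congr (_ * _).
  (* A node at the origin has weight 0 since [0 < D]. The right-hand side vanishes as well: through
     |z|^(2(D-k)) if k = 0, through the homogeneity of h if k > 0. *)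
  have [Z0|Z0] := eqVneq (l2norm (Z e)) 0.
    have r0 : sqnorm (Z e) = 0 by rewrite sqnormE Z0 expr0n.
    rewrite Z0 r0 !expr0n (gtn_eqF D0) /= rmorph0 mul0r subn_eq0.
    rewrite [Z e]hx Z0 (bidegree_homogeneous _ _ hh) rmorph0 !expr0n.
    by have [->|] := posnP k; [rewrite leqNgt D0 mul0r|rewrite !mul0r mulr0].
  rewrite [in RHS](hx e) (bidegree_homogeneous _ _ hh) -hx sqnormE conjc_real.
  rewrite -exprMn -expr2 mulrA -rmorphXn /= -!rmorphXn /= -rmorphM /= -exprD.
  by rewrite subnK.
exists I, w, x; split.
- move=> e; rewrite mulr_ge0 ?invr_ge0 ?ler0n// mulr_ge0//; last first.
    by rewrite exprn_ge0// sqr_ge0.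
  by rewrite -ler0c Wreal.
- apply: (@complexI R); rewrite rmorph_sum.
  transitivity (\sum_e (w e)%:C%C * 1); first by apply: eq_bigr => e _; rewrite mulr1.
  rewrite (wE 0%N _ (bidegree_cst n 1))// subn0 addn0.
  have -> : E (fun=> 1) = 1.
    transitivity (E (monomial [::] [::])).
      by apply: eq_bigr => e _; rewrite /monomial !big_nil !mulr1.
    by rewrite /E hZ// big1// => j _; rewrite eqxx mulr1.
  by rewrite mulr1 /c0 fmorphV /= rmorph_nat mulVf// -(rmorph_nat (real_complex R)) fmorph_eq0.
- move=> k h hh kD; have hl := bidegree_laplacian hh.
  rewrite (wE _ _ hh)// (wE _ _ hl) 1?ltnW// mulrCA; congr (_ * _).
  have gl : k.+1%:R * E h = E (laplacian h) := gaussian_laplacian hZ hh kD kD.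
  rewrite -gl !mulrA -!natrM; congr (_%:R * _).
  rewrite -(subnSK kD) big_ord_recl addn0 [RHS]mulnC mulnA; congr (_ * _)%N.
  by apply: eq_bigr => i _; rewrite -!addnA addSnnS.
Qed.

End sphere_design.

Arguments sqnorm {R n} z.

(** * The reproducing kernel *)

Section zonal_kernel.
Variables (R : realType) (n : nat).
Local Notation C := R[i].
Local Notation Cn := 'rV[R[i]]_n.
Local Notation bidegree := (@bidegree R n).
Local Notation zpoly := (@zpoly R n).
Implicit Types (f g h : Cn -> C) (z w : Cn).

(** <z,w> and its conjugate are kept as two polynomials in z, of bidegrees (1, 0) and (0, 1), so
    that the calculus of bidegrees applies to each. *)
Definition dotl w z : C := \sum_j z 0 j * (w 0 j)^*%C.
Definition dotr w z : C := \sum_j (z 0 j)^*%C * w 0 j.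

Lemma bidegree_dotl w : bidegree 1 0 (dotl w).
Proof.
apply: bidegree_sum => j _.
have := bidegree_scale (w 0 j)^*%C (@bidegree_coord R n j).
by apply: bidegree_ext => z; rewrite mulrC.
Qed.

Lemma bidegree_dotr w : bidegree 0 1 (dotr w).
Proof.
apply: bidegree_sum => j _.
have := bidegree_scale (w 0 j) (@bidegree_conj R n j).
by apply: bidegree_ext => z; rewrite mulrC.
Qed.

Lemma dotr_sym z w : dotr z w = dotl w z.
Proof. by apply: eq_bigr => j _; rewrite mulrC. Qed.

Lemma dotl_conj w z : (dotl w z)^*%C = dotr w z.
Proof.
rewrite /dotl rmorph_sum /=; apply: eq_bigr => j _.
by rewrite rmorphM /= conjcK.
Qed.

Let zl w : zpoly (dotl w). Proof. exact: bidegree_zpoly (bidegree_dotl w). Qed.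
Let zr w : zpoly (dotr w). Proof. exact: bidegree_zpoly (bidegree_dotr w). Qed.
Let zs : zpoly sqnorm.
Proof. exact: bidegree_zpoly (@bidegree_sqnorm R n). Qed.

Lemma deriv_z_dotl j w : deriv_z j (dotl w) = fun=> (w 0 j)^*%C.
Proof.
have hd := @derivation_z R n j; have [d0 _ _ _ dM] := hd.
rewrite /dotl (derivation_big _ (F := fun i z => z 0 i * (w 0 i)^*%C))//.
  apply/funext => z; rewrite (bigD1 j)//= big1 => [|i /negbTE ij].
    rewrite (dM (fun z => z 0 j) (fun=> (w 0 j)^*%C)) ?d0; last exact: zpoly_cst.
      by rewrite (@deriv_z_coord R n j j) eqxx mul1r mulr0 !addr0.
    exact: zpoly_coord.
  rewrite (dM (fun z => z 0 i) (fun=> (w 0 i)^*%C)) ?d0; last exact: zpoly_cst.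
    by rewrite (@deriv_z_coord R n j i) ij mul0r mulr0 addr0.
  exact: zpoly_coord.
move=> i; apply: (@Defs.zpoly_mul R n (fun z => z 0 i) (fun=> _)).
  exact: zpoly_coord.
exact: zpoly_cst.
Qed.

Lemma deriv_zbar_dotr j w : deriv_zbar j (dotr w) = fun=> w 0 j.
Proof.
have hd := @derivation_zbar R n j; have [d0 _ _ _ dM] := hd.
rewrite /dotr (derivation_big _ (F := fun i z => (z 0 i)^*%C * w 0 i))//.
  apply/funext => z; rewrite (bigD1 j)//= big1 => [|i /negbTE ij].
    rewrite (dM (fun z => (z 0 j)^*%C) (fun=> w 0 j)) ?d0; last exact: zpoly_cst.
      by rewrite (@deriv_zbar_conj R n j j) eqxx mul1r mulr0 !addr0.
    exact: zpoly_conj.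
  rewrite (dM (fun z => (z 0 i)^*%C) (fun=> w 0 i)) ?d0; last exact: zpoly_cst.
    by rewrite (@deriv_zbar_conj R n j i) ij mul0r mulr0 addr0.
  exact: zpoly_conj.
move=> i; apply: (@Defs.zpoly_mul R n (fun z => (z 0 i)^*%C) (fun=> _)).
  exact: zpoly_conj.
exact: zpoly_cst.
Qed.

Lemma deriv_z_dotr j w : deriv_z j (dotr w) = fun=> 0.
Proof. exact: deriv_z_bidegree0 (bidegree_dotr w). Qed.

Lemma deriv_zbar_dotl j w : deriv_zbar j (dotl w) = fun=> 0.
Proof. exact: deriv_zbar_bidegree0 (bidegree_dotl w). Qed.

Lemma deriv_z_sqnorm j : deriv_z j sqnorm = fun z => (z 0 j)^*%C.
Proof.
have hd := @derivation_z R n j; have [d0 _ _ _ dM] := hd.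
rewrite /sqnorm (derivation_big _ (F := fun i z => z 0 i * (z 0 i)^*%C))//.
  apply/funext => z; rewrite (bigD1 j)//= big1 => [|i /negbTE ij].
    rewrite dM; [|exact: zpoly_coord|exact: zpoly_conj].
    by rewrite (@deriv_z_coord R n j j) (@deriv_z_conj R n j j) eqxx mul1r mulr0 !addr0.
  rewrite dM; [|exact: zpoly_coord|exact: zpoly_conj].
  by rewrite (@deriv_z_coord R n j i) (@deriv_z_conj R n j i) ij mul0r mulr0 !addr0.
by move=> i; apply: Defs.zpoly_mul; [exact: zpoly_coord|exact: zpoly_conj].
Qed.

Lemma deriv_zbar_sqnorm j : deriv_zbar j sqnorm = fun z => z 0 j.
Proof.
have hd := @derivation_zbar R n j; have [d0 _ _ _ dM] := hd.
rewrite /sqnorm (derivation_big _ (F := fun i z => z 0 i * (z 0 i)^*%C))//.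
  apply/funext => z; rewrite (bigD1 j)//= big1 => [|i /negbTE ij].
    rewrite dM; [|exact: zpoly_coord|exact: zpoly_conj].
    by rewrite (@deriv_zbar_coord R n j j) (@deriv_zbar_conj R n j j) eqxx mulr1 mul0r add0r addr0.
  rewrite dM; [|exact: zpoly_coord|exact: zpoly_conj].
  by rewrite (@deriv_zbar_coord R n j i) (@deriv_zbar_conj R n j i) ij mul0r mulr0 !addr0.
by move=> i; apply: Defs.zpoly_mul; [exact: zpoly_coord|exact: zpoly_conj].
Qed.

Lemma laplacian_dotl w z : laplacian (dotl w) z = 0.
Proof.
apply: big1 => j _; rewrite deriv_zbar_dotl.
by have [-> _ _ _ _] := @derivation_z R n j.
Qed.

Lemma laplacian_dotr w z : laplacian (dotr w) z = 0.
Proof.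
apply: big1 => j _; rewrite deriv_zbar_dotr.
by have [-> _ _ _ _] := @derivation_z R n j.
Qed.

Lemma laplacian_sqnorm z : laplacian sqnorm z = n%:R.
Proof.
rewrite /laplacian; under eq_bigr do rewrite deriv_zbar_sqnorm.
under eq_bigr => j _ do rewrite (@deriv_z_coord R n j j) eqxx.
by rewrite sumr_const card_ord.
Qed.

Lemma gradient_form_dotl w h z : gradient_form h (dotl w) z = 0.
Proof. by apply: big1 => j _; rewrite deriv_zbar_dotl mulr0. Qed.

Lemma gradient_form_dotr w h z : gradient_form (dotr w) h z = 0.
Proof. by apply: big1 => j _; rewrite deriv_z_dotr mul0r. Qed.

Lemma gradient_form_dotlr w z : gradient_form (dotl w) (dotr w) z = sqnorm w.
Proof.
by apply: eq_bigr => j _; rewrite deriv_z_dotl deriv_zbar_dotr mulrC.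
Qed.

Lemma gradient_form_dotl_sqnorm w z :
  gradient_form (dotl w) sqnorm z = dotl w z.
Proof.
by apply: eq_bigr => j _; rewrite deriv_z_dotl deriv_zbar_sqnorm mulrC.
Qed.

Lemma gradient_form_sqnorm_dotr w z :
  gradient_form sqnorm (dotr w) z = dotr w z.
Proof. by apply: eq_bigr => j _; rewrite deriv_z_sqnorm deriv_zbar_dotr. Qed.

Lemma gradient_form_sqnorm z : gradient_form sqnorm sqnorm z = sqnorm z.
Proof.
by apply: eq_bigr => j _; rewrite deriv_z_sqnorm deriv_zbar_sqnorm mulrC.
Qed.

(* |z|^2 |w|^2 - |<z, w>|^2 when |w| = 1 *)
Definition codot w z : C := -1 * (dotl w z * dotr w z) + sqnorm z.

Lemma codotE w z : codot w z = sqnorm z - dotl w z * dotr w z.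
Proof. by rewrite /codot addrC mulN1r. Qed.

Let zlr w : zpoly (fun z => dotl w z * dotr w z).
Proof. exact: Defs.zpoly_mul. Qed.

Lemma bidegree_codot w : bidegree 1 1 (codot w).
Proof.
apply: bidegree_add; last exact: bidegree_sqnorm.
apply: bidegree_scale.
exact: (bidegree_mul (bidegree_dotl w) (bidegree_dotr w)).
Qed.

Let zc w : zpoly (codot w). Proof. exact: bidegree_zpoly (bidegree_codot w). Qed.

Lemma derivation_codot d w : derivation d ->
  d (codot w) = fun z => d sqnorm z - (d (dotl w) z * dotr w z + dotl w z * d (dotr w) z).
Proof.
move=> [d0 _ _ dD dM]; have h1 : zpoly (fun=> -1) by exact: zpoly_cst.
rewrite /codot dD//; last exact: (@Defs.zpoly_mul R n (fun=> -1)).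
rewrite (dM (fun=> -1))// (dM (dotl w))// d0; apply/funext => z.
by rewrite mul0r add0r mulN1r addrC.
Qed.

Lemma gradient_form_codotr w h z : gradient_form h (codot w) z =
  gradient_form h sqnorm z - dotl w z * gradient_form h (dotr w) z.
Proof.
rewrite /gradient_form mulr_sumr -sumrB; apply: eq_bigr => j _.
rewrite (derivation_codot w (@derivation_zbar R n j)) deriv_zbar_dotl mul0r add0r.
by rewrite mulrBr; congr (_ - _); rewrite mulrCA.
Qed.

Lemma gradient_form_codotl w h z : gradient_form (codot w) h z =
  gradient_form sqnorm h z - dotr w z * gradient_form (dotl w) h z.
Proof.
rewrite /gradient_form mulr_sumr -sumrB; apply: eq_bigr => j _.
rewrite (derivation_codot w (@derivation_z R n j)) deriv_z_dotr mulr0 addr0.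
by rewrite mulrBl; congr (_ - _); rewrite mulrAC mulrC.
Qed.

Section unit_vector.
Variable w : Cn.
Hypothesis w1 : sqnorm w = 1.

Lemma gradient_form_dotl_codot z : gradient_form (dotl w) (codot w) z = 0.
Proof.
by rewrite gradient_form_codotr gradient_form_dotl_sqnorm gradient_form_dotlr w1 mulr1 subrr.
Qed.

Lemma gradient_form_codot_dotr z : gradient_form (codot w) (dotr w) z = 0.
Proof.
by rewrite gradient_form_codotl gradient_form_sqnorm_dotr gradient_form_dotlr w1 mulr1 subrr.
Qed.

Lemma gradient_form_codot_sqnorm z :
  gradient_form (codot w) sqnorm z = codot w z.
Proof.
rewrite gradient_form_codotl gradient_form_sqnorm gradient_form_dotl_sqnorm.
by rewrite codotE [dotr w z * _]mulrC.
Qed.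

Lemma gradient_form_sqnorm_codot z :
  gradient_form sqnorm (codot w) z = codot w z.
Proof.
rewrite gradient_form_codotr gradient_form_sqnorm gradient_form_sqnorm_dotr.
by rewrite codotE.
Qed.

Lemma gradient_form_codot z : gradient_form (codot w) (codot w) z = codot w z.
Proof.
by rewrite gradient_form_codotr gradient_form_codot_dotr mulr0 subr0
  gradient_form_codot_sqnorm.
Qed.

Lemma laplacian_codot z : laplacian (codot w) z = n%:R - 1.
Proof.
rewrite /codot laplacian_lin// laplacian_sqnorm.
rewrite laplacian_mul// laplacian_dotl laplacian_dotr gradient_form_dotlr.
by rewrite gradient_form_dotr w1 mul0r mulr0 !addr0 add0r mulr1 addrC.
Qed.

(** Put u = [codot w] and r = [sqnorm]. The first-order forms close up on u and r: (u,u), (u,r) and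
    (r,u) give u, and (r,r) gives r. As A is harmonic, orthogonal to u and homogeneous of total
    degree d, only two neighbours of A u^m r^k appear, and harmonicity becomes a two-term recursion
    in m. *)
Lemma laplacian_codot_sqnorm (A : Cn -> C) (d m k : nat) z :
  (0 < n)%N -> zpoly A -> laplacian A z = 0 ->
  gradient_form A (codot w) z = 0 -> gradient_form (codot w) A z = 0 ->
  gradient_form A sqnorm z + gradient_form sqnorm A z = d%:R * A z ->
  laplacian (fun z => A z * (codot w z ^+ m * sqnorm z ^+ k)) z =
  A z * ((m * (n.-1 + m.-1))%:R * (codot w z ^+ m.-1 * sqnorm z ^+ k) +
         (k * (n + k.-1 + 2 * m + d))%:R * (codot w z ^+ m * sqnorm z ^+ k.-1)).
Proof.
move=> n0 zA lA Ac cA As; have zcm : zpoly (fun z => codot w z ^+ m) by exact: zpoly_exp.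
have zsk : zpoly (fun z => sqnorm z ^+ k) by exact: zpoly_exp.
have zcs : zpoly (fun z => codot w z ^+ m * sqnorm z ^+ k) by exact: Defs.zpoly_mul.
rewrite laplacian_mul// laplacian_mul// lA !laplacian_exp//.
rewrite (gradient_form_expr _ _ _ zs) (gradient_form_expl _ _ _ zs).
rewrite (gradient_form_expr _ _ _ (zc w)) (gradient_form_expl _ _ _ (zc w)).
rewrite gradient_form_mulr// gradient_form_mull//.
rewrite (gradient_form_expr _ _ _ zs) (gradient_form_expl _ _ _ zs).
rewrite (gradient_form_expr _ _ _ (zc w)) (gradient_form_expl _ _ _ (zc w)).
rewrite Ac cA laplacian_codot laplacian_sqnorm gradient_form_codot.
rewrite gradient_form_sqnorm gradient_form_codot_sqnorm gradient_form_sqnorm_codot.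
have {}As : gradient_form A sqnorm z = d%:R * A z - gradient_form sqnorm A z.
  by rewrite -As addrK.
have nE : n%:R = n.-1%:R + 1 :> C by rewrite -[in LHS](prednK n0) -natr1.
rewrite As !(natrM, natrD) nE; move: (n.-1)%:R => N.
move: (A z) (gradient_form sqnorm A z) (codot w z) (sqnorm z) => a b u r.
by case: m {zcm zcs} => [|[|m]]; case: k {zsk} => [|[|k]]; rewrite /= ?exprS; ring.
Qed.


End unit_vector.
End zonal_kernel.

(** * Harmonicity of the zonal functions *)

Section zonal_harmonic.
Variables (R : realType) (n : nat).
Local Notation C := R[i].
Local Notation Cn := 'rV[R[i]]_n.
Local Notation bidegree := (@bidegree R n).
Local Notation zpoly := (@zpoly R n).
Local Notation codot := (@codot R n).
Implicit Types (f g h : Cn -> C) (z w : Cn) (k d m : nat).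

Lemma laplacian_sum (I : Type) (r : seq I) (a : I -> C) (F : I -> Cn -> C) z :
  (forall i, zpoly (F i)) ->
  laplacian (fun z => \sum_(i <- r) a i * F i z) z =
  \sum_(i <- r) a i * laplacian (F i) z.
Proof.
move=> zF; elim: r => [|i r IH].
  rewrite big_nil (_ : (fun z => _) = fun=> 0) ?laplacian_cst//.
  by apply/funext => y; rewrite big_nil.
have zS : zpoly (fun z => \sum_(i <- r) a i * F i z).
  apply: zpoly_sum => j; apply: (@Defs.zpoly_mul R n (fun=> a j)) => //.
  exact: zpoly_cst.
have := laplacian_lin (a i) z (zF i) zS; rewrite big_cons -IH => <-.
by congr (laplacian _ z); apply/funext => y; rewrite big_cons.
Qed.

(* The coefficients of the Jacobi polynomial P_k^(n-2,d)(1 - 2x), up to a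
   factor independent of m. *)
Definition jacobi_coef k d m : R :=
  (-1) ^+ m * 'C(k, m)%:R * (n - 2 + m + k + d)`!%:R / (n - 2 + m)`!%:R.

(** The left-hand side is the coefficient of [codot] ^ m times [sqnorm] ^ (k-m-1) in the Laplacian
    of the zonal function. It vanishes by (m+1) 'C(k, m+1) = (k-m) 'C(k, m) and one step of each
    factorial. *)
Lemma jacobi_coef_rec k d m : (2 <= n)%N -> (m < k)%N ->
  jacobi_coef k d m.+1 * (m.+1 * (n.-1 + m))%:R +
  jacobi_coef k d m * ((k - m) * (n + (k - m).-1 + 2 * m + d))%:R = 0.
Proof.
move=> n2 mk; pose N := (n - 2)%N; have nE : n = N.+2 by rewrite -addn2 subnK.
have n1E : n.-1 = N.+1 by rewrite nE.
have eN : (n + (k - m).-1 + 2 * m + d = (N + m + k + d).+1)%N by lia.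
rewrite /jacobi_coef -/N eN n1E addnS !addSn !factS.
have n1 : (N + m).+1%:R != 0 :> R by rewrite pnatr_eq0.
have n3 : (N + m)`!%:R != 0 :> R by rewrite pnatr_eq0 -lt0n fact_gt0.
have bE : m.+1%:R * 'C(k, m.+1)%:R = (k - m)%:R * 'C(k, m)%:R :> R.
  by rewrite -!natrM mul_bin_left.
rewrite exprS !natrM; move: bE n1 n3.
move: m.+1%:R 'C(k, m.+1)%:R (k - m)%:R 'C(k, m)%:R => a b c e.
move: (N + m).+1%:R (N + m)`!%:R (N + m + k + d).+1%:R (N + m + k + d)`!%:R.
move: ((-1) ^+ m) => s x y u v abce x0 y0.
transitivity (s * v / y * u * (c * e - a * b)).
  by field; rewrite x0 y0.
by rewrite abce subrr mulr0.
Qed.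

(** The reproducing kernel up to a factor, as a homogeneous polynomial in z: the powers of [sqnorm]
    bring all terms to the bidegree (k + d1, k + d2) and equal 1 on the sphere. *)
Definition zonal k d1 d2 w z : C := \sum_(m < k.+1) (jacobi_coef k (d1 + d2) m)%:C%C *
  ((dotl w z ^+ d1 * dotr w z ^+ d2) * (codot w z ^+ m * sqnorm z ^+ (k - m))).

Lemma bidegree_zonal k d1 d2 w : bidegree (k + d1) (k + d2) (zonal k d1 d2 w).
Proof.
apply: bidegree_sum => m _; apply: bidegree_scale.
have h1 := bidegree_mul (bidegree_exp d1 (bidegree_dotl w))
                        (bidegree_exp d2 (bidegree_dotr w)).
have h2 := bidegree_mul (bidegree_exp m (bidegree_codot w))
                        (bidegree_exp (k - m) (@bidegree_sqnorm R n)).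
have := bidegree_mul h1 h2; rewrite !muln0 !muln1 subnKC; last by rewrite -ltnS.
by rewrite addn0 add0n addnC [(d2 + k)%N]addnC.
Qed.

(** The hypothesis [d1 * d2 = 0] makes the monomial factor A holomorphic or antiholomorphic, hence
    harmonic: its Laplacian carries the factor d1 d2. *)
Lemma laplacian_zonal k d1 d2 w z : (2 <= n)%N -> (d1 * d2 = 0)%N ->
  sqnorm w = 1 -> laplacian (zonal k d1 d2 w) z = 0.
Proof.
move=> n2 d0 w1.
have zl := bidegree_zpoly (bidegree_dotl w).
have zr := bidegree_zpoly (bidegree_dotr w).
have zc := bidegree_zpoly (bidegree_codot w).
have zs := bidegree_zpoly (@bidegree_sqnorm R n).
have zl1 : zpoly (fun z => dotl w z ^+ d1) by exact: zpoly_exp.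
have zr1 : zpoly (fun z => dotr w z ^+ d2) by exact: zpoly_exp.
pose A z := dotl w z ^+ d1 * dotr w z ^+ d2.
have zA : zpoly A by exact: Defs.zpoly_mul.
have d0R : d1%:R * d2%:R = 0 :> C by rewrite -natrM d0.
have lA : laplacian A z = 0.
  rewrite /A laplacian_mul// !laplacian_exp// laplacian_dotl laplacian_dotr.
  rewrite !gradient_form_expr// !gradient_form_expl//.
  rewrite gradient_form_dotl !gradient_form_dotr gradient_form_dotlr w1.
  rewrite !mulr0 !addr0 !mulr0 mul0r !add0r mulr1.
  by rewrite mulrACA [d2%:R * _]mulrC d0R mul0r.
have Ac : gradient_form A (codot w) z = 0.
  rewrite /A gradient_form_mull// !gradient_form_expl//.
  by rewrite gradient_form_dotl_codot// gradient_form_dotr !mulr0 mul0r addr0.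
have cA : gradient_form (codot w) A z = 0.
  rewrite /A gradient_form_mulr// !gradient_form_expr//.
  by rewrite gradient_form_dotl gradient_form_codot_dotr// !mulr0 mul0r addr0.
have expK d (x : C) : d%:R * x ^+ d.-1 * x = d%:R * x ^+ d.
  by case: d => [|d]; rewrite ?mul0r// -mulrA exprSr.
have As : gradient_form A sqnorm z + gradient_form sqnorm A z =
    (d1 + d2)%:R * A z.
  rewrite /A gradient_form_mull// gradient_form_mulr//.
  rewrite !gradient_form_expl// !gradient_form_expr//.
  rewrite gradient_form_dotl_sqnorm gradient_form_sqnorm_dotr.
  rewrite gradient_form_dotl gradient_form_dotr !expK natrD.
  rewrite !mulr0 mul0r addr0 add0r mulrDl; congr (_ + _); first by rewrite mulrA.
  by rewrite mulrCA.
rewrite /zonal laplacian_sum; last first.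
  by move=> m; apply: (Defs.zpoly_mul zA); apply: Defs.zpoly_mul; exact: zpoly_exp.
have n0 : (0 < n)%N by rewrite ltnW.
under eq_bigr => m _ do
  rewrite (laplacian_codot_sqnorm w1 m (k - m) n0 zA lA Ac cA As) mulrCA mulrDr.
(* The first sum loses its term m = 0 and the second its term m = k; after the shift the two cancel
   term by term. *)
rewrite -mulr_sumr big_split /= big_ord_recl /= !mul0r mulr0 add0r.
rewrite [X in _ + X]big_ord_recr /= subnn !mul0r mulr0 addr0 -big_split /=.
rewrite big1 ?mulr0// => m _.
have e1 : (k - m.+1 = (k - m).-1)%N by rewrite subnS.
rewrite /bump /= add1n e1.
transitivity ((jacobi_coef k (d1 + d2) m.+1 * (m.+1 * (n.-1 + m))%:R +
  jacobi_coef k (d1 + d2) m * ((k - m) * (n + (k - m).-1 + 2 * m + (d1 + d2)))%:R)%:C%C *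
  (codot w z ^+ m * sqnorm z ^+ (k - m).-1)).
  move: (jacobi_coef _ _ _) (jacobi_coef _ _ _) => x y.
  move: (m.+1 * _)%N ((k - m) * _)%N => a b.
  by rewrite rmorphD !rmorphM /= !rmorph_nat mulrDl !mulrA.
by rewrite jacobi_coef_rec// rmorph0 mul0r.
Qed.

End zonal_harmonic.

(** * Means of harmonic polynomials against powers of <y,z> and its conjugate *)

Section reproducing.
Variables (R : realType) (n : nat).
Local Notation C := R[i].
Local Notation Cn := 'rV[R[i]]_n.
Local Notation bidegree := (@bidegree R n).
Local Notation zpoly := (@zpoly R n).
Implicit Types (f g h : Cn -> C) (y z : Cn).

Variables (D : nat) (I : finType) (w : I -> R) (x : I -> sphere R n).
Hypothesis n0 : (0 < n)%N.
Hypothesis w1 : \sum_i w i = 1.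
Hypothesis by_parts : forall k h, bidegree k.+1 k.+1 h -> (k < D)%N ->
  (k.+1 * (n + k))%:R * (\sum_i (w i)%:C%C * h (val (x i))) =
  \sum_i (w i)%:C%C * laplacian h (val (x i)).

Let M h := \sum_i (w i)%:C%C * h (val (x i)).

Let M_scale a f : M (fun y => a * f y) = a * M f.
Proof. by rewrite /M mulr_sumr; apply: eq_bigr => e _; rewrite mulrCA. Qed.

Let M_add f g : M (fun y => f y + g y) = M f + M g.
Proof. by rewrite /M -big_split /=; apply: eq_bigr => e _; rewrite mulrDr. Qed.

Variable z : Cn.
Hypothesis z1 : sqnorm z = 1.

Let zl : zpoly (dotl z). Proof. exact: bidegree_zpoly (bidegree_dotl z). Qed.
Let zr : zpoly (dotr z). Proof. exact: bidegree_zpoly (bidegree_dotr z). Qed.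

Lemma laplacian_dotr_dotl a b y :
  laplacian (fun y => dotr z y ^+ a * dotl z y ^+ b) y =
  (a * b)%:R * (dotr z y ^+ a.-1 * dotl z y ^+ b.-1).
Proof.
rewrite laplacian_mul; [|exact: zpoly_exp..].
rewrite !laplacian_exp// laplacian_dotl laplacian_dotr.
rewrite !gradient_form_expr// !gradient_form_expl//.
rewrite gradient_form_dotl !gradient_form_dotr gradient_form_dotlr z1.
rewrite !mulr0 !addr0 !mulr0 mul0r !add0r mulr1 natrM.
by move: (dotl z y ^+ _) (dotr z y ^+ _) => s t; ring.
Qed.

(** Integration by parts gives (n+a) m_(a+1) = (a+1) m_a for the moments of |<y,z>|^2, those of the
    Beta(1, n-1) law. *)
Lemma mean_moment a : (a <= D)%N ->
  (n.-1 + a)`!%:R * M (fun y => dotr z y ^+ a * dotl z y ^+ a) =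
  (a`! * n.-1`!)%:R.
Proof.
elim: a => [_|a IH aD].
  rewrite addn0 fact0 mul1n -[RHS]mulr1; congr (_ * _).
  rewrite /M; under eq_bigr do rewrite !expr0 !mulr1.
  by rewrite -rmorph_sum w1.
have hb := bidegree_mul (bidegree_exp a.+1 (bidegree_dotr z))
  (bidegree_exp a.+1 (bidegree_dotl z)).
rewrite !muln0 !muln1 addn0 add0n in hb.
have := by_parts hb aD; rewrite -/(M _) => e.
have {}e : (n + a)%:R * M (fun y => dotr z y ^+ a.+1 * dotl z y ^+ a.+1) =
    a.+1%:R * M (fun y => dotr z y ^+ a * dotl z y ^+ a).
  apply: (@mulfI _ a.+1%:R); first by rewrite pnatr_eq0.
  rewrite mulrA -natrM e mulrA -natrM -M_scale.
  by apply: eq_bigr => i _; rewrite laplacian_dotr_dotl.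
have na : (n + a = (n.-1 + a).+1)%N by rewrite -addSn prednK.
rewrite addnS factS -na natrM mulrAC e mulrAC -mulrA IH 1?ltnW//.
by rewrite -natrM factS mulnA.
Qed.

(** Derivative in the fixed direction z. It keeps harmonicity, and at y = z Euler's identity
    evaluates it as p f(z). *)
Definition holo_deriv f y : C := \sum_j z 0 j * deriv_z j f y.
Definition antiholo_deriv f y : C := \sum_j (z 0 j)^*%C * deriv_zbar j f y.

Lemma derivation_holo : derivation holo_deriv.
Proof. by apply: derivation_sum => j; exact: derivation_z. Qed.

Lemma derivation_antiholo : derivation antiholo_deriv.
Proof. by apply: derivation_sum => j; exact: derivation_zbar. Qed.

Lemma laplacian_reproducing f a b y : zpoly f -> laplacian f y = 0 ->
  laplacian (fun y => f y * (dotr z y ^+ a * dotl z y ^+ b)) y =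
  a%:R * (holo_deriv f y * (dotr z y ^+ a.-1 * dotl z y ^+ b)) +
  b%:R * (antiholo_deriv f y * (dotr z y ^+ a * dotl z y ^+ b.-1)) +
  (a * b)%:R * (f y * (dotr z y ^+ a.-1 * dotl z y ^+ b.-1)).
Proof.
move=> zf lf.
have zra : zpoly (fun y => dotr z y ^+ a) by exact: zpoly_exp.
have zlb : zpoly (fun y => dotl z y ^+ b) by exact: zpoly_exp.
rewrite laplacian_mul//; last exact: Defs.zpoly_mul.
rewrite lf laplacian_dotr_dotl gradient_form_mulr// gradient_form_mull//.
rewrite !gradient_form_expr// !gradient_form_expl//.
rewrite gradient_form_dotl gradient_form_dotr.
have -> : gradient_form f (dotr z) y = holo_deriv f y.
  by apply: eq_bigr => j _; rewrite deriv_zbar_dotr mulrC.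
have -> : gradient_form (dotl z) f y = antiholo_deriv f y.
  by apply: eq_bigr => j _; rewrite deriv_z_dotl.
move: (holo_deriv f y) (antiholo_deriv f y) (dotl z y ^+ b) (dotr z y ^+ a).
by move: (dotl z y ^+ _) (dotr z y ^+ _) (f y) => *; ring.
Qed.

(** Induction on a + b. Integration by parts yields three means of the same shape: f differentiated
    along z with a or b lowered, or f itself with both lowered. For a < p all three vanish. For a =
    p, and then b = q, the third falls under a < p, while Euler's identity at z turns the others
    into p and q times the same value; their sum p + q cancels the factor in front. The condition p
    + b = q + a balances the two degrees of the integrand. *)
Lemma mean_reproducing p q f a b : bidegree p q f ->
  (forall y, laplacian f y = 0) -> (p + b = q + a)%N -> (p + b <= D)%N ->
  ((a < p)%N -> M (fun y => f y * (dotr z y ^+ a * dotl z y ^+ b)) = 0) /\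
  (a = p -> (n.-1 + (p + q))`!%:R * M (fun y => f y * (dotr z y ^+ a * dotl z y ^+ b))
     = (n.-1`! * (p`! * q`!))%:R * f z).
Proof.
have [N] := ubnP (a + b); elim: N => // N IH in p q f a b * => abN hf lf pbqa pbD.
case e : (p + b)%N pbD => [|k] kD.
  split=> [ap|ap]; first by lia.
  have [p0 q0 a0 b0] : [/\ p = 0, q = 0, a = 0 & b = 0]%N by split; lia.
  move: hf; rewrite a0 b0 p0 q0 !addn0 fact0 !muln1 => hf; congr (_ * _).
  (* Homogeneity of bidegree (0, 0) with factor 0 and the convention 0^0 = 1: f is constant. *)
  have fz y : f y = f 0 by rewrite -[0](scale0r y) (bidegree_homogeneous _ _ hf) !mul1r.
  rewrite /M; under eq_bigr do rewrite !expr0 !mulr1 fz.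
  by rewrite -mulr_suml -rmorph_sum w1 mul1r fz.
have zf := bidegree_zpoly hf.
have hB := bidegree_mul (bidegree_exp a (bidegree_dotr z))
  (bidegree_exp b (bidegree_dotl z)).
have := bidegree_mul hf hB; rewrite !muln0 !muln1 addn0 add0n -pbqa e => hh.
have ibp : (k.+1 * (n + k))%:R * M (fun y => f y * (dotr z y ^+ a * dotl z y ^+ b)) =
    a%:R * M (fun y => holo_deriv f y * (dotr z y ^+ a.-1 * dotl z y ^+ b)) +
    b%:R * M (fun y => antiholo_deriv f y * (dotr z y ^+ a * dotl z y ^+ b.-1)) +
    (a * b)%:R * M (fun y => f y * (dotr z y ^+ a.-1 * dotl z y ^+ b.-1)).
  rewrite [LHS](by_parts hh kD) -!M_scale -!M_add; apply: eq_bigr => i _.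
  by rewrite (laplacian_reproducing a b zf (lf _)).
have hH : bidegree p.-1 q (holo_deriv f).
  by apply: bidegree_sum => j _; apply: bidegree_scale; exact: bidegree_deriv_z.
have hA : bidegree p q.-1 (antiholo_deriv f).
  by apply: bidegree_sum => j _; apply: bidegree_scale; exact: bidegree_deriv_zbar.
have l0 : laplacian f = fun=> 0 by apply/funext.
have lH y : laplacian (holo_deriv f) y = 0.
  rewrite (laplacian_derivation derivation_holo zf) l0.
  by have [-> _ _ _ _] := derivation_holo.
have lA y : laplacian (antiholo_deriv f) y = 0.
  rewrite (laplacian_derivation derivation_antiholo zf) l0.
  by have [-> _ _ _ _] := derivation_antiholo.
have nk0 : (k.+1 * (n + k))%:R != 0 :> C.
  by rewrite pnatr_eq0 -lt0n muln_gt0 addn_gt0 n0.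
split=> ap.
  apply: (mulfI nk0); rewrite ibp mulr0.
  have -> : a%:R * M (fun y => holo_deriv f y * (dotr z y ^+ a.-1 * dotl z y ^+ b)) = 0.
    case: (posnP a) => [->|a0]; first by rewrite mul0r.
    by rewrite (IH _ _ _ _ _ _ hH lH _ _).1 ?mulr0//; lia.
  have -> : b%:R * M (fun y => antiholo_deriv f y * (dotr z y ^+ a * dotl z y ^+ b.-1)) = 0.
    case: (posnP b) => [->|b0]; first by rewrite mul0r.
    by rewrite (IH _ _ _ _ _ _ hA lA _ _).1 ?mulr0//; lia.
  have -> : (a * b)%:R * M (fun y => f y * (dotr z y ^+ a.-1 * dotl z y ^+ b.-1)) = 0.
    case: (posnP a) => [->|a0]; first by rewrite mul0n mul0r.
    case: (posnP b) => [->|b0]; first by rewrite muln0 mul0r.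
    by rewrite (IH _ _ _ _ _ _ hf lf _ _).1 ?mulr0//; lia.
  by rewrite !addr0.
have bq : b = q by lia.
have k1 : (p + q)%N = k.+1 by rewrite -bq.
have e1 : (n.-1 + k)`!%:R * (a%:R * M (fun y => holo_deriv f y *
    (dotr z y ^+ a.-1 * dotl z y ^+ b))) = p%:R * ((n.-1`! * (p`! * q`!))%:R * f z).
  case: (posnP p) => [p0|p0]; first by rewrite ap p0 !mul0r mulr0.
  have h1 : (a.-1 + b < N)%N by lia.
  have h2 : (p.-1 + b = q + a.-1)%N by lia.
  have h3 : (p.-1 + b <= D)%N by lia.
  have [_ /(_ (congr1 predn ap))] := IH _ _ _ _ _ h1 hH lH h2 h3.
  have -> : (n.-1 + (p.-1 + q) = n.-1 + k)%N by lia.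
  have hz : holo_deriv f z = p%:R * f z := euler_z z hf.
  move=> E; rewrite mulrCA E hz.
  rewrite ap -[in (p`!)](prednK p0) factS prednK// !natrM.
  by move: (f z) => t; ring.
have e2 : (n.-1 + k)`!%:R * (b%:R * M (fun y => antiholo_deriv f y *
    (dotr z y ^+ a * dotl z y ^+ b.-1))) = q%:R * ((n.-1`! * (p`! * q`!))%:R * f z).
  case: (posnP q) => [q0|q0]; first by rewrite bq q0 !mul0r mulr0.
  have h1 : (a + b.-1 < N)%N by lia.
  have h2 : (p + b.-1 = q.-1 + a)%N by lia.
  have h3 : (p + b.-1 <= D)%N by lia.
  have [_ /(_ ap)] := IH _ _ _ _ _ h1 hA lA h2 h3.
  have -> : (n.-1 + (p + q.-1) = n.-1 + k)%N by lia.
  have hz : antiholo_deriv f z = q%:R * f z := euler_zbar z hf.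
  move=> E; rewrite mulrCA E hz.
  rewrite bq -[in (q`!)](prednK q0) factS prednK// !natrM.
  by move: (f z) => t; ring.
have e3 : (a * b)%:R * M (fun y => f y * (dotr z y ^+ a.-1 * dotl z y ^+ b.-1)) = 0.
  case: (posnP a) => [->|a0]; first by rewrite mul0n mul0r.
  case: (posnP b) => [->|b0]; first by rewrite muln0 mul0r.
  by rewrite (IH _ _ _ _ _ _ hf lf _ _).1 ?mulr0//; lia.
have nk : (n.-1 + (p + q) = (n.-1 + k).+1)%N by rewrite k1 addnS.
have nk' : (n + k = (n.-1 + k).+1)%N by rewrite -addSn prednK.
apply: (@mulfI _ k.+1%:R); first by rewrite pnatr_eq0.
rewrite nk factS -nk' [(_ * _`!)%N]mulnC natrM.
transitivity ((n.-1 + k)`!%:R * ((k.+1 * (n + k))%:R * 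
    M (fun y => f y * (dotr z y ^+ a * dotl z y ^+ b)))).
  by rewrite natrM; move: (M _) => t; ring.
by rewrite ibp e3 addr0 mulrDr e1 e2 -mulrDl -natrD k1.
Qed.

End reproducing.

(** * Reproducing property and absolute mean of the kernel *)

Section zonal_mean.
Variables (R : realType) (n : nat).
Local Notation C := R[i].
Local Notation Cn := 'rV[R[i]]_n.
Local Notation bidegree := (@bidegree R n).
Local Notation zonal := (@zonal R n).
Implicit Types (f g h : Cn -> C) (y z : Cn).

(** Pythagoras for the projection of z on the line of y. Positivity of the left-hand side is the
    source of the Cauchy-Schwarz inequality [abs_dot_le1]. *)
Lemma sqnorm_sub_dotl y z : sqnorm y = 1 ->
  sqnorm (z - dotl y z *: y) = codot y z.
Proof.
move=> y1; rewrite codotE; set c := dotl y z.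
have cE : c^*%C = dotr y z by exact: dotl_conj.
transitivity (\sum_j (z 0 j * (z 0 j)^*%C - c^*%C * (z 0 j * (y 0 j)^*%C)
    - c * ((z 0 j)^*%C * y 0 j) + c * c^*%C * (y 0 j * (y 0 j)^*%C))).
  apply: eq_bigr => j _; rewrite !mxE rmorphB rmorphM /=.
  by move: (z 0 j) (z 0 j)^*%C (y 0 j) (y 0 j)^*%C c^*%C => *; ring.
rewrite !big_split /= !sumrN -!mulr_sumr -/(dotl y z) -/(dotr y z) -/c -cE.
by rewrite -/(sqnorm z) -/(sqnorm y) y1; move: (sqnorm z) c^*%C => *; ring.
Qed.

Definition abs_dot y z : R := complex.Re `|dotl y z|.

Lemma abs_dotE y z : dotl y z * dotr y z = (abs_dot y z ^+ 2)%:C%C.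
Proof. by rewrite -dotl_conj -sqr_normc rmorphXn /= RRe_real// normr_real. Qed.

Lemma abs_dot_ge0 y z : 0 <= abs_dot y z.
Proof. by rewrite -ler0c RRe_real ?normr_real. Qed.

Lemma codot_unit y z : sqnorm z = 1 -> codot y z = (1 - abs_dot y z ^+ 2)%:C%C.
Proof. by move=> z1; rewrite codotE abs_dotE z1 rmorphB. Qed.

Lemma abs_dot_le1 y z : sqnorm y = 1 -> sqnorm z = 1 -> abs_dot y z <= 1.
Proof.
move=> y1 z1; have : 0 <= codot y z.
  by rewrite -sqnorm_sub_dotl//; apply: sumr_ge0 => j _; exact: mulcJ_ge0.
by rewrite codot_unit// ler0c subr_ge0 expr_le1// abs_dot_ge0.
Qed.

(** On the sphere [codot] is nonnegative, so absolute values fall only on the coefficients and on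
    the monomial factor. *)
Lemma normr_zonal_le k d1 d2 y z : sqnorm y = 1 -> sqnorm z = 1 ->
  complex.Re `|zonal k d1 d2 y z| <= abs_dot y z ^+ (d1 + d2) *
    \sum_(m < k.+1) `|jacobi_coef R n k (d1 + d2) m| * (1 - abs_dot y z ^+ 2) ^+ m.
Proof.
move=> y1 z1; have nE (c : R) : `|c%:C%C| = `|c|%:C%C.
  by rewrite normc_def /= expr0n addr0 sqrtr_sqr.
have s0 : 0 <= 1 - abs_dot y z ^+ 2.
  by rewrite subr_ge0 expr_le1 ?abs_dot_ge0 ?abs_dot_le1.
rewrite -lecR RRe_real ?normr_real// mulr_sumr rmorph_sum /=.
apply: (le_trans (ler_norm_sum _ _ _)); apply: ler_sum => m _.
have aE : `|dotl y z| = (abs_dot y z)%:C%C by rewrite RRe_real ?normr_real.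
move: (jacobi_coef _ _ _ _) => c.
rewrite z1 expr1n mulr1 codot_unit// !normrM !normrX -dotl_conj normcJ -exprD.
rewrite !nE (ger0_norm s0) aE -!rmorphXn -!rmorphM lecR.
by rewrite [in leRHS]mulrCA.
Qed.

Variables (D : nat) (I : finType) (w : I -> R) (x : I -> sphere R n).
Hypothesis n2 : (2 <= n)%N.
Hypothesis w1 : \sum_i w i = 1.
Hypothesis by_parts : forall k h, bidegree k.+1 k.+1 h -> (k < D)%N ->
  (k.+1 * (n + k))%:R * (\sum_i (w i)%:C%C * h (val (x i))) =
  \sum_i (w i)%:C%C * laplacian h (val (x i)).
Let n0 : (0 < n)%N. Proof. exact: ltnW. Qed.

(** The reciprocal of the product of two numbers: the factor of f(z) at top degree in
    [mean_reproducing], and the leading coefficient of the Jacobi polynomial in |<y,z>|^2. *)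
Definition zonal_scale k d1 d2 : R := (n.-1 + (k + d1 + (k + d2)))%:R *
  (n - 2 + k)`!%:R / (n.-1`! * ((k + d1)`! * (k + d2)`!))%:R.

(** Expanded in powers of |<y,z>|^2, the kernel pairs with f through its term of degree k only; the
    terms j < k have a = d1 + j < k + d1 and mean 0. The mean runs over the first argument of
    [zonal], while harmonicity concerns the second. *)
Lemma zonal_reproducing k d1 d2 f z : (k + d1 + (k + d2) <= D)%N ->
  bidegree (k + d1) (k + d2) f -> (forall y, laplacian f y = 0) ->
  sqnorm z = 1 ->
  (zonal_scale k d1 d2)%:C%C * (\sum_i (w i)%:C%C *
    (f (val (x i)) * zonal k d1 d2 (val (x i)) z)) = f z.
Proof.
move=> kD hf lf z1; pose a m := (jacobi_coef R n k (d1 + d2) m)%:C%C.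
(* The Jacobi factor as a polynomial in t = |<y,z>|^2. Its coefficient of degree k comes from m = k
   alone, with a sign (-1)^k that cancels the one in [jacobi_coef]. *)
pose Q := \sum_(m < k.+1) a m *: (1 - 'X : {poly C}) ^+ m.
have s1 m : (size ((1 - 'X : {poly C}) ^+ m) <= m.+1)%N.
  rewrite (leq_trans (size_poly_exp_leq _ _))//.
  have -> : size (1 - 'X : {poly C}) = 2%N by rewrite -opprB size_polyN size_XsubC.
  by rewrite mul1n.
have sQ : (size Q <= k.+1)%N.
  apply: (leq_trans (size_sum _ _ _)); apply/bigmax_leqP => m _.
  by rewrite (leq_trans (size_scale_leq _ _))// (leq_trans (s1 m))// ltnS -ltnS.
have Qk : Q`_k = a k * (-1) ^+ k.
  rewrite /Q coef_sum big_ord_recr /= big1 ?add0r => [|m _]; last first.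
    by rewrite coefZ nth_default ?mulr0// (leq_trans (s1 m)).
  rewrite coefZ; congr (_ * _).
  have -> : (1 - 'X : {poly C}) ^+ k = (-1) ^+ k *: ('X - 1%:P) ^+ k.
    by rewrite -exprZn scaleN1r opprB.
  rewrite coefZ (_ : (('X - 1%:P) ^+ k)`_k = 1) ?mulr1//.
  have /monicP := monic_exp k (monicXsubC (1 : C)).
  by rewrite lead_coefE size_exp_XsubC.
have zE i : zonal k d1 d2 (val (x i)) z = \sum_(j < k.+1) Q`_j *
    (dotr z (val (x i)) ^+ (d1 + j) * dotl z (val (x i)) ^+ (d2 + j)).
  move: (val (x i)) => y; transitivity (dotl y z ^+ d1 * dotr y z ^+ d2 *
      Q.[dotl y z * dotr y z]).
    rewrite /Q horner_sum mulr_sumr; apply: eq_bigr => m _.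
    rewrite z1 expr1n mulr1 codotE z1 hornerZ horner_exp [RHS]mulrCA.
    by rewrite (_ : (1 - 'X).[_] = 1 - dotl y z * dotr y z)// !hornerE.
  rewrite (horner_coef_wide _ sQ) mulr_sumr; apply: eq_bigr => j _.
  rewrite (dotr_sym z y) -(dotr_sym y z) !exprD exprMn.
  by move: (dotl y z ^+ _) (dotr y z ^+ _) (dotl y z ^+ _) (dotr y z ^+ _) => *; ring.
have step : \sum_i (w i)%:C%C * (f (val (x i)) * zonal k d1 d2 (val (x i)) z) =
    \sum_(j < k.+1) Q`_j * \sum_i (w i)%:C%C * (f (val (x i)) *
     (dotr z (val (x i)) ^+ (d1 + j) * dotl z (val (x i)) ^+ (d2 + j))).
  under eq_bigr do rewrite zE mulr_sumr mulr_sumr.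
  rewrite exchange_big /=; apply: eq_bigr => j _; rewrite mulr_sumr.
  apply: eq_bigr => i _; rewrite [in RHS]mulrCA; congr (_ * _).
  by rewrite mulrCA.
have rep (j : nat) : (j <= k)%N ->
    (k + d1 + (d2 + j) = k + d2 + (d1 + j))%N /\ (k + d1 + (d2 + j) <= D)%N.
  by move: kD => {zE step}; lia.
rewrite step big_ord_recr /= big1 ?add0r => [|j _]; last first.
  have [e1 e2] := rep j (ltnW (ltn_ord j)).
  rewrite (mean_reproducing n0 w1 by_parts z1 hf lf e1 e2).1 ?mulr0//.
  by rewrite addnC ltn_add2r.
have [e1 e2] := rep k (leqnn k).
have := (mean_reproducing n0 w1 by_parts z1 hf lf e1 e2).2 (addnC _ _).
set S := \sum_i _ => hS; rewrite Qk /a /zonal_scale.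
have fne m : m`!%:R != 0 :> C by rewrite pnatr_eq0 -lt0n fact_gt0.
set q := (k + d1 + (k + d2))%N in hS *.
have {}hS : S = (n.-1`! * ((k + d1)`! * (k + d2)`!))%:R * f z / (n.-1 + q)`!%:R.
  by rewrite -hS mulrAC mulfV// mul1r.
have [N nE] : exists N, n = N.+2 by exists (n - 2)%N; lia.
have fq : (n.-1 + q)`!%:R = (n.-1 + q)%:R * (N + k + k + (d1 + d2))`!%:R :> C.
  have -> : (N + k + k + (d1 + d2) = N + q)%N by rewrite /q; lia.
  by rewrite nE /= addSn factS natrM.
have n2E : (n - 2 = N)%N by lia.
have P0 : (n.-1`! * ((k + d1)`! * (k + d2)`!))%:R != 0 :> C.
  by rewrite pnatr_eq0 -lt0n !muln_gt0 !fact_gt0.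
move: P0 hS; move: (n.-1`! * _)%N => P P0 hS.
rewrite /jacobi_coef n2E binn mulr1 hS fq !rmorphM /= !fmorphV /= !rmorph_nat.
rewrite rmorphXn /= rmorphN1.
have s1k : (-1) ^+ k * (-1) ^+ k = 1 :> C by rewrite -exprMn mulrNN mulr1 expr1n.
have nq0 : (n.-1 + q)%:R != 0 :> C by rewrite nE pnatr_eq0.
move: (fne (N + k)%N) (fne (N + k + k + (d1 + d2))%N) P0 nq0 s1k.
move: (N + k + k + (d1 + d2))`!%:R (N + k)`!%:R (f z) P%:R => c B v A.
move: (n.-1 + q)%:R ((-1) ^+ k) => u s B0 c0 A0 u0 ss.
transitivity ((s * s) * v); last by rewrite ss mul1r.
by field; rewrite u0 A0 B0 c0.
Qed.

(** The linear functional on polynomials with the moments of [mean_moment]: the mean of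
    P(|<y,z>|^2), the same for every unit vector z. *)
Definition dot_moment (P : {poly R}) : R :=
  \sum_(j < size P) P`_j * ((j`! * n.-1`!)%:R / (n.-1 + j)`!%:R).

Lemma mean_poly (P : {poly R}) z : sqnorm z = 1 -> (size P <= D.+1)%N ->
  \sum_i w i * P.[abs_dot (val (x i)) z ^+ 2] = dot_moment P.
Proof.
move=> z1 sP; under eq_bigr do rewrite horner_coef mulr_sumr.
rewrite exchange_big /=; apply: eq_bigr => j _.
under eq_bigr do rewrite mulrCA.
rewrite -mulr_sumr; congr (_ * _).
have f0 : (n.-1 + j)`!%:R != 0 :> R by rewrite pnatr_eq0 -lt0n fact_gt0.
apply: (mulfI f0); rewrite mulrC [RHS]mulrC divfK// mulrC; apply: (@complexI R).
rewrite rmorphM /= !rmorph_nat -(mean_moment n0 w1 by_parts z1); last first.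
  by rewrite -ltnS (leq_trans _ sP).
congr (_ * _); rewrite rmorph_sum; apply: eq_bigr => i _.
by rewrite rmorphM /= dotr_sym -[dotl z _]dotr_sym -exprMn abs_dotE -rmorphXn.
Qed.

(** Replacing s^(d1+d2) by a majorant that is polynomial in s^2 brings the integrand within the
    exactness of the quadrature. *)
Lemma zonal_mean_le k d1 d2 (g : {poly R}) z : sqnorm z = 1 ->
  (forall i, 0 <= w i) -> (k + size g <= D)%N ->
  (forall s, 0 <= s <= 1 -> s ^+ (d1 + d2) <= g.[s ^+ 2]) ->
  \sum_i w i * complex.Re `|zonal k d1 d2 (val (x i)) z| <=
  \sum_(m < k.+1) `|jacobi_coef R n k (d1 + d2) m| *
     dot_moment ((1 - 'X) ^+ m * g).
Proof.
move=> z1 w0 kD hg.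
apply: (@le_trans _ _ (\sum_i \sum_(m < k.+1) `|jacobi_coef R n k (d1 + d2) m| *
    (w i * ((1 - 'X) ^+ m * g).[abs_dot (val (x i)) z ^+ 2]))).
  apply: ler_sum => i _; have y1 := sqnorm_sphere (x i).
  apply: (le_trans (ler_wpM2l (w0 i) (normr_zonal_le _ _ _ y1 z1))).
  rewrite mulr_sumr mulr_sumr; apply: ler_sum => m _.
  rewrite [leRHS]mulrCA ler_wpM2l// [leLHS]mulrCA ler_wpM2l//.
  have s0 := abs_dot_ge0 (val (x i)) z; have s1 := abs_dot_le1 y1 z1.
  rewrite hornerM horner_exp !hornerE mulrC ler_wpM2l//.
    by rewrite exprn_ge0// subr_ge0 expr_le1.
  by rewrite hg// s0.
rewrite exchange_big /=; apply: ler_sum => m _; rewrite -mulr_sumr.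
rewrite mean_poly// (leq_trans (size_polyMleq _ _))//.
have : (size ((1 - 'X : {poly R}) ^+ m) <= m.+1)%N.
  rewrite (leq_trans (size_poly_exp_leq _ _))//.
  have -> : size (1 - 'X : {poly R}) = 2%N by rewrite -opprB size_polyN size_XsubC.
  by rewrite mul1n.
rewrite -(leq_add2r (size g)) -subn1 => h.
rewrite leq_subLR (leq_trans h)// addSn add1n ltnS ltnW// ltnS.
by rewrite (leq_trans _ kD)// leq_add2r -ltnS.
Qed.

End zonal_mean.

(** * Extension of functionals and projections *)

Section real_hahn_banach.
Variables (R : realType) (V : lmodType R[i]) (N : V -> R).
Hypothesis ND : forall u v, N (u + v) <= N u + N v.
Hypothesis NZ : forall t v, 0 < t -> N (t%:C%C *: v) = t * N v.

(** A partial real-linear functional is represented by its graph. Domination by N already makes the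
    graph single-valued, as [good_fun] shows. *)
Let good (G : set (V * R)) :=
  (forall t u a v b, G (u, a) -> G (v, b) -> G (t%:C%C *: u + v, t * a + b)) /\
  (forall v a, G (v, a) -> a <= N v).

Let N0 : N 0 = 0.
Proof.
have := @NZ 2 0 (ltr0n _ 2); rewrite scaler0 => h; lra.
Qed.

Let good_fun G v a b : good G -> G (v, a) -> G (v, b) -> a = b.
Proof.
move=> [lG dG] ga gb.
have h c d : G (v, c) -> G (v, d) -> c - d <= 0.
  move=> gc gd; rewrite -N0; apply: dG.
  by have := lG (-1) _ _ _ _ gd gc; rewrite rmorphN1 scaleN1r addNr mulN1r addrC.
by apply/eqP; rewrite eq_le -subr_le0 -[b <= a]subr_le0 !h.
Qed.

(** The one-dimensional step: a value c at y0 is admissible if a - N(v - y0) <= c <= N(v' + y0) - a'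
    throughout the graph, and subadditivity leaves room for the supremum of the lower bounds. *)
Let extend G y0 : good G -> G (0, 0) -> exists c,
  good [set p | exists t v a, G (v, a) /\ p = (v + t%:C%C *: y0, a + t * c)].
Proof.
move=> [lG dG] g0.
pose S := [set s | exists v a, G (v, a) /\ s = a - N (v - y0)].
have Sub v' a' : G (v', a') -> ubound S (N (v' + y0) - a').
  move=> gv' _ [v [a [gv ->]]].
  have := dG _ _ (lG 1 _ _ _ _ gv gv'); rewrite rmorph1 scale1r mul1r.
  have := ND (v - y0) (v' + y0); rewrite addrACA addNr addr0 => h1 h2.
  by lra.
have Ss : has_sup S.
  split; first by exists (0 - N (0 - y0)); exists 0, 0.
  by exists (N (0 + y0) - 0); exact: Sub.
exists (sup S).
have c1 v a : G (v, a) -> a - N (v - y0) <= sup S.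
  by move=> gv; apply: (ub_le_sup Ss.2); exists v, a.
have c2 v a : G (v, a) -> sup S <= N (v + y0) - a.
  by move=> gv; apply: (ge_sup Ss.1); exact: Sub.
have GZ t v a : G (v, a) -> G (t%:C%C *: v, t * a).
  by move=> gv; have := lG t _ _ _ _ gv g0; rewrite !addr0.
split.
  move=> t u a v b [s [u' [a' [gu [-> ->]]]]] [r [v' [b' [gv [-> ->]]]]].
  exists (t * s + r), (t%:C%C *: u' + v'), (t * a' + b'); split; first exact: lG.
  congr (_, _); last by ring.
  by rewrite scalerDr scalerA addrACA -scalerDl rmorphD rmorphM.
move=> _ _ [t [v [a [gv [-> ->]]]]].
have [t0|t0|->] := ltgtP t 0.
- have s0 : 0 < - t by rewrite oppr_gt0.
  have := c1 _ _ (GZ (- t)^-1 _ _ gv).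
  have -> : v + t%:C%C *: y0 = (- t)%:C%C *: ((- t)^-1%:C%C *: v - y0).
    rewrite scalerBr scalerA -rmorphM /= divff ?gt_eqF// scale1r.
    by rewrite rmorphN scaleNr opprK.
  rewrite NZ//; set x := N _ => h.
  have : (- t) * ((- t)^-1 * a - x) <= (- t) * sup S by rewrite ler_pM2l.
  by rewrite mulrBr mulrA divff ?gt_eqF// mul1r => h1; lra.
- have := c2 _ _ (GZ t^-1 _ _ gv).
  have -> : v + t%:C%C *: y0 = t%:C%C *: (t^-1%:C%C *: v + y0).
    by rewrite scalerDr scalerA -rmorphM /= divff ?gt_eqF// scale1r.
  rewrite NZ//; set x := N _ => h.
  have : t * sup S <= t * (x - t^-1 * a) by rewrite ler_pM2l.
  by rewrite mulrBr mulrA divff ?gt_eqF// mul1r => h1; lra.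
- by rewrite rmorph0 scale0r addr0 mul0r addr0; exact: dG.
Qed.

(** Zorn's lemma on graphs: a maximal one is total, for otherwise [extend] would enlarge it. *)
Lemma real_hahn_banach (G0 : set (V * R)) : G0 (0, 0) ->
  (forall t u a v b, G0 (u, a) -> G0 (v, b) ->
    G0 (t%:C%C *: u + v, t * a + b)) ->
  (forall v a, G0 (v, a) -> a <= N v) ->
  exists u : V -> R, [/\ forall t x y, u (t%:C%C *: x + y) = t * u x + u y,
    forall x, u x <= N x & forall v a, G0 (v, a) -> u v = a].
Proof.
move=> g00 lG0 dG0.
(* [G0] is put in the predicate because [Zorn_bigcup] includes the empty chain. *)
pose P A := good (G0 `|` A).
have [F FP Ftot|A [PA maxA]] := @Zorn_bigcup _ P.
  have two p q : (G0 `|` \bigcup_(X in F) X) p -> (G0 `|` \bigcup_(X in F) X) q ->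
      (G0 p /\ G0 q) \/ exists2 X, F X & (G0 `|` X) p /\ (G0 `|` X) q.
    move=> [gp|[X FX Xp]] [gq|[Y FY Yq]].
    - by left.
    - by right; exists Y => //; split; [left|right].
    - by right; exists X => //; split; [right|left].
    - by have [XY|YX] := Ftot _ _ FX FY; right; [exists Y => //|exists X => //];
        split; right => //; [exact: XY|exact: YX].
  split=> [t u a v b gu gv|v a].
    have [[hu hv]|[X FX [hu hv]]] := two _ _ gu gv; first by left; exact: lG0.
    have [lX _] := FP X FX; have [h|h] := lX t _ _ _ _ hu hv; first by left.
    by right; exists X.
  move=> [|[X FX Xv]]; first exact: dG0.
  by have [_ dX] := FP X FX; apply: dX; right.
set G := G0 `|` A in PA; have gG : good G by [].
have G00 : G (0, 0) by left.
have tot y : exists a, G (y, a).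
  apply: contrapT => ny; have [c] := extend y gG G00.
  set G' := [set p | _] => gG'.
  have GG' : G `<=` G'.
    move=> [v a] gv; exists 0, v, a; split => //.
    by rewrite rmorph0 scale0r mul0r !addr0.
  have yc : G' (y, c).
    by exists 1, 0, 0; split => //; rewrite rmorph1 scale1r mul1r !add0r.
  apply: (maxA G').
    split; first by move=> p Ap; apply: GG'; right.
    by move=> /(_ _ yc) Ac; apply: ny; exists c; right.
  rewrite /P (_ : G0 `|` G' = G')//; apply/seteqP; split=> [p [|//]|p]; last by right.
  by move=> gp; apply: GG'; left.
have /choice[u hu] := tot; exists u; split.
- move=> t x y; apply: (good_fun gG (hu _)).
  by have [lG _] := gG; exact: lG.
- by move=> x; have [_ dG] := gG; exact: dG.
- by move=> v a gv; apply: (good_fun gG (hu v)); left.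
Qed.

End real_hahn_banach.

(** The real part of phi is extended to u, and T(y) = u(y) - i u(i y) restores complex linearity. *)
Lemma complex_hahn_banach (R : realType) (Y : normedModType R[i])
  (X : lmodType R[i]) (J : {linear X -> Y}) (phi : X -> R[i]) :
  (forall a x y, phi (a *: x + y) = a * phi x + phi y) ->
  (forall x, `|phi x| <= `|J x|) ->
  exists T : Y -> R[i], [/\ forall a x y, T (a *: x + y) = a * T x + T y,
    forall y, `|T y| <= `|y| & forall x, T (J x) = phi x].
Proof.
move=> lphi bphi; pose N (y : Y) := complex.Re `|y|.
have NE y : (N y)%:C%C = `|y| by rewrite RRe_real ?normr_real.
have ND u v : N (u + v) <= N u + N v by rewrite -lecR rmorphD /= !NE ler_normD.
have NZ t v : 0 < t -> N (t%:C%C *: v) = t * N v.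
  move=> t0; apply: (@complexI R); rewrite rmorphM /= !NE normrZ; congr (_ * _).
  by rewrite ger0_norm// ler0c ltW.
have phi0 : phi 0 = 0.
  have := lphi 1 0 0; rewrite scaler0 addr0 mul1r => /eqP.
  by rewrite -subr_eq0 opprD addrA subrr sub0r oppr_eq0 => /eqP.
have ReD (a b : R[i]) : complex.Re (a + b) = complex.Re a + complex.Re b.
  by case: a b => [? ?] [? ?].
have ReZ (t : R) (b : R[i]) : complex.Re (t%:C%C * b) = t * complex.Re b.
  by case: b => ? ?; rewrite /= mul0r subr0.
pose G0 := [set p : Y * R | exists x, p = (J x, complex.Re (phi x))].
have [|||u [lu Nu Gu]] := @real_hahn_banach R Y N ND NZ G0.
- by exists 0; rewrite linear0 phi0.
- move=> t _ _ _ _ [x [-> ->]] [y [-> ->]]; exists (t%:C%C *: x + y).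
  by rewrite linearP lphi ReD ReZ.
- move=> _ _ [x [-> ->]]; rewrite -lecR NE (le_trans _ (bphi x))//.
  by rewrite (le_trans _ (normc_ge_Re _))// lecR ler_norm.
have u0 : u 0 = 0 by apply: Gu; exists 0; rewrite linear0 phi0.
have uD x y : u (x + y) = u x + u y.
  by have := lu 1 x y; rewrite rmorph1 scale1r mul1r.
have uZ t x : u (t%:C%C *: x) = t * u x by rewrite -[_ *: _]addr0 lu u0 addr0.
have uN x : u (- x) = - u x.
  by have := uZ (-1) x; rewrite rmorphN1 scaleN1r mulN1r.
pose T y : R[i] := Complex (u y) (- u ('i%C *: y)).
have TD x y : T (x + y) = T x + T y.
  by rewrite /T scalerDr !uD opprD.
have TZ a x : T (a *: x) = a * T x.
  case: a => s t; have -> : Complex s t = s%:C%C + t%:C%C * 'i%C.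
    by apply/eqP; rewrite eq_complex /=; apply/andP; split; apply/eqP; ring.
  have e : 'i%C *: ((s%:C + t%:C * 'i)%C *: x) = s%:C%C *: ('i%C *: x) - t%:C%C *: x.
    rewrite !scalerA mulrDr mulrCA -expr2 sqr_i mulrN1 scalerDl scaleNr.
    by rewrite [_ * s%:C%C]mulrC.
  rewrite /T e scalerDl uD uZ -scalerA uZ uD uN !uZ.
  by apply/eqP; rewrite eq_complex /=; apply/andP; split; apply/eqP; ring.
exists T; split.
- by move=> a x y; rewrite TD TZ.
- move=> y; have [->|Ty0] := eqVneq (T y) 0; first by rewrite normr0.
  (* A rotation that makes T(y) real and nonnegative; there T agrees with u, which is bounded by the
     norm. *)
  pose th := `|T y| / T y.
  have nth : `|th| = 1 by rewrite normf_div normr_id divff// normr_eq0.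
  have e : T (th *: y) = `|T y| by rewrite TZ divfK.
  have : u (th *: y) <= N (th *: y) := Nu _.
  rewrite -lecR NE normrZ nth mul1r; apply: le_trans.
  have -> : u (th *: y) = complex.Re (T (th *: y)) by [].
  by rewrite e RRe_real ?normr_real.
- move=> x; rewrite /T -linearZ.
  have -> : u (J x) = complex.Re (phi x) by apply: Gu; exists x.
  have -> : u (J ('i%C *: x)) = complex.Re (phi ('i%C *: x)).
    by apply: Gu; exists ('i%C *: x).
  have -> : phi ('i%C *: x) = 'i%C * phi x.
    by have := lphi 'i%C x 0; rewrite !addr0 phi0 addr0.
  by case: (phi x) => s t /=; apply/eqP; rewrite eq_complex /=; apply/andP; split;
    apply/eqP; ring.
Qed.

(** * From a discrete reproducing formula to a projection *)

Section projection_from_quadrature.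
Variables (R : realType) (n p q : nat).
Local Notation H := (Hsphere R n p q).
Implicit Types (g : H).

Lemma Hsphere_norm g : `|g| = (supnorm g)%:C%C.
Proof. by []. Qed.

Lemma le_supnorm g x : complex.Re `|g x| <= supnorm g.
Proof.
apply: ub_le_sup; last by exists x.
case: g => g /= /asboolP[f [/bihomogeneous_zpoly/zpoly_bounded[M hM] _] ->].
by exists M => _ [y _ <-]; exact: hM.
Qed.

Lemma supnorm_le g (M : R) : 0 <= M -> (forall x, complex.Re `|g x| <= M) ->
  supnorm g <= M.
Proof.
move=> M0 hM; rewrite /supnorm; set A := (X in sup X).
have [->|/set0P A0] := eqVneq A set0; first by rewrite sup0.
by apply: ge_sup => // _ [x _ <-]; exact: hM.
Qed.

Lemma Hsphere_sumE (I : Type) (r : seq I) (a : I -> R[i]) (K : I -> H) x :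
  (\sum_(i <- r) a i *: K i) x = \sum_(i <- r) a i * K i x.
Proof.
elim: r => [|i r IH]; first by rewrite !big_nil.
by rewrite !big_cons -IH.
Qed.

(** With T_i the extension of evaluation at [x i], the projection is y |-> J(sum of T_i(y) K_i). As
    T_i has norm at most 1, B is a bound for the Lebesgue function of the formula and does not
    depend on Y. *)
Lemma projection_constant_le (I : finType) (x : I -> sphere R n) (K : I -> H)
    (B : R) : 0 <= B -> (forall g, \sum_i g (x i) *: K i = g) ->
  (forall z, \sum_i complex.Re `|K i z| <= B) ->
  (projection_constant H <= B%:E)%E.
Proof.
move=> B0 hK hB; apply: ge_ereal_sup => _ [Y [J [Jiso ->]]].
have /choice[T hT] : forall i, exists T : Y -> R[i],
    [/\ forall a x y, T (a *: x + y) = a * T x + T y,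
    forall y, `|T y| <= `|y| & forall g, T (J g) = g (x i)].
  move=> i; apply: (@complex_hahn_banach R Y H J (fun g => g (x i))) => // g.
  rewrite Jiso Hsphere_norm -(RRe_real (normr_real (g (x i)))) lecR.
  exact: le_supnorm.
pose P y := J (\sum_i T i y *: K i).
have Plin : linear P.
  move=> a u v; rewrite /P -linearP scaler_sumr -big_split /=; congr (J _).
  by apply: eq_bigr => i _; have [-> _ _] := hT i; rewrite scalerDl scalerA.
pose PL : {linear Y -> Y} := HB.pack P (GRing.isLinear.Build _ _ _ _ P Plin).
have PJ g : P (J g) = J g.
  rewrite /P; congr (J _); rewrite -[RHS]hK; apply: eq_bigr => i _.
  by have [_ _ ->] := hT i.
have oP : (opnorm PL <= B%:E)%E.
  apply: ge_ereal_sup => _ [y /= y1 <-]; rewrite lee_fin /P Jiso Hsphere_norm /=.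
  apply: supnorm_le => // z; apply: (le_trans _ (hB z)).
  rewrite -lecR RRe_real ?normr_real// Hsphere_sumE.
  rewrite (le_trans (ler_norm_sum _ _ _))// rmorph_sum; apply: ler_sum => i _.
  rewrite -[leRHS]/((complex.Re `|K i z|)%:C%C) RRe_real ?normr_real// normrM ler_piMl//.
  by have [_ Ti _] := hT i; exact: le_trans (Ti y) y1.
apply: (le_trans _ oP); apply: ereal_inf_lbound; exists PL => //.
split; first exact: le_lt_trans oP (ltry _).
  apply/seteqP; split=> [_ [y _ <-]|_ [g _ <-]]; first by exists (\sum_i T i y *: K i).
  by exists (J g).
by move=> _ [g _ <-]; exact: PJ.
Qed.

End projection_from_quadrature.

Lemma Re_normZ (R : realType) (c : R) (v : R[i]) : 0 <= c ->
  complex.Re `|c%:C%C * v| = c * complex.Re `|v|.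
Proof.
move=> c0; apply: (@complexI R); rewrite rmorphM !RRe_real ?normr_real//.
by rewrite normrM ger0_norm// ler0c.
Qed.

Section zonal_projection.
Variables (R : realType) (n k d1 d2 : nat).
Hypotheses (n2 : (2 <= n)%N) (d0 : (d1 * d2 = 0)%N).
Local Notation H := (Hsphere R n (k + d1) (k + d2)).
Local Notation zonal := (@zonal R n k d1 d2).
Local Notation scale := (zonal_scale R n k d1 d2).

Let Hzonal_subproof (c : R[i]) (y : sphere R n) :
  (fun z : sphere R n => c * zonal (val y) (val z)) \in
    @harmonic_on_sphere R n (k + d1) (k + d2).
Proof.
apply/asboolP; exists (fun z => c * zonal (val y) z) => //.
have hz := bidegree_zonal k d1 d2 (val y).
split; first exact: bidegree_bihomogeneous (bidegree_scale c hz).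
move=> z; have := @laplacian_sum R n unit [:: tt] (fun=> c) (fun=> zonal (val y)) z.
rewrite big_seq1 laplacian_zonal ?sqnorm_sphere// mulr0 => <-.
  by congr (laplacian _ z); apply/funext => z'; rewrite big_seq1.
by move=> _; exact: bidegree_zpoly hz.
Qed.

Lemma projection_constant_zonal (g : {poly R}) :
  (forall s, 0 <= s <= 1 -> s ^+ (d1 + d2) <= g.[s ^+ 2]) ->
  (projection_constant H <= (scale * \sum_(m < k.+1)
    `|jacobi_coef R n k (d1 + d2) m| * dot_moment n ((1 - 'X) ^+ m * g))%:E)%E.
Proof.
move=> hg; have n0 : (0 < n)%N by exact: ltnW.
(* Large enough both for the reproducing formula, of degree p + q, and for the moments of the
   majorant; the successor makes D positive. *)
pose D := (k + d1 + (k + d2) + size g).+1.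
have [I [w [x [w0 w1 ibp]]]] := @spherical_design R n D n0 isT.
have D1 : (k + d1 + (k + d2) <= D)%N by rewrite /D; lia.
have D2 : (k + size g <= D)%N by rewrite /D; lia.
have s0 : 0 <= scale by rewrite divr_ge0 ?mulr_ge0 ?ler0n.
have bound (z : sphere R n) := zonal_mean_le n2 w1 ibp (sqnorm_sphere z) w0 D2 hg.
pose K i : H := MkHsphere (Hzonal_subproof ((w i)%:C%C * scale%:C%C) (x i)).
have KE i z : complex.Re `|K i z| = scale * (w i * complex.Re `|zonal (val (x i)) (val z)|).
  rewrite (_ : K i z = (scale * w i)%:C%C * zonal (val (x i)) (val z)).
    by rewrite Re_normZ ?mulr_ge0// mulrA.
  by rewrite [(scale * w i)%R]mulrC rmorphM.
(* Some point of the sphere, at which [bound] shows the right-hand side to be nonnegative. *)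
have [z _] := sphere_normalize (0 : 'rV[R[i]]_n) n0.
apply: (projection_constant_le (x := x) (K := K)).
- rewrite mulr_ge0// (le_trans _ (bound z))//; apply: sumr_ge0 => i _.
  by rewrite mulr_ge0// -ler0c RRe_real ?normr_real.
- move=> h; apply: val_inj; apply/funext => y.
  transitivity (\sum_i h (x i) * K i y); first exact: Hsphere_sumE.
  case: h => h /= /asboolP[f [/bihomogeneous_bidegree hf lf] hE].
  rewrite hE -[RHS](zonal_reproducing n2 w1 ibp D1 hf lf (sqnorm_sphere y)).
  rewrite mulr_sumr; apply: eq_bigr => i _.
  by move: (w i)%:C%C scale%:C%C (f _) (zonal _ _) => *; ring.
- move=> y; under eq_bigr do rewrite KE.
  by rewrite -mulr_sumr ler_wpM2l//; exact: bound.
Qed.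

End zonal_projection.

(** * Beta and Gamma integrals *)

Section beta_integral.
Variable R : realType.
Local Notation mu := (@lebesgue_measure R).
Implicit Types (a b t : R) (N : nat).

Lemma continuous_powR_itv a b : 0 <= a -> 0 < b ->
  {within `[0, b], continuous (@powR R ^~ a)}.
Proof.
move=> a0 b0; have cpos t : 0 < t -> {for t, continuous (@powR R ^~ a)}.
  move=> t0; apply: differentiable_continuous; apply/derivable1_diffP.
  by apply: derivable_powR; rewrite in_itv/= andbT.
apply/continuous_within_itvP => //; split.
- by move=> t; rewrite in_itv/= => /andP[t0 _]; exact: cpos.
(* The power with exponent 0 is the constant 1, at the origin too; for a > 0 the value at the origin
   is 0. *)
- have [->|an0] := eqVneq a 0.
    rewrite powRr0; under eq_fun do rewrite powRr0; exact: cvg_cst.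
  by rewrite powR0//; apply: powR_cvg0; rewrite lt_neqAle eq_sym an0.
- by apply: cvg_at_left_filter; exact: cpos.
Qed.

Lemma continuous_horner_itv (P : {poly R}) (A : set R) :
  {within A, continuous (fun t => P.[t])}.
Proof. by apply: continuous_subspaceT; exact: continuous_horner. Qed.

Lemma integrable_itv01 (f : R -> R) : {within `[0, 1], continuous f} ->
  mu.-integrable `[0, 1] (EFin \o f).
Proof.
by move=> cf; apply: continuous_compact_integrable => //; exact: segment_compact.
Qed.

Lemma continuous_mul_itv (A : set R) (f g : R -> R) :
  {within A, continuous f} -> {within A, continuous g} ->
  {within A, continuous (fun t => f t * g t)}.
Proof. by move=> cf cg t; apply: cvgM; [exact: cf|exact: cg]. Qed.

Lemma continuous_onem_itv N (A : set R) :
  {within A, continuous (fun t : R => (1 - t) ^+ N)}.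
Proof.
have -> : (fun t : R => (1 - t) ^+ N) = fun t => ((1 - 'X) ^+ N).[t].
  by apply/funext => t; rewrite horner_exp !hornerE.
exact: continuous_horner_itv.
Qed.

Lemma integrable_beta a N : 0 <= a ->
  mu.-integrable `[0, 1] (EFin \o (fun t : R => (1 - t) ^+ N * t `^ a)).
Proof.
move=> a0; apply: integrable_itv01; apply: continuous_mul_itv.
  exact: continuous_onem_itv.
exact: continuous_powR_itv.
Qed.

Lemma Rintegral_powR a : 0 <= a ->
  \int[mu]_(t in `[0, 1]) t `^ a = (a + 1)^-1.
Proof.
move=> a0; have a1 : 0 < a + 1 by lra.
have a1n : a + 1 != 0 by rewrite gt_eqF.
pose F (t : R) := (a + 1)^-1 * t `^ (a + 1).
have dF t : 0 < t -> is_derive t 1 F (t `^ a).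
  move=> t0; have := is_derive1_powR (a + 1) t0; rewrite addrK => h.
  have -> : t `^ a = (a + 1)^-1 *: ((a + 1) * t `^ a).
    by rewrite /GRing.scale /= mulrA mulVf// mul1r.
  exact: is_deriveZ.
have cF : {within `[0, 1], continuous F}.
  apply: (@continuous_mul_itv _ (fun=> _)); first by move=> ?; exact: cvg_cst.
  by apply: continuous_powR_itv => //; exact: ltW.
rewrite /Rintegral (@continuous_FTC2 _ _ F)//.
- by rewrite -EFinB /= /F powR1 powR0// mulr0 mulr1 subr0.
- exact: continuous_powR_itv.
- have /continuous_within_itvP-/(_ ltr01)[_ c0 c1] := cF; split => //.
  by move=> t; rewrite in_itv/= => /andP[t0 _]; have [] := dF t t0.
- move=> t; rewrite in_itv/= => /andP[t0 _].
  by rewrite derive1E; have [_ ->] := dF t t0.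
Qed.

(** Recursion in N from (1-t)^(N+1) = (1-t)^N - t (1-t)^N, which trades the last factor for a raised
    by 1. *)
Lemma beta_integralE a N : 0 <= a ->
  \int[mu]_(t in `[0, 1]) ((1 - t) ^+ N * t `^ a) =
  N`!%:R / \prod_(i < N.+1) (a + 1 + i%:R).
Proof.
elim: N a => [|N IH] a a0.
  under eq_Rintegral do rewrite expr0 mul1r.
  by rewrite Rintegral_powR// big_ord1 addr0 mul1r.
have a1 : 0 <= a + 1 by lra.
have step : \int[mu]_(t in `[0, 1]) ((1 - t) ^+ N.+1 * t `^ a) =
    \int[mu]_(t in `[0, 1]) ((1 - t) ^+ N * t `^ a) -
    \int[mu]_(t in `[0, 1]) ((1 - t) ^+ N * t `^ (a + 1)).
  rewrite -RintegralB//; [|exact: integrable_beta..].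
  apply: eq_Rintegral => t; rewrite inE/= in_itv/= => /andP[t0 _].
  have -> : t `^ (a + 1) = t * t `^ a.
    have a1p : 0 < a + 1 by lra.
    by have := mulr_powRB1 t0 a1p; rewrite addrK => ->.
  by rewrite exprSr; ring.
rewrite step !IH//.
have pos (c : R) : 0 < c -> forall M, \prod_(i < M) (c + i%:R) != 0.
  move=> c0 M; apply/prodf_neq0 => i _; rewrite gt_eqF//.
  by apply: (lt_le_trans c0); rewrite lerDl.
have P1 : \prod_(i < N.+2) (a + 1 + i%:R) =
    (a + 1) * \prod_(i < N.+1) (a + 1 + 1 + i%:R).
  rewrite big_ord_recl addr0; congr (_ * _); apply: eq_bigr => i _.
  by rewrite /bump /= natrD addrA.
have P2 : \prod_(i < N.+2) (a + 1 + i%:R) =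
    \prod_(i < N.+1) (a + 1 + i%:R) * (a + 1 + N.+1%:R).
  by rewrite big_ord_recr.
have ap1 : 0 < a + 1 by rewrite ltr_wpDl.
have ap2 : 0 < a + 1 + 1 by rewrite ltr_wpDl.
have n1 := pos _ ap1 N.+1; have n2 := pos _ ap2 N.+1; have n3 := pos _ ap1 N.+2.
have e1 : (\prod_(i < N.+1) (a + 1 + i%:R))^-1 =
    (a + 1 + N.+1%:R) / \prod_(i < N.+2) (a + 1 + i%:R).
  apply: (mulIf n3); rewrite divfK// P2 mulrA mulVf// mul1r//.
have e2 : (\prod_(i < N.+1) (a + 1 + 1 + i%:R))^-1 =
    (a + 1) / \prod_(i < N.+2) (a + 1 + i%:R).
  apply: (mulIf n3); rewrite divfK// P1 mulrCA mulVf// mulr1//.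
rewrite e1 e2 factS natrM; set P := (\prod_(i < _) _)^-1.
by rewrite -natr1; ring.
Qed.

(** The moments j! (n-1)! / (n-1+j)! are those of the density (n-1) (1-t)^(n-2) on [0, 1]. *)
Lemma dot_momentE (n : nat) (P : {poly R}) : (2 <= n)%N ->
  dot_moment n P = n.-1%:R * \int[mu]_(t in `[0, 1]) ((1 - t) ^+ (n - 2) * P.[t]).
Proof.
move=> n2; have [N nE] : exists N, n = N.+2 by exists (n - 2)%N; rewrite -addn2 subnK.
have -> : (n - 2 = N)%N by rewrite nE -addn2 addnK.
have mom j : \int[mu]_(t in `[0, 1]) ((1 - t) ^+ N * t ^+ j) =
    (j`! * N`!)%:R / (n.-1 + j)`!%:R.
  transitivity (\int[mu]_(t in `[0, 1]) ((1 - t) ^+ N * t `^ j%:R)).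
    apply: eq_Rintegral => t; rewrite inE/= in_itv/= => /andP[t0 _].
    by rewrite powR_mulrn.
  rewrite beta_integralE// nE /=.
  have -> : \prod_(i < N.+1) (j%:R + 1 + i%:R) = (N.+1 + j)`!%:R / j`!%:R :> R.
    elim: (N.+1) => [|M IHM].
      by rewrite big_ord0 add0n divff// pnatr_eq0 -lt0n fact_gt0.
    rewrite big_ord_recr /= IHM addSn factS natrM.
    by rewrite -mulrA mulrC -[(M + j).+1%:R]natr1 natrD; ring.
  by rewrite invf_div natrM mulrA [N`!%:R * _]mulrC.
have lin (r : seq nat) : \int[mu]_(t in `[0, 1]) ((1 - t) ^+ N *
    \sum_(j <- r) P`_j * t ^+ j) =
    \sum_(j <- r) P`_j * \int[mu]_(t in `[0, 1]) ((1 - t) ^+ N * t ^+ j).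
  have cj j : {within `[0, 1], continuous (fun t : R => (1 - t) ^+ N * t ^+ j)}.
    apply: continuous_mul_itv; first exact: continuous_onem_itv.
    by apply: continuous_subspaceT; exact: exprn_continuous.
  elim: r => [|j r IHr].
    rewrite big_nil; under eq_Rintegral do rewrite big_nil mulr0.
    by rewrite Rintegral_cst// mul0r.
  rewrite big_cons -IHr -RintegralZl//; last exact: integrable_itv01.
  rewrite -RintegralD//.
  - by apply: eq_Rintegral => t _; rewrite big_cons mulrDr mulrCA.
  - apply: integrable_itv01; apply: (@continuous_mul_itv _ (fun=> _)) => //.
    by move=> ?; exact: cvg_cst.
  - apply: integrable_itv01; apply: continuous_mul_itv; first exact: continuous_onem_itv.
    have -> : (fun t : R => \sum_(j0 <- r) P`_j0 * t ^+ j0) =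
        fun t => (\sum_(j0 <- r) P`_j0 *: 'X^j0).[t].
      apply/funext => t; rewrite horner_sum; apply: eq_bigr => i _.
      by rewrite hornerZ hornerXn.
    exact: continuous_horner_itv.
have linP := lin (index_iota 0 (size P)).
under eq_Rintegral do rewrite horner_coef -(big_mkord predT (fun j => P`_j * _ ^+ j)).
rewrite linP /dot_moment -(big_mkord predT (fun j => P`_j * ((j`! * n.-1`!)%:R / (n.-1 + j)`!%:R))).
rewrite mulr_sumr; apply: eq_bigr => j _; rewrite mom nE /= factS.
by rewrite !natrM; ring.
Qed.

(** The hypothesis on g is read at s = sqrt t, where s^d is t^(d/2); the error e is integrated
    against a weight at most 1. *)
Lemma dot_moment_le (n m d : nat) (g : {poly R}) (e : R) : (2 <= n)%N ->
  0 <= e -> (forall s, 0 <= s <= 1 -> g.[s ^+ 2] <= s ^+ d + e) ->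
  dot_moment n ((1 - 'X) ^+ m * g) <= n.-1%:R *
    (\int[mu]_(t in `[0, 1]) ((1 - t) ^+ (n + m - 2) * t `^ (d%:R / 2)) + e).
Proof.
move=> n2 e0 hg; rewrite dot_momentE// ler_wpM2l//.
have d0 : 0 <= d%:R / 2 :> R by rewrite divr_ge0.
have eE : e = \int[mu]_(t in `[0, 1]) e.
  transitivity (\int[mu]_(t in `[0, 1]) (e * ((1 - t) ^+ 0 * t `^ 0))).
    rewrite RintegralZl ?beta_integralE//; last exact: integrable_beta.
    by rewrite big_ord1 fact0 add0r addr0 divr1 mulr1.
  by apply: eq_Rintegral => t _; rewrite expr0 powRr0 !mulr1.
have ie : mu.-integrable `[0, 1] (EFin \o (fun=> e)).
  by apply: integrable_itv01 => ?; exact: cvg_cst.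
rewrite [in leRHS]eE -RintegralD//; last exact: integrable_beta.
apply: le_Rintegral => //.
- apply: integrable_itv01; apply: continuous_mul_itv; first exact: continuous_onem_itv.
  exact: continuous_horner_itv.
- have cb : {within `[0, 1], continuous
      (fun t : R => (1 - t) ^+ (n + m - 2) * t `^ (d%:R / 2))}.
    apply: continuous_mul_itv; first exact: continuous_onem_itv.
    exact: continuous_powR_itv.
  by apply: integrable_itv01 => t; apply: cvgD; [exact: cb|exact: cvg_cst].
- move=> t; rewrite /= in_itv/= => /andP[t0 t1].
  have s01 : 0 <= Num.sqrt t <= 1 by rewrite sqrtr_ge0 -sqrtr1 ler_sqrt.
  have := hg _ s01; rewrite sqr_sqrtr//.
  have -> : Num.sqrt t ^+ d = t `^ (d%:R / 2).
    by rewrite mulrC powRrM powR12_sqrt// powR_mulrn// sqrtr_ge0.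
  have -> : ((1 - 'X) ^+ m * g).[t] = (1 - t) ^+ m * g.[t].
    by rewrite hornerM horner_exp !hornerE.
  move=> h; rewrite mulrA -exprD.
  have -> : (n - 2 + m = n + m - 2)%N by rewrite addnBAC.
  have p0 : 0 <= (1 - t) ^+ (n + m - 2) by rewrite exprn_ge0// subr_ge0.
  apply: (le_trans (ler_wpM2l p0 h)); rewrite mulrDr lerD2l ler_piMl//.
  by rewrite exprn_ile1 ?subr_ge0// lerBlDl lerDr.
Qed.

(** The iteration v |-> v + (t - v^2) / 2 started at 0 stays below s = sqrt t. The invariant (s - v)
    (2 + k s) <= 2 s bounds its error by 2/k uniformly on [0, 1], and a final shift by e turns it
    into a majorant. *)
Lemma sqrt_poly_approx (e : R) : 0 < e -> exists u : {poly R},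
  forall s, 0 <= s <= 1 -> s <= u.[s ^+ 2] <= s + e.
Proof.
move=> e0.
(* [s - u_{k+1}(s^2) = (s - u_k(s^2)) (1 - (s + u_k(s^2)) / 2)] *)
pose u := fix u k : {poly R} :=
  if k is k'.+1 then u k' + 2^-1 *: ('X - u k' ^+ 2) else 0.
have uE k s : (u k.+1).[s ^+ 2] =
    (u k).[s ^+ 2] + (s ^+ 2 - (u k).[s ^+ 2] ^+ 2) / 2.
  by rewrite /= !hornerE mulrC.
have hu k s : 0 <= s <= 1 -> 0 <= (u k).[s ^+ 2] <= s /\
    (s - (u k).[s ^+ 2]) * (2 + k%:R * s) <= 2 * s.
  move=> /andP[s0 s1]; elim: k => [|k [/andP[u0 us] IH]].
    by rewrite /= horner0 lexx s0; split => //; lra.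
  rewrite uE -[k.+1%:R]natr1; move: ((u k).[s ^+ 2]) u0 us IH => v v0 vs IH.
  have k0 : 0 <= k%:R * s by rewrite mulr_ge0.
  move: (k%:R) k0 IH => K K0 IH.
  have h1 : 0 <= (s - v) * (s + v) by rewrite mulr_ge0 ?subr_ge0 ?addr_ge0.
  have h2 : 0 <= (s - v) * (2 - (s + v)).
    by rewrite mulr_ge0 ?subr_ge0//; lra.
  have e1 : s ^+ 2 - v ^+ 2 = (s - v) * (s + v) by ring.
  have e2 : (s - v) * (2 - (s + v)) = 2 * (s - v) - (s - v) * (s + v) by ring.
  rewrite e2 in h2; split.
    rewrite e1; move: ((s - v) * (s + v)) h1 h2 => x h1 h2.
    by apply/andP; split; lra.
  have -> : (s - (v + (s ^+ 2 - v ^+ 2) / 2)) * (2 + (K + 1) * s) =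
    (s - v) * ((1 - (s + v) / 2) * (2 + K * s + s)) by field.
  apply: le_trans IH; apply: ler_wpM2l; first by lra.
  have h3 : 0 <= (s + v) * (K * s) by rewrite mulr_ge0 ?addr_ge0.
  have h4 : 0 <= (s + v) * s by rewrite mulr_ge0 ?addr_ge0.
  have -> : (1 - (s + v) / 2) * (2 + K * s + s) =
    2 + K * s - v - (s + v) * (K * s) / 2 - (s + v) * s / 2 by field.
  move: ((s + v) * (K * s)) ((s + v) * s) h3 h4 => x y x0 y0.
  by lra.
have [k hk] : exists k : nat, 2 / e < k%:R.
  by exists (Num.truncn (2 / e)).+1; exact: truncnS_gt.
exists (u k + e%:P) => s s01; have [/andP[v0 vs] h] := hu k s s01.
have /andP[s0 s1] := s01.
rewrite !hornerE; move: ((u k).[_]) v0 vs h => v v0 vs h.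
have ke : 2 < k%:R * e by rewrite -ltr_pdivrMr.
apply/andP; split; last by lra.
have [->|sn0] := eqVneq s 0; first by lra.
have sp : 0 < s by rewrite lt_neqAle eq_sym sn0.
have : (s - v) * (k%:R * s) <= 2 * s.
  apply: le_trans h; apply: ler_wpM2l; lra.
rewrite mulrA ler_pM2r// => h2.
have kp : 0 < k%:R :> R by rewrite (lt_trans _ hk)// divr_gt0.
rewrite -lerBlDl -(ler_pM2r kp) (le_trans h2)// ltW// mulrC//.
Qed.

Lemma power_poly_approx (d : nat) (e : R) : 0 < e -> exists g : {poly R},
  forall s, 0 <= s <= 1 -> s ^+ d <= g.[s ^+ 2] <= s ^+ d + e.
Proof.
move=> e0; have [c c0 hc] : exists2 c : R, 0 <= c & forall x s : R,
    0 <= x <= 1 -> 0 <= s <= 1 -> (s + x) ^+ d <= s ^+ d + c * x.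
  elim: d => [|d [c c0 hc]].
    by exists 0 => // x s _ _; rewrite !expr0 mul0r addr0.
  exists (1 + c * 2); first by rewrite addr_ge0// mulr_ge0.
  move=> x s x01 s01; have := hc x s x01 s01.
  have /andP[x0 x1] := x01; have /andP[s0 s1] := s01.
  rewrite !exprSr => h; apply: (@le_trans _ _ ((s ^+ d + c * x) * (s + x))).
    by rewrite ler_wpM2r// addr_ge0.
  have : s ^+ d <= 1 by rewrite exprn_ile1.
  have : 0 <= s ^+ d by rewrite exprn_ge0.
  move: (s ^+ d) => y y0 y1.
  have cx : 0 <= c * x by rewrite mulr_ge0.
  have -> : (y + c * x) * (s + x) = y * s + (y * x + (c * x) * (s + x)) by ring.
  rewrite lerD2l mulrDl mul1r lerD//; first by rewrite ler_piMl.
  by rewrite [leRHS]mulrAC ler_wpM2l//; lra.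
pose x := Num.min 1 (e / (c + 1)).
have c1 : 0 < c + 1 by lra.
have x0 : 0 < x by rewrite lt_min ltr01 divr_gt0.
have x1 : x <= 1 by rewrite ge_min lexx.
have xe : c * x <= e.
  have : x <= e / (c + 1) by rewrite ge_min lexx orbT.
  rewrite ler_pdivlMr// => h; nra.
have [u hu] := sqrt_poly_approx x0.
exists (u ^+ d) => s s01; have /andP[h1 h2] := hu s s01.
have /andP[s0 s1] := s01; rewrite horner_exp; apply/andP; split.
  by rewrite lerXn2r ?nnegrE// (le_trans s0).
apply: (@le_trans _ _ ((s + x) ^+ d)).
  by rewrite lerXn2r ?nnegrE ?(le_trans s0 h1) ?addr_ge0 ?(ltW x0).
apply: (le_trans (hc x s _ s01)); first by rewrite (ltW x0).
by rewrite lerD2l.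
Qed.

End beta_integral.

(** * The Gamma function at arguments at least 1 *)

Section gamma_function.
Variable R : realType.
Local Notation mu := (@lebesgue_measure R).
Implicit Types (a b c t x : R).

Let g a t : R := t `^ a * expR (- t).
Let G a : \bar R := (\int[mu]_(t in `[0%R, +oo[) (g a t)%:E)%E.

Let g_ge0 a t : 0 <= g a t.
Proof. by rewrite mulr_ge0 ?powR_ge0 ?expR_ge0. Qed.

Let measurable_g a (A : set R) : measurable_fun A (g a).
Proof.
apply: (measurable_funS measurableT) => //; apply: measurable_funM.
  exact: measurable_powR.
by apply: measurableT_comp => //; exact: measurable_expR.
Qed.

Let derive_g a t : 0 < t ->
  is_derive t 1 (g (a + 1)) ((a + 1) * g a t - g (a + 1) t).
Proof.
move=> t0; have := is_derive1_powR (a + 1) t0; rewrite addrK => h.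
have -> : (a + 1) * g a t - g (a + 1) t =
   t `^ (a + 1) *: (- expR (- t)) + expR (- t) *: ((a + 1) * t `^ a).
  by rewrite /g /GRing.scale /=; ring.
apply: is_deriveM.
by apply: is_derive_eq; rewrite /GRing.scale /=; ring.
Qed.

Let continuous_g_pos a t : 0 < t -> {for t, continuous (g a)}.
Proof.
move=> t0; apply: differentiable_continuous; apply/derivable1_diffP.
by have := derive_g (a - 1) t0; rewrite subrK => -[].
Qed.

Let continuous_g a b : 0 <= a -> 0 < b -> {within `[0, b], continuous (g a)}.
Proof.
move=> a0 b0; apply: continuous_mul_itv; first exact: continuous_powR_itv.
apply: continuous_subspaceT => t.
by apply: (@continuous_comp _ _ _ -%R expR); [exact: opp_continuous|exact: continuous_expR].
Qed.

Let cvg_g a : g a t @[t --> +oo] --> (0 : R).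
Proof.
(* With a < N, the bound t^(N+1) <= (N+1)! exp(t) leaves a spare factor 1/t. *)
pose N := (Num.truncn a).+1; pose K : R := N.+1`!%:R.
have K0 : 0 < K by rewrite ltr0n fact_gt0.
apply/cvgrPdist_le => e e0; near=> t.
rewrite sub0r normrN ger0_norm//.
have t1 : 1 <= t by near: t; apply: nbhs_pinfty_ge; exact: num_real.
have t0 : 0 < t by exact: lt_le_trans t1.
have te : K / e <= t by near: t; apply: nbhs_pinfty_ge; exact: num_real.
have h1 : t `^ a <= t ^+ N.
  rewrite -powR_mulrn ?(ltW t0)// ler_powR// ltW//; exact: truncnS_gt.
have h2 := expR_ge1Dxn N (ltW t0).
rewrite /g expRN ler_pdivrMr ?expR_gt0//; apply: (le_trans h1).
have h3 : t ^+ N.+1 <= K * expR t.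
  rewrite mulrC -ler_pdivrMr//; apply: le_trans h2.
  by rewrite lerDr.
rewrite -(ler_pM2r t0) -exprSr (le_trans h3)// mulrAC ler_pM2r ?expR_gt0//.
by rewrite mulrC -ler_pdivrMr.
Unshelve. all: by end_near. Qed.

(* Split at t = a + 1, where the derivative of [g (a + 1)] changes sign: only
   integrals of nonnegative functions occur, and finiteness is not needed. *)
Let G_rec a : 0 <= a -> G (a + 1) = ((a + 1)%:E * G a)%E.
Proof.
move=> a0; set c := a + 1; have c0 : 0 < c by rewrite ltr_wpDl.
have gc t : 0 <= t -> g c t = t * g a t.
  by move=> t0; rewrite /g mulrA; congr (_ * _); rewrite -(mulr_powRB1 t0 c0) /c addrK.
have mE (A : set R) (f : R -> R) : measurable_fun A f ->
  measurable_fun A (fun t => (f t)%:E) by move=> mf; exact/measurable_EFinP.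
have split_ b : G b = (\int[mu]_(t in `[0%R, c]) (g b t)%:E +
    \int[mu]_(t in `[c, +oo[) (g b t)%:E)%E.
  rewrite /G (@itv_bndbnd_setU _ _ _ (BRight c))//; last by rewrite bnd_simp ltW.
  rewrite ge0_integral_setU//=.
  - by rewrite integral_itv_obnd_cbnd//; apply: mE; exact: measurable_g.
  - apply: mE; exact: measurable_g.
  - by move=> t _; rewrite lee_fin.
  - apply/disj_setPS => t [/=]; rewrite !in_itv/= andbT => /andP[_ tc] ct.
    by have := lt_le_trans ct tc; rewrite ltxx.
have F0 : g c 0 = 0 by rewrite /g powR0 ?mul0r// gt_eqF.
have low : (\int[mu]_(t in `[0%R, c]) (c * g a t - g c t)%:E = (g c c)%:E)%E.
  rewrite (@continuous_FTC2 _ _ (g c))//.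
  - by rewrite F0 sube0.
  - move=> t; apply: cvgB; last exact: continuous_g (ltW c0) c0 t.
    by apply: cvgM; [exact: cvg_cst|exact: continuous_g a0 c0 t].
  - have /continuous_within_itvP-/(_ c0)[_ h0 h1] := continuous_g (ltW c0) c0.
    split=> // t; rewrite in_itv/= => /andP[t0 _].
    by have [] := derive_g a t0.
  - move=> t; rewrite in_itv/= => /andP[t0 _].
    by rewrite derive1E; have [_ ->] := derive_g a t0.
have high : (\int[mu]_(t in `[c, +oo[) (g c t - c * g a t)%:E = (g c c)%:E)%E.
  rewrite (@ge0_continuous_FTC2y _ _ (fun t => - g c t) c 0)//.
  - by rewrite EFinN oppeK add0e.
  - move=> t ct; rewrite gc; last by rewrite (le_trans _ ct)// ltW.
    by rewrite -mulrBl mulr_ge0// subr_ge0.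
  - have cpos b : {within `[c, +oo[, continuous (g b)}.
      apply: continuous_in_subspaceT => t; rewrite inE/= in_itv/= andbT => ct.
      by apply: continuous_g_pos; exact: lt_le_trans ct.
    move=> t; apply: cvgB; first exact: cpos.
    by apply: cvgM; [exact: cvg_cst|exact: cpos].
  - by rewrite -oppr0; apply: cvgN; exact: cvg_g.
  - move=> t ct; have t0 := lt_trans c0 ct.
    by apply: derivableN; have [] := derive_g a t0.
  - by apply: cvgN; apply: cvg_at_right_filter; exact: continuous_g_pos.
  - move=> t; rewrite in_itv/= andbT => ct; have t0 := lt_trans c0 ct.
    have [dg eg] := derive_g a t0.
    by rewrite derive1E deriveN// eg opprB.
have mc (A : set R) : measurable_fun A (fun t => c * g a t).
  by apply: measurable_funM => //; exact: measurable_g.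
have e1 : (\int[mu]_(t in `[0%R, c]) (c * g a t)%:E =
    (g c c)%:E + \int[mu]_(t in `[0%R, c]) (g c t)%:E)%E.
  rewrite -low -ge0_integralD//.
  - by apply: eq_integral => t _; rewrite -EFinD subrK.
  - move=> t /=; rewrite in_itv/= => /andP[t0 tc]; rewrite lee_fin gc//.
    by rewrite -mulrBl mulr_ge0// subr_ge0.
  - by apply: mE; apply: measurable_funB => //; exact: measurable_g.
  - by move=> t _; rewrite lee_fin.
  - apply: mE; exact: measurable_g.
have e2 : (\int[mu]_(t in `[c, +oo[) (g c t)%:E =
    (g c c)%:E + \int[mu]_(t in `[c, +oo[) (c * g a t)%:E)%E.
  rewrite -high -ge0_integralD//.
  - by apply: eq_integral => t _; rewrite -EFinD subrK.
  - move=> t /=; rewrite in_itv/= andbT => ct; rewrite lee_fin gc; last first.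
      by rewrite (le_trans _ ct)// ltW.
    by rewrite -mulrBl mulr_ge0// subr_ge0.
  - by apply: mE; apply: measurable_funB => //; exact: measurable_g.
  - by move=> t _; rewrite lee_fin mulr_ge0// ltW.
  - by apply: mE.
have cI (D : set R) : measurable D -> (\int[mu]_(t in D) (c * g a t)%:E =
    c%:E * \int[mu]_(t in D) (g a t)%:E)%E.
  move=> mD; under eq_integral do rewrite EFinM.
  rewrite ge0_integralZl_EFin//; last exact: ltW.
  - by move=> t _; rewrite lee_fin.
  - by apply: mE; exact: measurable_g.
rewrite split_ e2 (split_ a) ge0_muleDr; first last.
- by apply: integral_ge0 => t _; rewrite lee_fin.
- by apply: integral_ge0 => t _; rewrite lee_fin.
by rewrite -!cI// e1 addeCA addeA.
Qed.

Let G0 : G 0 = 1%E.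
Proof.
rewrite /G (@ge0_continuous_FTC2y _ _ (fun t => - expR (- t)) 0 0)//.
- by rewrite oppr0 expR0 EFinN oppeK add0e.
- apply/continuous_within_itvcyP; split.
    by move=> t; rewrite in_itv/= andbT; exact: continuous_g_pos.
  have /continuous_within_itvP-/(_ ltr01)[_ h _] := continuous_g (lexx 0) ltr01.
  exact: h.
- by rewrite -oppr0; apply: cvgN; exact: cvgr_expR.
- apply: cvgN; apply: cvg_at_right_filter.
  by apply: (@continuous_comp _ _ _ -%R expR); [exact: opp_continuous|exact: continuous_expR].
- move=> t; rewrite in_itv/= andbT => t0; rewrite derive1E derive_val.
  by rewrite /g powRr0 mul1r /GRing.scale /=; ring.
Qed.

Let G_leD a b c : (forall t, 0 <= t -> t `^ a <= t `^ b + t `^ c) ->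
  (G a <= G b + G c)%E.
Proof.
move=> abc; rewrite /G -ge0_integralD//.
- apply: ge0_le_integral => //.
  + by move=> t _; rewrite lee_fin.
  + by apply/measurable_EFinP; exact: measurable_g.
  + by apply: emeasurable_funD; apply/measurable_EFinP; exact: measurable_g.
  + move=> t /=; rewrite in_itv/= andbT => t0; rewrite lee_fin /g -mulrDl.
    by rewrite ler_wpM2r ?expR_ge0// abc.
- by move=> t _; rewrite lee_fin.
- by apply/measurable_EFinP; exact: measurable_g.
- by move=> t _; rewrite lee_fin.
- by apply/measurable_EFinP; exact: measurable_g.
Qed.

(** For exponents b in [0, 1], t^b <= 1 + t gives finiteness. Positivity follows from t <= t^b +
    t^(b+1): if G b were 0, so would be G (b+1) by the recursion, against G 1 = 1. The recursion
    then reaches larger exponents. *)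
Let G_gt0 a : 0 <= a -> (0 < G a < +oo)%E.
Proof.
have base b : 0 <= b <= 1 -> (0 < G b < +oo)%E.
  move=> /andP[b0 b1].
  have G1 : G 1 = 1%E by rewrite -[1%R]add0r G_rec// add0r G0 mul1e.
  have le1 : (G b <= G 0 + G 1)%E.
    apply: G_leD => t t0; rewrite powRr0 powRr1//.
    have [t1|t1] := leP t 1.
      rewrite (@le_trans _ _ 1) ?lerDl//.
      have <- : (1 : R) `^ b = 1 by rewrite powR1.
      by rewrite ge0_ler_powR ?nnegrE.
    rewrite (@le_trans _ _ t) ?lerDr//.
    by rewrite -[leRHS](powRr1 t0) ler_powR// ltW.
  have le2 : (G 1 <= G b + G (b + 1))%E.
    apply: G_leD => t t0; rewrite powRr1//.
    have [->|tn0] := eqVneq t 0; first by rewrite addr_ge0 ?powR_ge0.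
    have tp : 0 < t by rewrite lt_neqAle eq_sym tn0.
    have [t1|t1] := leP t 1.
      rewrite (@le_trans _ _ (t `^ b)) ?lerDl ?powR_ge0//.
      by rewrite -[leLHS](powRr1 t0) ger_powR// tp.
    rewrite (@le_trans _ _ (t `^ (b + 1))) ?lerDr ?powR_ge0//.
    by rewrite -[leLHS](powRr1 t0) ler_powR ?lerDr// ltW.
  apply/andP; split; last first.
    by apply: (le_lt_trans le1); rewrite G0 G1 -EFinD ltry.
  have Gb0 : (0 <= G b)%E by apply: integral_ge0 => t _; rewrite lee_fin.
  rewrite lt_neqAle Gb0 andbT; apply/negP => /eqP e.
  by move: le2; rewrite G1 G_rec// -e mule0 adde0 lee_fin ler10.
move=> a0; have [k ak] : exists k : nat, a <= k%:R.
  by exists (Num.truncn a).+1; rewrite ltW// truncnS_gt.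
elim: k a a0 ak => [|k IH] a a0 ak.
  by apply: base; rewrite a0 (le_trans ak).
have [a1|a1] := leP a 1; first by apply: base; rewrite a0.
have b0 : 0 <= a - 1 by rewrite subr_ge0 ltW.
have /andP[h1 h2] : (0 < G (a - 1) < +oo)%E.
  by apply: IH => //; rewrite lerBlDr natr1.
rewrite -(subrK 1 a) G_rec// subrK; apply/andP; split.
  by rewrite mule_gt0// lte_fin (lt_trans ltr01).
have := h1; have := h2; case: (G (a - 1)) => // r _ _.
by rewrite -EFinM ltry.
Qed.

Let GammaE x : 1 <= x -> (Gamma x)%:E = G (x - 1).
Proof.
move=> x1; rewrite /Gamma /Rintegral.
have -> : (\int[mu]_(t in `]0%R, +oo[) (t `^ (x - 1) * expR (- t))%:E = G (x - 1))%E.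
  by rewrite /G integral_itv_obnd_cbnd//; apply/measurable_EFinP; exact: measurable_g.
have x0 : 0 <= x - 1 by rewrite subr_ge0.
have /andP[h1 h2] := G_gt0 x0.
by rewrite fineK// ge0_fin_numE// ltW.
Qed.

Lemma Gamma_gt0 x : 1 <= x -> 0 < Gamma x.
Proof.
move=> x1; rewrite -lte_fin GammaE//.
by have /andP[] : (0 < G (x - 1) < +oo)%E by rewrite G_gt0// subr_ge0.
Qed.

Lemma Gamma1 : Gamma (1 : R) = 1.
Proof. by apply: EFin_inj; rewrite GammaE// subrr G0. Qed.

Lemma GammaS x : 1 <= x -> Gamma (x + 1) = x * Gamma x.
Proof.
move=> x1; apply: EFin_inj; rewrite EFinM !GammaE//; last by rewrite ler_wpDl// (le_trans _ x1).
by rewrite addrAC G_rec ?subr_ge0// subrK.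
Qed.

Lemma Gamma_nat k : Gamma (k.+1%:R : R) = k`!%:R.
Proof.
elim: k => [|k IH]; first by rewrite Gamma1.
by rewrite -natr1 GammaS ?ler1n// IH factS natrM.
Qed.

Lemma Gamma_prod x k : 1 <= x ->
  Gamma (x + k%:R) = \prod_(i < k) (x + i%:R) * Gamma x.
Proof.
move=> x1; elim: k => [|k IH]; first by rewrite addr0 big_ord0 mul1r.
rewrite -natr1 addrA GammaS; last by rewrite ler_wpDr.
by rewrite IH big_ord_recr /= mulrCA mulrA.
Qed.

End gamma_function.

(** * The bounds *)

Section bounds.
Variable R : realType.
Local Notation mu := (@lebesgue_measure R).
Local Notation jint n m d := (\int[mu]_(t in `[0, 1])
  ((1 - t) ^+ (n + m - 2) * t `^ (d / 2))).

Lemma projection_constant_jacobi (n k d1 d2 : nat) :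
  (2 <= n)%N -> (d1 * d2 = 0)%N ->
  (projection_constant (Hsphere R n (k + d1) (k + d2)) <=
    (zonal_scale R n k d1 d2 * \sum_(m < k.+1) `|jacobi_coef R n k (d1 + d2) m| *
      (n.-1%:R * jint n m (d1 + d2)%:R))%:E)%E.
Proof.
move=> n2 d0; set S := zonal_scale _ _ _ _ _; pose I (m : nat) := jint n m (d1 + d2)%:R.
set c := jacobi_coef R n k (d1 + d2).
have S0 : 0 <= S by rewrite divr_ge0 ?mulr_ge0 ?ler0n.
pose C1 := S * \sum_(m < k.+1) `|c m| * n.-1%:R.
have C10 : 0 <= C1 by rewrite mulr_ge0// sumr_ge0// => m _; rewrite mulr_ge0.
apply/lee_addgt0Pr => e e0; have C1p : 0 < C1 + 1 by rewrite ltr_wpDl.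
(* The majorant's error is multiplied by C1 in the bound, so this share keeps the total at most e
   even when C1 = 0. *)
have e1 : 0 < e / (C1 + 1) by rewrite divr_gt0.
have [g hg] := power_poly_approx (d1 + d2) e1.
have hg1 s : 0 <= s <= 1 -> s ^+ (d1 + d2) <= g.[s ^+ 2] by move=> /hg/andP[].
have hg2 s : 0 <= s <= 1 -> g.[s ^+ 2] <= s ^+ (d1 + d2) + e / (C1 + 1).
  by move=> /hg/andP[].
apply: (le_trans (@projection_constant_zonal R n k d1 d2 n2 d0 g hg1)); rewrite -EFinD lee_fin.
apply: (@le_trans _ _ (S * \sum_(m < k.+1) `|c m| *
    (n.-1%:R * (I m + e / (C1 + 1))))).
  rewrite ler_wpM2l//; apply: ler_sum => m _; rewrite ler_wpM2l//.
  exact: (dot_moment_le m n2 (ltW e1) hg2).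
have -> : \sum_(m < k.+1) `|c m| * (n.-1%:R * (I m + e / (C1 + 1))) =
    \sum_(m < k.+1) `|c m| * (n.-1%:R * I m) +
    (\sum_(m < k.+1) `|c m| * n.-1%:R) * (e / (C1 + 1)).
  by rewrite mulr_suml -big_split; apply: eq_bigr => m _ /=; ring.
rewrite mulrDr lerD2l mulrA -/C1 mulrCA ler_piMr ?(ltW e0)//.
by rewrite ler_pdivrMr// mul1r lerDl.
Qed.

(** All Gamma arguments are positive integers, so the bound is the previous one in terms of
    factorials; the factor n - 1 of the density reduces (n-1)! to Gamma(n-1). *)
Lemma projection_constant_integral (n p q : nat) : (2 <= n)%N ->
  (projection_constant (Hsphere R n p q) <=
      ((n%:R + p%:R + q%:R - 1) * Gamma (n%:R - 1 + (minn p q)%:R) /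
         (Gamma (n%:R - 1 : R) * Gamma (1 + p%:R) * Gamma (1 + q%:R)) *
       \sum_(0 <= m < (minn p q).+1)
          ('C(minn p q, m)%:R *
           (Gamma (n%:R - 1 + m%:R + (maxn p q)%:R) / Gamma (n%:R - 1 + m%:R)) *
           jint n m `|p%:R - q%:R|))%:E)%E.
Proof.
move=> n2; pose k := minn p q; pose d1 := (p - k)%N; pose d2 := (q - k)%N.
have pE : p = (k + d1)%N by rewrite /d1 /k; lia.
have qE : q = (k + d2)%N by rewrite /d2 /k; lia.
have d0 : (d1 * d2 = 0)%N.
  by case: (leqP p q) => pq; rewrite /d1 /d2 /k; [rewrite (minn_idPl pq)|rewrite (minn_idPr (ltnW pq))];
    rewrite subnn ?muln0.
have mE : maxn p q = (k + (d1 + d2))%N by rewrite /d1 /d2 /k; lia.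
have dE : `|p%:R - q%:R| = (d1 + d2)%:R :> R.
  rewrite {1}pE {1}qE !natrD opprD addrACA subrr add0r.
  have [->|->] : d1 = 0%N \/ d2 = 0%N.
    by move/eqP: d0; rewrite muln_eq0 => /orP[] /eqP ->; [left|right].
    by rewrite sub0r add0r normrN ger0_norm.
  by rewrite subr0 addr0 ger0_norm.
have [N nE] : exists N, n = N.+2 by exists (n - 2)%N; lia.
have G1 (j : nat) : Gamma (n%:R - 1 + j%:R : R) = (N + j)`!%:R.
  by rewrite nE -natr1 addrK -natrD addSn Gamma_nat.
have G2 (i j : nat) : Gamma (n%:R - 1 + i%:R + j%:R : R) = (N + (i + j))`!%:R.
  by rewrite -addrA -natrD G1.
have G0 : Gamma (n%:R - 1 : R) = N`!%:R by have := G1 0%N; rewrite addr0 addn0.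
have GS (j : nat) : Gamma (1 + j%:R : R) = j`!%:R by rewrite addrC natr1 Gamma_nat.
have H := projection_constant_jacobi k n2 d0; rewrite -pE -qE in H.
apply: (le_trans H); rewrite lee_fin le_eqVlt; apply/orP; left; apply/eqP.
rewrite -/k G0 !GS G1 mE dE /zonal_scale -pE -qE big_mkord mulr_sumr mulr_sumr.
apply: eq_bigr => m _; rewrite G2 G1 /jacobi_coef.
have -> : (n - 2 = N)%N by lia.
have sgn : `|(-1) ^+ m * 'C(k, m)%:R * (N + m + k + (d1 + d2))`!%:R / (N + m)`!%:R| =
    'C(k, m)%:R * ((N + (m + (k + (d1 + d2))))`!%:R / (N + m)`!%:R) :> R.
  rewrite !normrM normrX normrN1 expr1n mul1r normfV !ger0_norm// !addnA.
  by rewrite mulrA.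
rewrite sgn.
have -> : n%:R + p%:R + q%:R - 1 = (n.-1 + (p + q))%:R :> R.
  by rewrite nE /= !natrD -[N.+2%:R]natr1; ring.
move: (jint n m _) => J; rewrite nE /= factS !natrM.
have f1 : N.+1%:R != 0 :> R by rewrite pnatr_eq0.
have fn (j : nat) : j`!%:R != 0 :> R by rewrite pnatr_eq0 -lt0n fact_gt0.
move: (fn N) (fn p) (fn q) (fn (N + m)%N).
move: (N + (m + (k + (d1 + d2))))`!%:R (N + m)`!%:R (N + k)`!%:R N`!%:R p`!%:R q`!%:R.
move: 'C(k, m)%:R (N.+1 + (p + q))%:R N.+1%:R f1 => a b c c0 x y z u v w u0 v0 w0 y0.
by field; rewrite u0 v0 w0 y0 c0.
Qed.

End bounds.

(** * The bound in Gamma form and its limit *)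

Section gamma_bounds.
Variable R : realType.
Local Notation mu := (@lebesgue_measure R).

Lemma beta_Gamma (a : R) (N : nat) : 0 <= a ->
  \int[mu]_(t in `[0, 1]) ((1 - t) ^+ N * t `^ a) =
  N`!%:R * (Gamma (a + 1) / Gamma (a + 1 + N.+1%:R)).
Proof.
move=> a0; have a1 : 1 <= a + 1 by rewrite lerDr.
rewrite beta_integralE// Gamma_prod//; congr (_ * _).
rewrite invfM mulrCA divff ?mulr1//.
by rewrite gt_eqF// Gamma_gt0.
Qed.

(** The Beta integral contributes (n+m-2)!, which cancels Gamma(n-1+m); the half-integers (p-q)/2
    survive in the last quotient only. *)
Lemma projection_constant_Gamma (n p q : nat) : (2 <= n)%N -> (q <= p)%N ->
  (projection_constant (Hsphere R n p q) <=
      (Gamma (n%:R - 1 + q%:R) / (Gamma (n%:R - 1 : R) * Gamma (1 + q%:R)) *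
       \sum_(0 <= m < q.+1)
          ('C(q, m)%:R * (n%:R + p%:R + q%:R - 1) *
           (Gamma (n%:R - 1 + m%:R + p%:R) / Gamma (1 + p%:R)) *
           (Gamma ((p%:R - q%:R) / 2 + 1) /
            Gamma (n%:R + m%:R + (p%:R - q%:R) / 2))))%:E)%E.
Proof.
move=> n2 qp; apply: (le_trans (projection_constant_integral R p q n2)).
rewrite lee_fin le_eqVlt; apply/orP; left; apply/eqP.
rewrite (minn_idPr qp) (maxn_idPl qp) !mulr_sumr; apply: eq_bigr => m _.
have pq0 : 0 <= p%:R - q%:R :> R by rewrite subr_ge0 ler_nat.
rewrite ger0_norm//; set a := (p%:R - q%:R) / 2.
have a0 : 0 <= a by rewrite divr_ge0.
rewrite beta_Gamma//.
have [N nE] : exists N, n = N.+2 by exists (n - 2)%N; lia.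
have -> : (n + m - 2 = N + m)%N by lia.
have -> : n%:R + m%:R + a = a + 1 + (N + m).+1%:R.
  by rewrite nE -[N.+2%:R]natr1 -[N.+1%:R]natr1 -[(N + m).+1%:R]natr1 natrD; ring.
have -> : Gamma (n%:R - 1 + m%:R : R) = (N + m)`!%:R.
  by rewrite nE -natr1 addrK -natrD addSn Gamma_nat.
have g1 : Gamma (n%:R - 1 : R) != 0.
  by rewrite gt_eqF// Gamma_gt0// nE -natr1 addrK ler1n.
have g2 (j : nat) : Gamma (1 + j%:R : R) != 0 by rewrite gt_eqF// Gamma_gt0// lerDl.
have g3 : (N + m)`!%:R != 0 :> R by rewrite pnatr_eq0 -lt0n fact_gt0.
have g4 : Gamma (a + 1 + (N + m).+1%:R) != 0.
  by rewrite gt_eqF// Gamma_gt0// ler_wpDr// lerDr.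
move: (g2 p) (g2 q) g1 g3 g4.
move: (Gamma (1 + p%:R)) (Gamma (1 + q%:R)) (Gamma (n%:R - 1)) => x y z.
move: (N + m)`!%:R (Gamma (_ + _.+1%:R)) (Gamma (a + 1)) => b c d.
move: (Gamma (n%:R - 1 + m%:R + p%:R)) (Gamma (n%:R - 1 + q%:R)) => e f.
move: 'C(q, m)%:R (n%:R + p%:R + q%:R - 1) => g h x0 y0 z0 b0 c0.
by field; rewrite x0 y0 z0 b0 c0.
Qed.

Lemma cvgn_near_eq (f g : nat -> R) (l : R) :
  (\forall p \near \oo, f p = g p) -> f p @[p --> \oo] --> l ->
  g p @[p --> \oo] --> l.
Proof. by move=> fg; apply: cvg_trans; apply: near_eq_cvg. Qed.

Lemma cvg_affine_ratio (u v w : R) :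
  (fun p : nat => (p%:R + u) / ((p%:R - v) / 2 + w) : R) @ \oo --> (2 : R).
Proof.
pose x (p : nat) : R := (p%:R - v) / 2 + w.
have xoo : x p @[p --> \oo] --> +oo.
  apply/cvgryPge => A; near=> p.
  have h : 2 * (A - w) + v <= p%:R by near: p; exact: nbhs_infty_ger.
  rewrite /x; lra.
have xpos : \forall p \near \oo, 0 < x p.
  by move/cvgryPgt : xoo => /(_ 0).
have xV : (x p)^-1 @[p --> \oo] --> (0 : R) by apply/gtr0_cvgV0.
(* With x the denominator, p + u = 2 x + (u + v - 2 w). *)
have : 2 + (u + v - 2 * w) * (x p)^-1 @[p --> \oo] --> 2 + (u + v - 2 * w) * 0.
  by apply: cvgD; [exact: cvg_cst|apply: cvgM; [exact: cvg_cst|exact: xV]].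
rewrite mulr0 addr0; apply: cvg_trans; apply: near_eq_cvg; near=> p.
have x0 : 0 < x p by near: p.
have xn0 : x p != 0 by rewrite gt_eqF.
apply: (mulIf xn0); rewrite mulrDl divfK// -mulrA mulVf// /x.
by field.
Unshelve. all: by end_near. Qed.

Lemma cvg_prod_affine_ratio (q M : nat) :
  (fun p : nat => \prod_(i < M)
    ((p%:R + (1 + i%:R)) / ((p%:R - q%:R) / 2 + (1 + i%:R))) : R)
    @ \oo --> (2 ^+ M : R).
Proof.
elim: M => [|M IH].
  rewrite expr0; under eq_fun do rewrite big_ord0.
  exact: cvg_cst.
rewrite exprSr; under eq_fun do rewrite big_ord_recr /=.
exact: cvgM IH (cvg_affine_ratio _ _ _).
Qed.

(** The upper limit is an infimum of suprema over the sets of the filter at infinity, so for each e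
    one tail on which b <= l + e is enough. *)
Lemma limn_esup_le (u : nat -> \bar R) (b : nat -> R) (l : R) (k : nat) :
  (forall p, (k <= p)%N -> (u p <= (b p)%:E)%E) -> b p @[p --> \oo] --> l ->
  (limn_esup u <= l%:E)%E.
Proof.
move=> ub bl; apply/lee_addgt0Pr => e e0.
pose A := [set p | (k <= p)%N /\ b p <= l + e].
have FA : (\oo : set_system nat) A.
  have /cvgrPdist_le/(_ e e0) h := bl.
  near=> p; split; first by near: p; exact: nbhs_infty_ge.
  have : `|l - b p| <= e by near: p.
  by rewrite ler_norml => /andP[h1 _]; lra.
apply: (@le_trans _ _ (ereal_sup (u @` A))).
  by apply: ereal_inf_lbound; exists A.
apply: ge_ereal_sup => _ [p [kp bp] <-].
by rewrite (le_trans (ub p kp))// -EFinD lee_fin.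
Unshelve. all: by end_near. Qed.

(** With N = n - 2, the two Gamma quotients are products of N + m factors in the numerator and N + m
    + 1 in the denominator; the prefactor n + p + q - 1 pairs with the one left over, and each of
    the N + m + 1 quotients tends to 2. *)
Lemma cvg_Gamma_term (n m q : nat) : (2 <= n)%N ->
  (fun p : nat => (n%:R + p%:R + q%:R - 1) *
    (Gamma (n%:R - 1 + m%:R + p%:R) / Gamma (1 + p%:R)) *
    (Gamma ((p%:R - q%:R) / 2 + 1) /
     Gamma (n%:R + m%:R + (p%:R - q%:R) / 2)) : R)
  @ \oo --> (2 ^+ (n - 1 + m) : R).
Proof.
move=> n2; have [N nE] : exists N, n = N.+2 by exists (n - 2)%N; lia.
have -> : (n - 1 + m = (N + m).+1)%N by lia.
rewrite exprS.
have h : (fun p : nat =>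
    (p%:R + (N%:R + 1 + q%:R)) / ((p%:R - q%:R) / 2 + (1 + (N + m)%:R)) *
    \prod_(i < N + m) ((p%:R + (1 + i%:R)) / ((p%:R - q%:R) / 2 + (1 + i%:R))) : R)
    @ \oo --> (2 * 2 ^+ (N + m) : R).
  exact: (cvgM (@cvg_affine_ratio (N%:R + 1 + q%:R) q%:R (1 + (N + m)%:R))
    (@cvg_prod_affine_ratio q (N + m))).
apply: cvgn_near_eq h; near=> p; rewrite /=.
have qp : (q <= p)%N by near: p; exact: nbhs_infty_ge.
have pq0 : 0 <= p%:R - q%:R :> R by rewrite subr_ge0 ler_nat.
set a := (p%:R - q%:R) / 2; have a0 : 0 <= a by rewrite divr_ge0.
have -> : n%:R + m%:R + a = a + 1 + (N + m).+1%:R.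
  by rewrite nE -[N.+2%:R]natr1 -[N.+1%:R]natr1 -[(N + m).+1%:R]natr1 natrD; ring.
have -> : n%:R - 1 + m%:R + p%:R = 1 + p%:R + (N + m)%:R :> R.
  by rewrite nE -[N.+2%:R]natr1 -[N.+1%:R]natr1 natrD; ring.
have a1 : 1 <= a + 1 by rewrite lerDr.
have p1 : 1 <= 1 + p%:R :> R by rewrite lerDl.
have g1 : Gamma (1 + p%:R : R) != 0 by rewrite gt_eqF// Gamma_gt0.
rewrite (Gamma_prod (N + m) p1) (Gamma_prod _ a1) (mulfK g1).
have g0 : Gamma (a + 1) != 0 by rewrite gt_eqF// Gamma_gt0.
rewrite [_ / (_ * Gamma (a + 1))]mulrC invfM mulfVK//.
rewrite big_ord_recr /= prodf_div invfM.
have -> : \prod_(i < N + m) (1 + p%:R + i%:R) = \prod_(i < N + m) (p%:R + (1 + i%:R)) :> R.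
  by apply: eq_bigr => i _; ring.
have -> : \prod_(i < N + m) (a + 1 + i%:R) = \prod_(i < N + m) (a + (1 + i%:R)) :> R.
  by apply: eq_bigr => i _; ring.
have -> : n%:R + p%:R + q%:R - 1 = p%:R + (N%:R + 1 + q%:R) :> R.
  by rewrite nE -[N.+2%:R]natr1 -[N.+1%:R]natr1; ring.
rewrite -[a + 1 + _]addrA.
move: (\prod_(i < _) _)^-1 (\prod_(i < _) _) (_ + (1 + _))^-1 (_ + _) => x y z t.
by ring.
Unshelve. all: by end_near. Qed.

End gamma_bounds.

Lemma cvg_sum_nat (R : realType) (F : nat -> nat -> R) (l : nat -> R) (M : nat) :
  (forall m, F m p @[p --> \oo] --> l m) ->
  \sum_(0 <= m < M) F m p @[p --> \oo] --> \sum_(0 <= m < M) l m.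
Proof.
move=> Fl; elim: M => [|M IH].
  by rewrite big_geq//; under eq_fun do rewrite big_geq//; exact: cvg_cst.
rewrite big_nat_recr//=; under eq_fun do rewrite big_nat_recr//=.
exact: cvgD IH (Fl M).
Qed.

Theorem proposition6p5 (R : realType) (n : nat) (hn : (2 <= n)%N) :
  (forall p q : nat,
    (projection_constant (Hsphere R n p q) <=
      ((n%:R + p%:R + q%:R - 1) * Gamma (n%:R - 1 + (minn p q)%:R) /
         (Gamma (n%:R - 1 : R) * Gamma (1 + p%:R) * Gamma (1 + q%:R)) *
       \sum_(0 <= m < (minn p q).+1)
          ('C(minn p q, m)%:R *
           (Gamma (n%:R - 1 + m%:R + (maxn p q)%:R) / Gamma (n%:R - 1 + m%:R)) *
           \int[lebesgue_measure]_(t in `[0, 1])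
              ((1 - t) ^+ (n + m - 2) * t `^ (`|p%:R - q%:R| / 2))))%:E)%E) /\
  (forall p q : nat, (q <= p)%N ->
    (projection_constant (Hsphere R n p q) <=
      (Gamma (n%:R - 1 + q%:R) / (Gamma (n%:R - 1 : R) * Gamma (1 + q%:R)) *
       \sum_(0 <= m < q.+1)
          ('C(q, m)%:R * (n%:R + p%:R + q%:R - 1) *
           (Gamma (n%:R - 1 + m%:R + p%:R) / Gamma (1 + p%:R)) *
           (Gamma ((p%:R - q%:R) / 2 + 1) /
            Gamma (n%:R + m%:R + (p%:R - q%:R) / 2))))%:E)%E) /\
  (forall q : nat,
    (limn_esup (fun p : nat => projection_constant (Hsphere R n p q)) <=
      (2 ^+ (n - 1) / Gamma (n%:R - 1 : R) *
       (Gamma (n%:R - 1 + q%:R) / Gamma (1 + q%:R)) *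
       \sum_(0 <= m < q.+1) 'C(q, m)%:R * 2 ^+ m)%:E)%E /\
    2 ^+ (n - 1) / Gamma (n%:R - 1 : R) *
       (Gamma (n%:R - 1 + q%:R) / Gamma (1 + q%:R)) *
       (\sum_(0 <= m < q.+1) 'C(q, m)%:R * 2 ^+ m) =
    2 ^+ (n - 1) * 3 ^+ q * 'C(n - 2 + q, q)%:R :> R).
Proof.
split; first by move=> p q; exact: projection_constant_integral.
split; first by move=> p q; exact: projection_constant_Gamma.
move=> q; split; last first.
  have [N nE] : exists N, n = N.+2 by exists (n - 2)%N; rewrite -addn2 subnK.
  have n1E : n%:R - 1 = N.+1%:R :> R by rewrite nE -natr1 addrK.
  have -> : (n - 2 + q = N + q)%N by rewrite nE -addn2 addnK.
  rewrite n1E -natrD addSn addrC natr1 !Gamma_nat.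
  (* The binomial expansion of (1 + 2)^q. *)
  have -> : \sum_(0 <= m < q.+1) 'C(q, m)%:R * 2 ^+ m = 3 ^+ q :> R.
    rewrite (_ : 3 = 1 + 2 :> R) ?exprDn ?big_mkord; last by rewrite nat1r.
    by apply: eq_bigr => m _; rewrite expr1n mul1r mulr_natl.
  have fn (j : nat) : j`!%:R != 0 :> R by rewrite pnatr_eq0 -lt0n fact_gt0.
  have -> : (N + q)`!%:R = 'C(N + q, q)%:R * (q`!%:R * N`!%:R) :> R.
    by rewrite -!natrM -(@bin_fact (N + q) q) ?leq_addl// addnK.
  move: (fn N) (fn q) ('C(_, _)%:R) (2 ^+ _) (3 ^+ q).
  by move: N`!%:R q`!%:R => x y x0 y0 a b c; field; rewrite x0 y0.
pose G0 := Gamma (n%:R - 1 + q%:R) / (Gamma (n%:R - 1 : R) * Gamma (1 + q%:R)).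
pose F (m p : nat) : R := (n%:R + p%:R + q%:R - 1) *
  (Gamma (n%:R - 1 + m%:R + p%:R) / Gamma (1 + p%:R)) *
  (Gamma ((p%:R - q%:R) / 2 + 1) / Gamma (n%:R + m%:R + (p%:R - q%:R) / 2)).
have bl : (fun p : nat => \sum_(0 <= m < q.+1) ('C(q, m)%:R * F m p)) @ \oo -->
    \sum_(0 <= m < q.+1) ('C(q, m)%:R * 2 ^+ (n - 1 + m) : R).
  apply: (@cvg_sum_nat R (fun m p => 'C(q, m)%:R * F m p)) => m.
  by apply: cvgM; [exact: cvg_cst|exact: cvg_Gamma_term].
have {}bl : (fun p : nat => G0 * \sum_(0 <= m < q.+1) ('C(q, m)%:R * F m p)) @ \oo
    --> G0 * \sum_(0 <= m < q.+1) ('C(q, m)%:R * 2 ^+ (n - 1 + m) : R).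
  exact: cvgM (cvg_cst G0) bl.
have -> : 2 ^+ (n - 1) / Gamma (n%:R - 1 : R) *
    (Gamma (n%:R - 1 + q%:R) / Gamma (1 + q%:R)) *
    (\sum_(0 <= m < q.+1) 'C(q, m)%:R * 2 ^+ m) =
    G0 * \sum_(0 <= m < q.+1) ('C(q, m)%:R * 2 ^+ (n - 1 + m)).
  rewrite /G0 invfM !mulr_sumr; apply: eq_bigr => m _; rewrite exprD.
  move: (Gamma (n%:R - 1))^-1 (Gamma (1 + q%:R))^-1 => x y.
  by move: (Gamma _) => z; ring.
apply: (@limn_esup_le R _ _ _ q _ bl) => p qp.
apply: (le_trans (projection_constant_Gamma R hn qp)).
rewrite lee_fin -/G0 le_eqVlt; apply/orP; left; apply/eqP; rewrite /=.
by congr (_ * _); apply: eq_bigr => m _; rewrite /F !mulrA.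
Qed.
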